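(* Let $\mathbb{G}$ be a homogeneous group of homogeneous dimension $Q\geq 3$, let $|\cdot|$ be a homogeneous quasi-norm on $\mathbb{G}$ with unit quasi-sphere $\mathfrak{S}$, let $\mathbb{E}=|x|\frac{d}{d|x|}$ be the Euler operator and let $2^{*}=2Q/(Q-2)$. Then for all $f\in C_0^\infty(\mathbb{G})$ and all $0\leq\delta<\frac{Q^2}{4}$, $$\int_{\mathbb{G}}|\mathbb{E}f(x)|^{2}dx-\delta\int_{\mathbb{G}}|f(x)|^{2}dx\;\geq\;\frac{\left(\frac{Q^{2}}{4}-\delta\right)^{\frac{Q-1}{Q}}}{\left(\frac{(Q-2)^{2}}{4}\right)^{\frac{Q-1}{Q}}}\,S_{Q}\left(\int_{\mathbb{G}}|x|^{2^{*}}|g(|x|)|^{2^{*}}dx\right)^{\frac{2}{2^{*}}},$$ where $$g(r)=\mathcal{M}(f)(r):=\frac{1}{|\mathfrak{S}|}\int_{\mathfrak{S}}f(ry)\,d\sigma(y),\qquad S_{Q}:=|\mathfrak{S}|^{\frac{2}{Q}}\,Q^{\frac{Q-2}{Q}}(Q-2)\left(\frac{\Gamma(Q/2)\Gamma(1+Q/2)}{\Gamma(Q)}\right)^{\frac{2}{Q}}.$$ Moreover, for each such $\delta$ the constant in this inequality is sharp, i.e. it cannot be replaced by any larger constant for which the inequality still holds for all $f\in C_0^\infty(\mathbb{G})$.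
   Context: A homogeneous group $\mathbb{G}$ is a connected simply connected Lie group whose Lie algebra $\mathfrak{g}$ is equipped with a family of dilations $D_\lambda=\mathrm{Exp}(A_0\ln\lambda)$, $\lambda>0$, that are Lie algebra morphisms, where $A_0$ is a diagonalisable linear operator on $\mathfrak{g}$ with positive eigenvalues. The induced dilations on $\mathbb{G}$ are written $x\mapsto\lambda x$, and $Q=\mathrm{Tr}\,A_0$ is the homogeneous dimension. A homogeneous quasi-norm is a continuous function $|\cdot|:\mathbb{G}\to[0,\infty)$ with $|x^{-1}|=|x|$, $|\lambda x|=\lambda|x|$ for $\lambda>0$, and $|x|=0$ iff $x=0$. The unit quasi-sphere is $\mathfrak{S}=\{x\in\mathbb{G}:|x|=1\}$; there is a unique positive Borel measure $\sigma$ on $\mathfrak{S}$ with $\int_{\mathbb{G}}f(x)\,dx=\int_0^\infty\int_{\mathfrak{S}}f(ry)r^{Q-1}\,d\sigma(y)\,dr$ for all $f\in L^1(\mathbb{G})$, where $dx$ is Haar measure; $|\mathfrak{S}|=\sigma(\mathfrak{S})$. The Euler operator is $(\mathbb{E}f)(ry)=r\frac{d}{dr}f(ry)$ for $r>0$, $y\in\mathfrak{S}$, i.e. $\mathbb{E}f(x)=\frac{d}{dt}f(e^tx)|_{t=0}$. $C_0^\infty(\mathbb{G})$ denotes smooth compactly supported functions. *)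

(* Defs.v *)
From HB Require Import structures.
From mathcomp Require Import all_boot all_order all_algebra.
From mathcomp Require Import all_classical all_reals all_analysis.
From mathcomp Require Import complex.

Set Implicit Arguments.
Unset Strict Implicit.
Unset Printing Implicit Defensive.

Import Order.TTheory GRing.Theory Num.Theory.
Import numFieldNormedType.Exports.

Local Open Scope classical_set_scope.
Local Open Scope ring_scope.

Notation normc := ComplexField.Normc.normc.

(* No compatibility between the two structures is assumed here: continuity, and
   indeed smoothness, of the group operations is part of [lie_group]. *)
#[short(type="groupSpaceType")]
HB.structure Definition GroupSpace :=
  {G of Group G & PointedTopological G}.

Section Smoothness.
Context (R : realType).

(* Continuous partial derivatives up to order k on the open set U.  This is the
   usual notion when V is finite-dimensional, the only case used below. *)
Fixpoint Ck (k : nat) (V W : normedModType R) (U : set V) (f : V -> W) : Prop :=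
  (forall x, U x -> {for x, continuous f}) /\
  if k is k'.+1 then
    forall v : V, (forall x, U x -> derivable f x v) /\ Ck k' U ('D_v f)
  else True.

Definition Cinfty (V W : normedModType R) (U : set V) (f : V -> W) : Prop :=
  forall k, Ck k U f.

(* [phi] and [psi] are meaningful on [dom] and [img] only. *)
Record chart (V : normedModType R) (M : topologicalType) := Chart {
  dom : set M;
  img : set V;
  phi : M -> V;
  psi : V -> M
}.

Record is_chart (V : normedModType R) (M : topologicalType) (c : chart V M) :
    Prop := IsChart {
  open_dom : open (dom c);
  open_img : open (img c);
  phi_img : forall x, dom c x -> img c (phi c x);
  psi_dom : forall u, img c u -> dom c (psi c u);
  phiK : forall x, dom c x -> psi c (phi c x) = x;
  psiK : forall u, img c u -> phi c (psi c u) = u;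
  phi_continuous : forall x, dom c x -> {for x, continuous (phi c)};
  psi_continuous : forall u, img c u -> {for u, continuous (psi c)}
}.

Record smooth_atlas (V : normedModType R) (M : topologicalType)
    (A : set (chart V M)) : Prop := SmoothAtlas {
  atlas_chart : forall c, A c -> is_chart c;
  atlas_cover : forall x, exists2 c, A c & dom c x;
  atlas_compatible : forall c d, A c -> A d ->
    Cinfty (img c `&` psi c @^-1` dom d) (phi d \o psi c)
}.

Definition id_atlas (V : normedModType R) : set (chart V V) :=
  [set Chart setT setT id id].
Arguments id_atlas V : clear implicits.

Definition prod_chart (V W : normedModType R) (M N : topologicalType)
    (c : chart V M) (d : chart W N) : chart (V * W)%type (M * N)%type :=
  Chart (dom c `*` dom d) (img c `*` img d)
        (fun x => (phi c x.1, phi d x.2)) (fun u => (psi c u.1, psi d u.2)).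

Definition prod_atlas (V W : normedModType R) (M N : topologicalType)
    (A : set (chart V M)) (B : set (chart W N)) :
    set (chart (V * W)%type (M * N)%type) :=
  [set prod_chart c d | c in A & d in B].

Definition smooth_on (V W : normedModType R) (M N : topologicalType)
    (A : set (chart V M)) (B : set (chart W N)) (O : set M) (f : M -> N) :
    Prop :=
  (forall x, O x -> {for x, continuous f}) /\
  forall c d, A c -> B d ->
    Cinfty (img c `&` psi c @^-1` (O `&` f @^-1` dom d)) (phi d \o f \o psi c).

Definition smooth_fun (V : normedModType R) (M : topologicalType)
    (A : set (chart V M)) (f : M -> R) : Prop :=
  smooth_on A (id_atlas R^o) setT (f : M -> R^o).

Definition simply_connected (M : topologicalType) : Prop :=
  forall g : R -> M, {within `[0, 1], continuous g} -> g 0 = g 1 ->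
  exists H : R * R -> M,
    [/\ {within `[0, 1] `*` `[0, 1], continuous H},
        {in `[0, 1], forall t, H (0, t) = g t},
        {in `[0, 1], forall t, H (1, t) = g 0} &
        {in `[0, 1], forall s, H (s, 0) = g 0 /\ H (s, 1) = g 0}].

End Smoothness.

Arguments id_atlas {R} V.

Section HomogeneousGroup.
Context (R : realType) (n : nat) (G : groupSpaceType).
Implicit Types (A : set (chart 'rV[R]_n G)).

(* Second countability is automatic for connected groups. *)
Record lie_group A : Prop := LieGroup {
  lie_hausdorff : hausdorff_space G;
  lie_atlas : smooth_atlas A;
  lie_mul :
    smooth_on (prod_atlas A A) A setT (fun x : G * G => (x.1 * x.2)%g);
  lie_inv : smooth_on A A setT (fun x : G => (x^-1)%g)
}.

(* Vector fields are given by their action on smooth functions; in each chart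
   they read X = sum_i a_i d/du_i with smooth coefficients a. Their values on
   nonsmooth functions are irrelevant. *)
Definition vector_field A (X : (G -> R) -> G -> R) : Prop :=
  forall c, A c -> exists2 a : 'rV[R]_n -> 'rV[R]_n, Cinfty (img c) a &
    forall f, smooth_fun A f -> forall u, img c u ->
      X f (psi c u) = 'D_(a u) (f \o psi c : 'rV[R]_n -> R^o) u.

Definition left_invariant A (X : (G -> R) -> G -> R) : Prop :=
  forall f, smooth_fun A f -> forall a x : G,
    X (fun y => f (a * y)%g) x = X f (a * x)%g.

Definition field_eq A (X Y : (G -> R) -> G -> R) : Prop :=
  forall f, smooth_fun A f -> X f =1 Y f.

Definition lie_bracket (X Y : (G -> R) -> G -> R) : (G -> R) -> G -> R :=
  fun f x => X (Y f) x - Y (X f) x.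

(* E is a linear isomorphism from R^n onto the Lie algebra of G, that is, the
   choice of a basis of the Lie algebra. *)
Record lie_algebra_basis A (E : 'rV[R]_n -> (G -> R) -> G -> R) : Prop :=
    LieAlgebraBasis {
  basis_field : forall u, vector_field A (E u) /\ left_invariant A (E u);
  basis_linear : forall (a : R) u v,
    field_eq A (E (a *: u + v)) (fun f x => a * E u f x + E v f x);
  basis_inj : forall u v, field_eq A (E u) (E v) -> u = v;
  basis_surj : forall X, vector_field A X -> left_invariant A X ->
    exists u, field_eq A X (E u)
}.

Definition expmx (B : 'M[R]_n) : 'M[R]_n :=
  limn (series (fun k => (k`!)%:R^-1 *: B ^+ k)).

(* Dilations of the Lie algebra in coordinates; operators act on row vectors
   from the right. *)
Definition lie_dil (A0 : 'M[R]_n) (l : R) : 'M[R]_n := expmx (ln l *: A0).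

Record homogeneous_group A (E : 'rV[R]_n -> (G -> R) -> G -> R)
    (A0 : 'M[R]_n) : Prop := HomogeneousGroup {
  hg_lie : lie_group A;
  hg_connected : connected [set: G];
  hg_simply_connected : simply_connected R G;
  hg_basis : lie_algebra_basis A E;
  hg_diag : diagonalizable A0;
  hg_pos : forall a : R, eigenvalue A0 a -> 0 < a;
  hg_morphism : forall l : R, 0 < l -> forall u v w,
    field_eq A (lie_bracket (E u) (E v)) (E w) ->
    field_eq A (lie_bracket (E (u *m lie_dil A0 l)) (E (v *m lie_dil A0 l)))
               (E (w *m lie_dil A0 l))
}.

(* The action of the positive reals on G by Lie group automorphisms whose
   differentials are the dilations of the Lie algebra. Such an action exists
   because G is simply connected, and is unique because G is connected.
   The value [dil l x] is meaningful for 0 < l only. *)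
Record induced_dilations A (E : 'rV[R]_n -> (G -> R) -> G -> R)
    (A0 : 'M[R]_n) (dil : R -> G -> G) : Prop := InducedDilations {
  dil_smooth : smooth_on (prod_atlas (id_atlas R^o) A) A
    [set lx : R^o * G | 0 < (lx.1 : R)] (fun lx => dil lx.1 lx.2);
  dil_morphism : forall l : R, 0 < l -> forall x y,
    dil l (x * y)%g = (dil l x * dil l y)%g;
  dil1 : forall x, dil 1 x = x;
  dilM : forall l m : R, 0 < l -> 0 < m -> forall x,
    dil (l * m) x = dil l (dil m x);
  dil_differential : forall l : R, 0 < l -> forall u f, smooth_fun A f ->
    forall x, E u (f \o dil l) x = E (u *m lie_dil A0 l) f (dil l x)
}.

Record homogeneous_quasi_norm (dil : R -> G -> G) (q : G -> R) : Prop :=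
    HomogeneousQuasiNorm {
  qnorm_continuous : continuous q;
  qnorm_ge0 : forall x, 0 <= q x;
  qnormV : forall x, q (x^-1)%g = q x;
  qnorm_dil : forall l : R, 0 < l -> forall x, q (dil l x) = l * q x;
  qnorm_eq0 : forall x, q x = 0 <-> x = 1%g
}.

Definition quasi_sphere (q : G -> R) : set G := [set x | q x = 1].

Definition borel : Type := g_sigma_algebraType (@open G).

Record haar_measure (mu : {measure set borel -> \bar R}) : Prop :=
    HaarMeasure {
  haar_left_invariant : forall (a : G) (B : set G),
    measurable (B : set borel) -> mu [set (a * x)%g | x in B] = mu B;
  haar_compact : forall K : set G, compact K -> (mu K < +oo)%E;
  haar_neq0 : mu setT != 0%E
}.

(* The measure sigma on the sphere of q is encoded as a Borel measure on G of
   which only the restriction to the sphere is ever used. *)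
Definition sphere_measure (dil : R -> G -> G) (q : G -> R) (Q : R)
    (mu sigma : {measure set borel -> \bar R}) : Prop :=
  forall f : borel -> R, mu.-integrable setT (EFin \o f) ->
    (\int[mu]_x (f x)%:E =
     \int[lebesgue_measure]_(r in `]0%R, +oo[)
       \int[sigma]_(y in quasi_sphere q) (f (dil r y) * r `^ (Q - 1))%:E)%E.

Definition sphere_area (q : G -> R) (sigma : {measure set borel -> \bar R}) :
  R := fine (sigma (quasi_sphere q)).

Definition Cc_infty A (f : G -> R[i]) : Prop :=
  [/\ smooth_fun A (fun x => complex.Re (f x)),
      smooth_fun A (fun x => complex.Im (f x)) &
      compact (closure [set x | f x != 0])].

Definition cderive1 (h : R -> R[i]) (t : R) : R[i] :=
  Complex (derive1 (fun s => complex.Re (h s) : R^o) t)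
          (derive1 (fun s => complex.Im (h s) : R^o) t).

Definition euler (dil : R -> G -> G) (f : G -> R[i]) (x : G) : R[i] :=
  cderive1 (fun t => f (dil (expR t) x)) 0.

Definition spherical_mean (dil : R -> G -> G) (q : G -> R)
    (sigma : {measure set borel -> \bar R}) (f : G -> R[i]) (r : R) : R[i] :=
  let S := quasi_sphere q in
  Complex
    ((sphere_area q sigma)^-1 * \int[sigma]_(y in S) complex.Re (f (dil r y)))
    ((sphere_area q sigma)^-1 * \int[sigma]_(y in S) complex.Im (f (dil r y))).

(* These integrands are nonnegative, so the integrals are taken in the extended
   reals and no integrability convention intervenes. *)
Definition euler_sobolev_ineq (dil : R -> G -> G) (q : G -> R)
    (mu sigma : {measure set borel -> \bar R}) (p delta C : R)
    (f : G -> R[i]) : Prop :=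
  ((\int[mu]_x (normc (euler dil f x) ^+ 2)%:E
     - delta%:E * \int[mu]_x (normc (f x) ^+ 2)%:E)
   >= C%:E * (\int[mu]_x
        (q x `^ p * normc (spherical_mean dil q sigma f (q x)) `^ p)%:E)
        `^ (2 / p))%E.

End HomogeneousGroup.

Definition Gamma (R : realType) (s : R) : R :=
  \int[lebesgue_measure]_(t in `]0, +oo[) (t `^ (s - 1) * expR (- t)).

(* [area] stands for the measure of the unit quasi-sphere. *)
Definition S_const (R : realType) (Q area : R) : R :=
  area `^ (2 / Q) * Q `^ ((Q - 2) / Q) * (Q - 2) *
  (Gamma (Q / 2) * Gamma (1 + Q / 2) / Gamma Q) `^ (2 / Q).

(* Main.v *)
(* In polar coordinates x = r y the function r^(Q/2) f(r y) = h satisfies, with ' = r d/dr and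
   k^2 = Q^2/4 - delta, r^Q (|E f|^2 - delta |f|^2) = |h'|^2 + k^2 |h|^2 - (Q/2) (|h|^2)', whose last
   term integrates to zero, and Jensen's inequality on the quasi-sphere replaces h by its spherical
   mean. What remains is a one-dimensional inequality for int (|h'|^2 + k^2 |h|^2) dr/r, proved by
   Nagy's method: with M = max |h|, the integrand minus k^2 M^(2-p) |h|^p dominates both
   (k M^2 theta(|h|^2/M^2))' and its opposite for an explicit primitive theta, each used on one side
   of the maximum point; the constant follows from a Beta integral and from AM-GM in M.

   Equality holds for h = sech(k t / a)^a with a = (Q-2)/2 and r = e^t. For the sharpness, this
   profile is truncated to a compactly supported C^1 function of ln |x| and approximated, together
   with its Euler derivative, uniformly by smooth functions on the group. The quasi-norm is only
   continuous, so the approximation averages along the dilation flow a smooth function uniformly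
   close to a hat function of ln |x|. Compactness of the quasi-balls comes from the fact that a
   dilation by a small factor is, in a chart, a contraction near the identity, whose basin of
   attraction is an open subgroup, hence all of the connected group. *)

Require Import Defs.
From HB Require Import structures.
From mathcomp Require Import all_boot all_order all_algebra.
From mathcomp Require Import all_classical all_reals all_analysis.
From mathcomp Require Import complex measurable_realfun.
From mathcomp Require Import ring lra.

Set Implicit Arguments.
Unset Strict Implicit.
Unset Printing Implicit Defensive.

Import Order.TTheory GRing.Theory Num.Theory.
Import numFieldNormedType.Exports.

Local Open Scope classical_set_scope.
Local Open Scope ring_scope.

(** * Calculus of C^k maps *)

(** Only |h|^2 enters the argument: |h| need not be differentiable where it vanishes, so theta is a
    function of |h|^2/M^2, and Cauchy-Schwarz for the real and imaginary parts replaces the bound of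
    the derivative of |h| by |h'|. The number 2(theta(1) - theta(0)) is found by inserting the
    squared extremal profile into theta, which gives the integral of sech^(2a+2), a Beta integral.
    Minimising the resulting bound over M loses nothing, because the extremal profile gives
    equality.

    Sharpness is arranged so that one-sided estimates suffice. Truncation never increases the energy
    density, up to an exact derivative, so the extremal energy is an upper bound at once; and the
    truncated profiles increase to the extremal one, so that their p-integrals converge
    monotonically.

    The measure on the quasi-sphere is known only through the polar formula for integrable
    functions. Its finiteness and positivity have to be extracted from that formula, tested on
    shells, before spherical means make sense; this already requires the compactness of the
    quasi-balls. *)

Section CkCalculus.
Context {R : realType}.
Implicit Types V W : normedModType R.

(** The recursion takes ambient limits at the points of [U], never limits relative to [U], so it
    splits over points although a singleton is not open. Smoothness can thus be checked with a
    different chart at each point. *)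
Lemma Ck_pointwise k V W (U : set V) (f : V -> W) :
  Ck k U f <-> forall x, U x -> Ck k [set x] f.
Proof.
elim: k f => [|k IH] f /=; split.
- by move=> [cf _] x Ux; split=> // _ ->; exact: cf.
- by move=> h; split=> // x Ux; have [+ _] := h x Ux; apply.
- move=> [cf df] x Ux; split=> [_ ->|v]; first exact: cf.
  have [d1 /IH d2] := df v.
  by split=> [_ ->|]; [exact: d1|exact: d2].
- move=> h; split=> [x Ux|v]; first by have [+ _] := h x Ux; apply.
  split=> [x Ux|]; first by have [_ /(_ v) [+ _]] := h x Ux; apply.
  by apply/IH => x Ux; have [_ /(_ v) [_ +]] := h x Ux.
Qed.

Lemma CkS k V W (U : set V) (f : V -> W) : Ck k.+1 U f -> Ck k U f.
Proof.
elim: k f => [|k IH] f; first by move=> [].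
move=> [cf df]; split => // v; have [d1 d2] := df v.
by split => //; exact: IH.
Qed.

Lemma Ck_continuous k V W (U : set V) (f : V -> W) x :
  Ck k U f -> U x -> {for x, continuous f}.
Proof. by case: k => [|k] [+ _] Ux; apply. Qed.

Lemma Ck_sub k V W (U U' : set V) (f : V -> W) :
  U' `<=` U -> Ck k U f -> Ck k U' f.
Proof. by move=> UU' /Ck_pointwise h; apply/Ck_pointwise => x /UU'; exact: h. Qed.

Lemma Ck_eq k V W (U : set V) (f g : V -> W) : open U ->
  {in U, f =1 g} -> Ck k U f -> Ck k U g.
Proof.
move=> oU; elim: k f g => [|k IH] f g fg /=.
  move=> [cf _]; split=> // x Ux; rewrite /prop_for /continuous_at.
  rewrite -(fg x) ?inE//.
  apply: cvg_trans (cf x Ux); apply: near_eq_cvg.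
  by near do [apply: fg; rewrite inE]; exact: open_nbhs_nbhs.
have nfg x : U x -> \near x, f x = g x.
  move=> Ux; have : nbhs x U by exact: open_nbhs_nbhs.
  by apply: filterS => y Uy; apply: fg; rewrite inE.
move=> [cf df]; split=> [x Ux|v].
  rewrite /prop_for /continuous_at -(fg x) ?inE//.
  by apply: cvg_trans (cf x Ux); apply: near_eq_cvg; exact: nfg.
have [d1 d2] := df v; split=> [x Ux|].
  exact: near_eq_derivable (nfg x Ux) (d1 x Ux).
apply: IH d2 => x /[!inE] Ux; apply: near_eq_derive; exact: nfg.
Unshelve. all: by end_near. Qed.

Lemma Ck_cst k V W (U : set V) (c : W) : Ck k U (fun=> c).
Proof.
elim: k c => [|k IH] c /=; split=> //; try by move=> x _; exact: cvg_cst.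
move=> v; split=> [x _|]; first exact: derivable_cst.
have -> : 'D_v (fun=> c) = (fun=> (0 : W)) by apply/funext => x; exact: derive_cst.
exact: IH.
Qed.

Lemma CkD k V W (U : set V) (f g : V -> W) : open U ->
  Ck k U f -> Ck k U g -> Ck k U (fun x => f x + g x).
Proof.
move=> oU; elim: k f g => [|k IH] f g.
  by move=> [cf _] [cg _]; split=> // x Ux; apply: cvgD; [exact: cf|exact: cg].
move=> [cf df] [cg dg]; split=> [x Ux|v].
  by apply: cvgD; [exact: cf|exact: cg].
have [df1 df2] := df v; have [dg1 dg2] := dg v; split=> [x Ux|].
  by apply: derivableD; [exact: df1|exact: dg1].
apply: (Ck_eq _ _ (IH _ _ df2 dg2)) => // x /[!inE] Ux.
by rewrite -deriveD //; [exact: df1|exact: dg1].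
Qed.

Lemma CkM k V (U : set V) (f g : V -> R^o) : open U ->
  Ck k U f -> Ck k U g -> Ck k U (fun x => f x * g x : R^o).
Proof.
move=> oU; elim: k f g => [|k IH] f g.
  move=> [cf _] [cg _]; split=> // x Ux.
  by apply: (@cvgM R V _ _ f g); [exact: cf|exact: cg].
move=> Cf Cg; have := Cf; have := Cg; move=> [cg dg] [cf df]; split=> [x Ux|v].
  by apply: (@cvgM R V _ _ f g); [exact: cf|exact: cg].
have [df1 df2] := df v; have [dg1 dg2] := dg v; split=> [x Ux|].
  by apply: derivableM; [exact: df1|exact: dg1].
apply: (Ck_eq _ _ (CkD oU (IH _ _ (CkS Cf) dg2) (IH _ _ (CkS Cg) df2))) => //.
move=> x /[!inE] Ux.
by rewrite (@deriveM _ _ f g) //; [exact: df1|exact: dg1].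
Qed.

Lemma CkZ k V (U : set V) (c : R) (f : V -> R^o) : open U ->
  Ck k U f -> Ck k U (fun x => c * f x : R^o).
Proof. by move=> oU; apply: CkM => //; exact: Ck_cst. Qed.

Lemma Ck_sum k V (U : set V) m (f : 'I_m -> V -> R^o) : open U ->
  (forall i, Ck k U (f i)) -> Ck k U (fun x => \sum_(i < m) f i x : R^o).
Proof.
move=> oU; elim: m f => [|m IH] f Cf.
  by apply: (Ck_eq _ _ (Ck_cst k U (0 : R^o))) => // x _; rewrite big_ord0.
have h : {in U, (fun x => \sum_(i < m) f (widen_ord (leqnSn m) i) x + f ord_max x : R^o)
     =1 (fun x => \sum_(i < m.+1) f i x : R^o)}.
  by move=> x _; rewrite big_ord_recr.
apply: (Ck_eq _ h) => //.
by apply: CkD => //; apply: IH => i; exact: Cf.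
Qed.

(* Precomposition with an affine map [g] of linear part [L]. *)
Lemma Ck_affine k V' V W (U : set V) (g L : V' -> V) (f : V -> W) :
  continuous g -> (forall h x v, g (h *: v + x) = h *: L v + g x) ->
  Ck k U f -> Ck k (g @^-1` U) (f \o g).
Proof.
move=> cg gL; have cfg (f0 : V -> W) : (forall x, U x -> {for x, continuous f0}) ->
    forall x, U (g x) -> {for x, continuous (f0 \o g)}.
  by move=> cf x Ux; apply: (@continuous_comp V' V W g f0); [exact: cg|exact: cf].
elim: k f => [|k IH] f [cf df]; first by split => // x /= Ux; exact: cfg.
have E x v : (fun h : R => h^-1 *: ((f \o g \o shift x) (h *: v) - (f \o g) x)) =
    (fun h : R => h^-1 *: ((f \o shift (g x)) (h *: L v) - f (g x))).
  by apply/funext => h /=; rewrite gL.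
split=> [x /= Ux|v]; first exact: cfg.
have [d1 d2] := df (L v); split=> [x Ux|].
  by rewrite /derivable E; exact: d1.
suff -> : 'D_v (f \o g) = 'D_(L v) f \o g by exact: IH.
by apply/funext => x; rewrite /derive E.
Qed.

Lemma Ck_coord k V n (U : set V) (f : V -> 'rV[R]_n) i : open U ->
  Ck k U f -> Ck k U (fun x => f x 0 i : R^o).
Proof.
move=> oU.
have cc (g : V -> 'rV[R]_n) x : {for x, continuous g} ->
    {for x, continuous (fun x => g x 0 i : R^o)}.
  move=> cg; have : {for x, continuous ((fun M : 'rV[R]_n => M 0 i : R^o) \o g)}.
    by apply: continuous_comp => //; exact: coord_continuous.
  by [].
elim: k f => [|k IH] f [cf df].
  by split => // x Ux; apply: cc; exact: cf.
split=> [x Ux|v]; first by apply: cc; exact: cf.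
have [d1 d2] := df v; split=> [x Ux|].
  by have /derivable_mxP := d1 x Ux; apply.
apply: (Ck_eq _ _ (IH _ d2)) => // x /[!inE] Ux.
by rewrite derive_mx ?mxE//; exact: d1.
Qed.

Lemma Ck_linear k V W (U : set V) (l : {linear V -> W}) :
  continuous l -> Ck k U l.
Proof.
move=> cl; case: k => [|k]; first by split => // x _; exact: cl.
split=> [x _|v]; first exact: cl.
have E x : (fun h : R => h^-1 *: ((l \o shift x) (h *: v) - l x)) @ 0^' --> l v.
  apply: cvg_near_cst; near=> h.
  rewrite /= [l (_ + _)]linearD [l (_ *: _)]linearZZ addrK scalerA mulVf ?scale1r//.
  by near: h; exact: nbhs_dnbhs_neq.
split=> [x _|].
  by apply/cvg_ex; exists (l v); exact: E.
have -> : 'D_v l = (fun=> l v) by apply/funext => x; apply/cvg_lim => //; exact: E.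
exact: Ck_cst.
Unshelve. all: by end_near. Qed.

End CkCalculus.

(** * The chain rule for C^k maps *)

Section ChainRule.
Context {R : realType}.
Implicit Types V W : normedModType R.

Lemma derive_shift_dir V W (f : V -> W) (y e : V) (s : R) :
  derivable f (s *: e + y) e ->
  is_derive s (1 : R^o) (fun t : R^o => f (t *: e + y)) ('D_e f (s *: e + y)).
Proof.
have E : (fun h : R => h^-1 *: (((fun t : R^o => f (t *: e + y)) \o shift (s : R^o)) (h *: (1 : R^o))
       - f (s *: e + y))) =
    (fun h : R => h^-1 *: ((f \o shift (s *: e + y)) (h *: e) - f (s *: e + y))).
  by apply/funext => h /=; rewrite [_%:A]mulr1 scalerDl addrA.
move=> df; split; first by rewrite /derivable E.
by rewrite /derive E.
Qed.

(** The mean value theorem along [e], stated for the deviation from the linear increment: the form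
    in which continuity of the partial derivatives yields differentiability. *)
Lemma increment_le V (f : V -> R^o) (y e : V) (t c eps : R) :
  (forall s, `|s| <= `|t| -> derivable f (s *: e + y) e /\
     `|'D_e f (s *: e + y) - c| <= eps) ->
  `|f (t *: e + y) - f y - t * c| <= `|t| * eps.
Proof.
move=> H.
pose phi (s : R^o) : R^o := f (s *: e + y).
pose dphi (s : R) : R := 'D_e f (s *: e + y).
have f0 : f y = phi 0 by rewrite /phi scale0r add0r.
have D s : `|s| <= `|t| -> is_derive (s : R^o) (1 : R^o) phi (dphi s).
  by move=> /H[df _]; exact: derive_shift_dir.
have MV a b : a <= b -> (forall x, x \in `[a, b] -> `|x| <= `|t|) ->
    exists2 x, `|x| <= `|t| & phi b - phi a = dphi x * (b - a).
  move=> ab sub; have := @MVT_segment R phi dphi a b ab.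
  case=> [x /subset_itv_oo_cc /sub /D //| |x /sub xt E]; last by exists x.
  by apply: derivable_within_continuous => x /sub /D [].
have [x xt E] : exists2 x, `|x| <= `|t| & phi t - phi 0 = dphi x * t.
  have [t0|t0] := leP 0 t.
    have [|x xt] := MV 0 t t0; last by rewrite subr0; exists x.
    by move=> x; rewrite in_itv/= => /andP[x0 xt]; rewrite !ger0_norm.
  have [|x xt] := MV t 0 (ltW t0).
    by move=> x; rewrite in_itv/= => /andP[x0 xt]; rewrite !ler0_norm ?lerN2// ltW.
  by rewrite sub0r mulrN => E; exists x => //; rewrite -[LHS]opprB E opprK.
have [_ le] := H x xt.
rewrite f0 -/(phi t) E mulrC -mulrBr normrM.
by rewrite ler_wpM2l.
Qed.

Lemma mx_norm_coord n (u : 'rV[R]_n) i : `|u 0 i| <= `|u|.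
Proof.
rewrite [leRHS]/Num.Def.normr/= mx_normrE.
exact: (le_bigmax _ (fun ij : 'I_1 * 'I_n => `|u ij.1 ij.2|) (0, i)).
Qed.

Lemma mx_norm_le n (u : 'rV[R]_n) (c : R) : 0 <= c ->
  (forall i, `|u 0 i| <= c) -> `|u| <= c.
Proof.
move=> c0 uc; rewrite [leLHS]/Num.Def.normr/= mx_normrE.
by apply: bigmax_le => // -[i j] _ /=; rewrite ord1.
Qed.

(* Moves from [a] to [a + h] one coordinate at a time. *)
Lemma C1_differentiable n (U : set 'rV[R]_n) (f : 'rV[R]_n -> R^o) a :
  open U -> U a -> Ck 1 U f ->
  differentiable f a /\
  forall h, 'd f a h = \sum_(i < n) h 0 i * 'D_('e_i) f a :> R.
Proof.
move=> oU Ua [_ Df].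
pose L0 (h : 'rV[R]_n) : R^o := \sum_(i < n) h 0 i * 'D_('e_i) f a.
have L0lin : linear L0.
  move=> k u v; rewrite /L0 scaler_sumr -big_split/=; apply: eq_bigr => i _.
  by rewrite !mxE mulrDl -mulrA.
pose LM := GRing.isLinear.Build _ _ _ _ _ L0lin.
pose L : {linear 'rV[R]_n -> R^o} := HB.pack L0 LM.
have Lc : continuous (L : 'rV[R]_n -> R^o).
  apply/linear_bounded_continuous/linear_boundedP => /=.
  apply: filterS (nbhs_pinfty_ge (num_real (\sum_(i < n) `|'D_('e_i) f a|))) => M hM x.
  rewrite /= /L0.
  apply: le_trans (ler_norm_sum _ _ _) _.
  apply: (@le_trans _ _ (\sum_(i < n) `|x| * `|'D_('e_i) f a|)).
    apply: ler_sum => i _; rewrite normrM ler_wpM2r//; exact: mx_norm_coord.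
  by rewrite -mulr_sumr mulrC ler_wpM2r.
have dE : ('d f a = L :> ('rV[R]_n -> R^o)) /\ differentiable f a.
  suff key : f \o shift a = cst (f a) + (L : 'rV[R]_n -> R^o) +o_ (0 : 'rV[R]_n) id.
    have dE : 'd f a = L :> ('rV[R]_n -> R^o) by apply: diff_unique.
    by split => //; apply/diff_locallyP; rewrite dE.
  apply/eqaddoP => e e0.
  (* Each of the [n] coordinate moves costs at most [e / n.+1%:R] times the norm of [h]; the
     successor avoids a division by zero in dimension 0. *)
  have e1 : 0 < e / n.+1%:R by rewrite divr_gt0.
  have : \forall y \near a, U y /\ forall i, `|'D_('e_i) f a - 'D_('e_i) f y| <= e / n.+1%:R.
    apply: filterI; first exact: open_nbhs_nbhs.
    apply: (@filter_forall _ _ (fun i y => `|'D_('e_i) f a - 'D_('e_i) f y| <= e / n.+1%:R) (nbhs a) (nbhs_filter a)) => i.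
    have [_ [ci _]] := Df 'e_i.
    by have /cvgrPdist_le/(_ _ e1) := ci a Ua.
  move=> /nbhs_ballP[d /= d0 Hd].
  have hd0 : \forall h \near (0 : 'rV[R]_n), `|h| < d.
    exact: pseudometric_normed_Zmodule.nbhs0_lt.
  near=> h.
  have hd : `|h| < d. by near: h; exact: hd0.
  pose w (k : nat) : 'rV[R]_n := \row_j (if (j < k)%N then h 0 j else 0).
  have w0 : w 0%N = 0 by apply/rowP => j; rewrite !mxE.
  have wn : w n = h by apply/rowP => j; rewrite !mxE ltn_ord.
  have wS (i : 'I_n) : w i.+1 = h 0 i *: 'e_i + w i.
    apply/rowP => j; rewrite !mxE eqxx/= ltnS leq_eqVlt.
    have [->|/eqP ji] := eqVneq j i; first by rewrite ltnn eqxx mulr1 addr0.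
    by rewrite mulr0 add0r; have [/ord_inj ji'|] := eqP.
  rewrite [X in `|X|](_ : _ =
     \sum_(i < n) (f (w i.+1 + a) - f (w i + a) - h 0 i * 'D_('e_i) f a)); last first.
    rewrite sumrB -/(L0 h) -(big_mkord xpredT (fun i => f (w i.+1 + a) - f (w i + a))).
    by rewrite telescope_sumr//= w0 wn add0r /= opprD addrA !fctE/=.
  apply: le_trans (ler_norm_sum _ _ _) _.
  apply: (@le_trans _ _ (\sum_(i < n) `|h| * (e / n.+1%:R))).
    apply: ler_sum => i _; rewrite wS.
    have -> : h 0 i *: 'e_i + w i + a = h 0 i *: 'e_i + (w i + a) by rewrite addrA.
    apply: le_trans (_ : `|h 0 i| * (e / n.+1%:R) <= _); last first.
      by rewrite ler_wpM2r ?mx_norm_coord// ltW.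
    apply: increment_le => s sh.
    have : ball a d (s *: 'e_i + (w i + a)).
      rewrite -ball_normE /= distrC addrA addrK.
      apply: le_lt_trans hd; apply: mx_norm_le => // j; rewrite !mxE eqxx/=.
      have [->|ji] := eqVneq j i; first by rewrite ltnn mulr1 addr0 (le_trans sh)// mx_norm_coord.
      by rewrite mulr0 add0r; case: ifP => _; rewrite ?normr0// mx_norm_coord.
    move=> /Hd[Us /(_ i)]; rewrite distrC => ?; split => //.
    by have [d1 _] := Df 'e_i; exact: d1.
  rewrite sumr_const card_ord -[X in X <= _]mulr_natr -mulrA mulrC ler_wpM2r//.
  rewrite -mulrA ger_pMr// mulrC ler_pdivrMr// mul1r ler_nat//.
by case: dE => dE df; split => // h; rewrite dE.
Unshelve. all: by end_near. Qed.

(** The inner map is only derivable in the direction [v]. Restricted to the line through [x] it is a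
    function of one variable, for which derivability and differentiability coincide, so the chain
    rule for differentials applies. *)
Lemma derivable_comp_diff V W' (g : W' -> R^o) (f : V -> W') x v :
  derivable f x v -> differentiable g (f x) ->
  derivable (g \o f) x v /\ 'D_v (g \o f) x = 'd g (f x) ('D_v f x).
Proof.
move=> df dg.
pose c (t : R) : W' := f (t *: v + x).
have dc : derivable c 0 1 by exact: (derivable1P f x v).1.
have c0 : c 0 = f x by rewrite /c scale0r add0r.
have diffc : differentiable c 0 by apply/derivable1_diffP.
have dg' : differentiable g (c 0) by rewrite c0.
have dgc : differentiable (g \o c) 0 by exact: differentiable_comp.
have dE (h : V -> R^o) : (fun t : R => t^-1 *: (((fun t : R => h (t *: v + x)) \o shift 0) (t *: 1) - h (0 *: v + x)))
    = (fun t : R => t^-1 *: ((h \o shift x) (t *: v) - h x)).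
  by apply/funext => t /=; rewrite addr0 scale0r add0r [_%:A]mulr1.
have dE' : (fun t : R => t^-1 *: ((c \o shift 0) (t *: 1) - c 0))
    = (fun t : R => t^-1 *: ((f \o shift x) (t *: v) - f x)).
  by apply/funext => t /=; rewrite c0 /c addr0 [_%:A]mulr1.
split; first by apply: (derivable1P (g \o f) x v).2; apply/derivable1_diffP.
rewrite -[LHS](_ : 'D_1 (g \o c) 0 = _); last by rewrite /derive (dE (g \o f)).
rewrite deriveE// diff_comp//= c0; congr ('d g (f x) _).
by rewrite -deriveE// /derive dE'.
Qed.

(** The coordinates [l] and the basis [e] of the middle space are abstract so that one induction
    serves both row vectors and the real line. A directional derivative of the composite is a sum of
    products of C^k functions, one of them again a composite, hence the induction on [k]. *)
Lemma Ck_comp_gen k V W' (U : set V) (U' : set W') (f : V -> W') (g : W' -> R^o)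
    m (e : 'I_m -> W') (l : 'I_m -> {linear W' -> R^o}) :
  open U -> open U' -> (forall x, U x -> U' (f x)) ->
  (forall j i (h : V -> W'), Ck j U h -> Ck j U (l i \o h)) ->
  (forall (h : W' -> R^o) y, Ck 1 U' h -> U' y -> differentiable h y /\
     forall w, 'd h y w = \sum_(i < m) l i w * 'D_(e i) h y :> R) ->
  Ck k U f -> Ck k U' g -> Ck k U (g \o f).
Proof.
move=> oU oU' UU' Cl dd.
have C0 (f0 : V -> W') (g0 : W' -> R^o) : (forall x, U x -> {for x, continuous f0}) ->
    (forall x, U' x -> {for x, continuous g0}) -> (forall x, U x -> U' (f0 x)) ->
    forall x, U x -> {for x, continuous (g0 \o f0)}.
  by move=> cf cg UU x Ux; apply: (@continuous_comp V W' R^o f0 g0); [exact: cf|exact/cg/UU].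
elim: k g => [|k IH] g Cf Cg.
  by split => // x Ux; move: Cf Cg => [cf _] [cg _]; exact: C0.
have C1g : Ck 1 U' g by move: Cg; clear; elim: k => // k IH /CkS.
have := Cf; have := Cg; move=> [cg dg] [cf df].
split=> [x Ux|v]; first exact: C0.
have [df1 df2] := df v.
have H x : U x -> derivable (g \o f) x v /\ 'D_v (g \o f) x =
    \sum_(i < m) (l i \o 'D_v f) x * ('D_(e i) g \o f) x.
  move=> Ux; have [dg' dE] := dd g _ C1g (UU' x Ux).
  by have [d1 d2] := derivable_comp_diff (df1 x Ux) dg'; split => //; rewrite d2 dE.
split=> [x Ux|]; first by have [] := H x Ux.
apply: (@Ck_eq _ _ _ _ _ (fun x => \sum_(i < m) (l i \o 'D_v f) x * ('D_(e i) g \o f) x : R^o)) => //.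
  by move=> x /[!inE] Ux; have [_ ->] := H x Ux.
apply: Ck_sum => // i; apply: CkM => //; first exact: Cl.
by have [_ dg2] := dg (e i); apply: IH => //; exact: CkS.
Qed.

Lemma Ck_comp_rV k V n (U : set V) (U' : set 'rV[R]_n) (f : V -> 'rV[R]_n)
    (g : 'rV[R]_n -> R^o) :
  open U -> open U' -> (forall x, U x -> U' (f x)) ->
  Ck k U f -> Ck k U' g -> Ck k U (g \o f).
Proof.
move=> oU oU' UU'.
have lin i : linear (fun u : 'rV[R]_n => u 0 i : R^o).
  by move=> a u v; rewrite !mxE.
pose l i : {linear 'rV[R]_n -> R^o} :=
  HB.pack (fun u : 'rV[R]_n => u 0 i : R^o) (GRing.isLinear.Build _ _ _ _ _ (lin i)).
apply: (@Ck_comp_gen k V _ U U' f g n (fun i => 'e_i) l) => //.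
  by move=> j i h; exact: Ck_coord.
by move=> h y Ch Uy; exact: (C1_differentiable oU' Uy Ch).
Qed.

Lemma Ck_comp_R k V (U : set V) (U' : set R^o) (f : V -> R^o) (g : R^o -> R^o) :
  open U -> open U' -> (forall x, U x -> U' (f x)) ->
  Ck k U f -> Ck k U' g -> Ck k U (g \o f).
Proof.
move=> oU oU' UU'.
apply: (@Ck_comp_gen k V _ U U' f g 1 (fun=> 1) (fun=> idfun)) => //.
move=> h y [_ Dh] Uy; have [d1 _] := Dh 1.
have dh : differentiable h y by apply/derivable1_diffP; exact: d1.
split=> // w; rewrite big_ord1 deriveE//= -[w in LHS]mulr1.
by rewrite -[LHS]/('d h y (w *: 1)) linearZZ.
Qed.

End ChainRule.

(** * Flat functions and bumps on row vectors *)

Section FlatFunction.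
Context {R : realType}.

(* The derivative of [flat N] is [flat N.+2 - N * flat N.+1]. *)
Definition flat (N : nat) (s : R^o) : R^o :=
  if 0 < s then s ^- N * expR (- s^-1) else 0.

(** e^t is the (m+1)-st power of e^(t/(m+1)), which is at least t/(m+1). *)
Lemma exprn_expRN_le (m : nat) (t : R) : 0 < t ->
  t ^+ m * expR (- t) <= m.+1%:R ^+ m.+1 / t.
Proof.
move=> t0; rewrite expRN ler_pdivrMr ?expR_gt0// mulrAC ler_pdivlMr//.
have -> : expR t = expR (t / m.+1%:R) ^+ m.+1.
  by rewrite -expRM_natr divfK.
rewrite -exprSr -exprMn lerXn2r ?nnegrE ?mulr_ge0 ?expR_ge0 ?(ltW t0)//.
rewrite mulrC -ler_pdivrMr ?ltr0n//.
by apply: le_trans (expR_ge1Dx _); rewrite lerDr.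
Qed.

Lemma flat_ge0 N s : 0 <= flat N s.
Proof.
rewrite /flat; case: ifPn => // s0.
by rewrite mulr_ge0 ?expR_ge0// invr_ge0 exprn_ge0// ltW.
Qed.

Lemma flat0_gt0 s : (0 < flat 0 s) = (0 < s).
Proof.
rewrite /flat; case: ifPn => s0; last by rewrite ltxx.
by rewrite expr0 invr1 mul1r expR_gt0.
Qed.

Lemma flat0_le1 s : flat 0 s <= 1.
Proof.
rewrite /flat; case: ifPn => // s0.
by rewrite expr0 invr1 mul1r -expR0 ler_expR oppr_le0 invr_ge0 ltW.
Qed.

Lemma is_derive_flat N (x : R^o) :
  is_derive x (1 : R^o) (flat N) (flat N.+2 x - N%:R * flat N.+1 x).
Proof.
have [x0|x0|->] := ltgtP x 0.
- have -> : flat N.+2 x - N%:R * flat N.+1 x = 0.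
    by rewrite /flat !ifF ?ltNge ?(ltW x0)//= mulr0 subr0.
  apply: (@near_eq_is_derive R R^o R^o (cst (0 : R^o))).
    near=> y; rewrite /flat ifF//; apply/negbTE; rewrite -leNgt ltW//.
    by near: y; exact: lt_nbhsl.
- apply: (@near_eq_is_derive R R^o R^o (fun y : R^o => (y^-1) ^+ N * expR (- y^-1) : R^o)).
    near=> y; rewrite /flat ifT ?exprVn//.
    by near: y; exact: lt_nbhsr.
  have x_neq0 : x != 0 by rewrite gt_eqF.
  have dV : is_derive x (1 : R^o) (fun y : R^o => y^-1 : R^o) (- x ^- 2).
    split; first by apply: derivableV.
    by rewrite deriveV// derive_id scaler1.
  have dN : is_derive x (1 : R^o) (fun y : R^o => - y^-1 : R^o) (x ^- 2).
    by have := is_deriveN dV; rewrite opprK.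
  have dE : is_derive x (1 : R^o) (fun y : R^o => expR (- y^-1) : R^o) (expR (- x^-1) * x ^- 2).
    have := @is_derive1_comp R expR (fun y : R^o => - y^-1 : R^o) x (expR (- x^-1)) (x ^- 2) _ dN.
    by apply; exact: is_derive_expR.
  have dX : is_derive x (1 : R^o) (fun y : R^o => (y^-1) ^+ N : R^o) (N%:R * (x^-1) ^+ N.-1 * - x ^- 2).
    have := @is_deriveX R _ (fun y : R^o => y^-1 : R^o) N x 1 _ dV.
    have -> : (fun y : R^o => y^-1 : R^o) ^+ N = (fun y : R^o => (y^-1) ^+ N : R^o).
      by apply/funext => y; rewrite exprfctE.
    move=> h; apply: is_derive_eq h _.
    by rewrite -[RHS]/(_ *: _) mulr_natl.
  apply: is_derive_eq (is_deriveM dX dE) _.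
  rewrite /flat x0 -![_ *: _]/(_ * _).
  have eN M : x ^- M.+2 = (x^-1) ^+ M * x ^- 2 :> R.
    by rewrite -(addn2 M) exprD invfM exprVn.
  case: N dX => [|N] dX; first by rewrite (eN 0%N) /= mulr0n expr0; ring.
  rewrite (eN N.+1) (eN N) exprS /=.
  by move: (x^-1 ^+ N) (x ^- 2) (x^-1) (expR _) => t y z E; ring.
- have -> : flat N.+2 0 - N%:R * flat N.+1 0 = 0.
    by rewrite /flat ltxx mulr0 subr0.
  suff H : (fun h : R => h^-1 *: ((flat N \o shift (0 : R^o)) (h *: (1 : R^o)) - flat N 0)) @ 0^' --> (0 : R^o).
    split; last by apply/cvg_lim.
    by apply/cvg_ex; exists 0.
  (* For h > 0 the difference quotient at 0 is h^-(N+1) e^(-1/h); [exprn_expRN_le] at 1/h with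
     exponent [N.+1] bounds it by [c * h]. *)
  pose c : R := N.+2%:R ^+ N.+2.
  have c0 : 0 < c by rewrite exprn_gt0.
  apply/cvgrPdist_le => e e0.
  have ec0 : 0 < e / c by rewrite divr_gt0.
  near=> h.
  rewrite sub0r normrN /= /shift/= [_%:A]mulr1 addr0 /flat ltxx subr0.
  case: ifPn => h0; last by rewrite scaler0 normr0 ltW.
  rewrite -[_ *: _]/(_ * _) ger0_norm; last first.
    by rewrite !mulr_ge0 ?expR_ge0 ?invr_ge0 ?exprn_ge0 ?(ltW h0).
  rewrite mulrA -exprVn -exprS.
  have /(exprn_expRN_le N.+1)/le_trans -> // : 0 < h^-1 by rewrite invr_gt0.
  rewrite -/c invrK mulrC -ler_pdivlMr//.
  apply: le_trans (ler_norm h) _; apply: ltW; near: h.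
  exact: pseudometric_normed_Zmodule.dnbhs0_lt.
Unshelve. all: by end_near. Qed.

Lemma Ck_R k (f df : R^o -> R^o) :
  (forall x, is_derive x (1 : R^o) f (df x)) -> Ck k setT df -> Ck k.+1 setT f.
Proof.
move=> fdf Cdf.
have diff x : differentiable f x by apply/derivable1_diffP; case: (fdf x).
split=> [x _|v]; first exact: differentiable_continuous.
split=> [x _|]; first exact: diff_derivable.
apply: (@Ck_eq _ _ _ _ _ (fun x => v * df x : R^o)); first exact: openT.
  move=> x _; rewrite deriveE//= -[v in RHS]mulr1 -[RHS]/('d f x (v *: 1)) linearZZ.
  by rewrite -deriveE//; case: (fdf x) => _ ->.
by apply: CkZ => //; exact: openT.
Qed.

Lemma Ck_flat k N : Ck k setT (flat N).
Proof.
elim: k N => [|k IH] N.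
  split=> // x _; apply: differentiable_continuous.
  by apply/derivable1_diffP; case: (is_derive_flat N x).
apply: (Ck_R (is_derive_flat N)).
have oT : open [set: R^o] by exact: openT.
apply: (@Ck_eq _ _ _ _ _ (fun x => flat N.+2 x + - N%:R * flat N.+1 x)) => //.
  by move=> x _; rewrite mulNr.
by apply: CkD => //; apply: CkZ.
Qed.

(** The Euclidean sum of squares is used because the norm of row vectors is a maximum, which is not
    smooth; [bump_supp] translates the support back to that norm. *)
Definition bump n (u0 : 'rV[R]_n) (rho : R) (u : 'rV[R]_n) : R^o :=
  flat 0 (rho ^+ 2 - \sum_(i < n) (u 0 i - u0 0 i) ^+ 2).

Lemma Ck_bump k n (u0 : 'rV[R]_n) rho : Ck k setT (bump u0 rho).
Proof.
have oT (V : normedModType R) : open [set: V] by exact: openT.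
apply: (@Ck_comp_R _ _ _ setT setT (fun u : 'rV[R]_n =>
  rho ^+ 2 - \sum_(i < n) (u 0 i - u0 0 i) ^+ 2) (flat 0)) => //; [exact: openT| |exact: Ck_flat].
apply: (@CkD R k _ R^o setT (fun=> rho ^+ 2)
  (fun u : 'rV[R]_n => - \sum_(i < n) (u 0 i - u0 0 i) ^+ 2)) => //; first exact: Ck_cst.
apply: (@Ck_eq _ _ _ R^o _ (fun u : 'rV[R]_n => \sum_(i < n) (-1) * ((u 0 i - u0 0 i) * (u 0 i - u0 0 i)))) => //.
  by move=> u _; rewrite -sumrN; apply: eq_bigr => i _; rewrite mulN1r expr2.
have Ci i : Ck k setT (fun u : 'rV[R]_n => u 0 i - u0 0 i : R^o).
  apply: (@CkD R k _ R^o setT (fun u : 'rV[R]_n => u 0 i) (fun=> - u0 0 i)) => //.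
    apply: (@Ck_coord _ _ _ _ _ id) => //.
    by apply: (@Ck_linear _ _ _ _ _ idfun) => x; exact: cvg_id.
  exact: Ck_cst.
by apply: Ck_sum => // i; apply: CkZ => //; apply: CkM.
Qed.

Lemma bump_ge0 n (u0 : 'rV[R]_n) rho u : 0 <= bump u0 rho u.
Proof. exact: flat_ge0. Qed.

Lemma bump_le1 n (u0 : 'rV[R]_n) rho u : bump u0 rho u <= 1.
Proof. exact: flat0_le1. Qed.

Lemma bump_center n (u0 : 'rV[R]_n) rho : 0 < rho -> 0 < bump u0 rho u0.
Proof.
move=> rho0; rewrite /bump flat0_gt0 big1 ?subr0 ?exprn_gt0// => i _.
by rewrite subrr expr0n.
Qed.

Lemma bump_supp n (u0 : 'rV[R]_n) rho u : 0 < rho -> bump u0 rho u != 0 ->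
  `|u - u0| <= rho.
Proof.
move=> rho0 b0; have : 0 < bump u0 rho u by rewrite lt_neqAle eq_sym b0 bump_ge0.
rewrite /bump flat0_gt0 subr_gt0 => le.
apply: mx_norm_le => [|i]; first exact: ltW.
rewrite !mxE -ler_sqr ?nnegrE ?normr_ge0 ?(ltW rho0)//.
rewrite -normrX ger0_norm ?sqr_ge0//; apply: ltW; apply: le_lt_trans le.
rewrite (bigD1 i)//= lerDl sumr_ge0// => j _; exact: sqr_ge0.
Qed.

End FlatFunction.

(** * Smooth functions on a manifold *)

Section SmoothFunctions.
Context {R : realType}.

Lemma open_chart_preimage (V : normedModType R) (M : topologicalType)
    (c : chart V M) (O : set M) :
  is_chart c -> open O -> open (img c `&` psi c @^-1` O).
Proof.
move=> cc oO; rewrite openE => u [cu Ou].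
apply: filterI; first by apply: open_nbhs_nbhs; split => //; exact: open_img.
by apply: (psi_continuous cc cu); exact: open_nbhs_nbhs.
Qed.

Lemma open_continuous_preimage (M N : topologicalType) (O : set M) (P : set N)
    (f : M -> N) : open O -> (forall x, O x -> {for x, continuous f}) -> open P ->
  open (O `&` f @^-1` P).
Proof.
move=> oO cf oP; rewrite openE => x [Ox Px].
apply: filterI; first exact: open_nbhs_nbhs.
by apply: (cf x Ox); exact: open_nbhs_nbhs.
Qed.

Lemma prod_is_chart (V W : normedModType R) (M N : topologicalType)
    (c : chart V M) (d : chart W N) :
  is_chart c -> is_chart d -> is_chart (prod_chart c d).
Proof.
have op (T U : topologicalType) (P : set T) (Q : set U) : open P -> open Q -> open (P `*` Q).
  move=> oP oQ; rewrite openE => -[x y] [/= Px Qy].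
  by exists (P, Q) => //; split; exact: open_nbhs_nbhs.
have fst_cont (T U : topologicalType) : continuous (fst : T * U -> T).
  by move=> x P Px; exists (P, setT) => [|? []//]; split => //; exact: filterT.
have snd_cont (T U : topologicalType) : continuous (snd : T * U -> U).
  by move=> x P Px; exists (setT, P) => [|? []//]; split => //; exact: filterT.
move=> cc cd; split => /=.
- by apply: op; exact: open_dom.
- by apply: op; exact: open_img.
- by move=> x [? ?]; split; exact: phi_img.
- by move=> x [? ?]; split; exact: psi_dom.
- by move=> [x y] [? ?] /=; congr pair; exact: phiK.
- by move=> [x y] [? ?] /=; congr pair; exact: psiK.
- move=> [x y] [/= cx dy]; apply: cvg_pair.
    by apply: (@continuous_comp _ _ _ fst (phi c)); [exact: fst_cont|exact: phi_continuous].
  by apply: (@continuous_comp _ _ _ snd (phi d)); [exact: snd_cont|exact: phi_continuous].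
- move=> [x y] [/= cx dy]; apply: cvg_pair.
    by apply: (@continuous_comp _ _ _ fst (psi c)); [exact: fst_cont|exact: psi_continuous].
  by apply: (@continuous_comp _ _ _ snd (psi d)); [exact: snd_cont|exact: psi_continuous].
Qed.

Lemma id_is_chart (V : normedModType R) : is_chart (Chart setT setT id id : chart V V).
Proof. by split=> //=; try exact: openT; move=> x _; exact: cvg_id. Qed.

Context {n : nat} {M : topologicalType} (A : set (chart 'rV[R]_n M)).
Hypothesis HA : smooth_atlas A.

Lemma smooth_fun_continuous (f : M -> R) : smooth_fun A f -> continuous (f : M -> R^o).
Proof. by move=> [cf _] x; exact: cf. Qed.

Lemma smooth_fun_chart (f : M -> R) c : smooth_fun A f -> A c ->
  Cinfty (img c) (f \o psi c : 'rV[R]_n -> R^o).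
Proof.
move=> [_ sf] Ac k; have := sf c _ Ac (erefl _) k.
by apply: Ck_sub => u cu; split.
Qed.

(** Continuity on the manifold, a separate clause of [smooth_on], follows from the chart readings,
    since near a point [f] is its reading composed with [phi c]. *)
Lemma smooth_funI (f : M -> R) :
  (forall c, A c -> Cinfty (img c) (f \o psi c : 'rV[R]_n -> R^o)) -> smooth_fun A f.
Proof.
move=> H; split=> [x _|c d Ac ->]; last first.
  by move=> k; apply: Ck_sub (H c Ac k) => u [].
have [c Ac cx] := atlas_cover HA x; have cc := atlas_chart HA Ac.
have : {for x, continuous ((f \o psi c : 'rV[R]_n -> R^o) \o phi c)}.
  apply: continuous_comp; first exact: phi_continuous.
  by apply: Ck_continuous (H c Ac 0%N) _; exact: phi_img.
rewrite /prop_for /continuous_at /= phiK//.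
apply: cvg_trans; apply: near_eq_cvg.
near=> y; rewrite /= phiK//; near: y.
by apply: open_nbhs_nbhs; split => //; exact: open_dom.
Unshelve. all: by end_near. Qed.

Lemma open_chart_img c : A c -> open (img c).
Proof. by move=> /(atlas_chart HA); exact: open_img. Qed.

Lemma smooth_cst (a : R) : smooth_fun A (fun=> a).
Proof. by apply: smooth_funI => c Ac k; exact: Ck_cst. Qed.

Lemma smoothD (f g : M -> R) :
  smooth_fun A f -> smooth_fun A g -> smooth_fun A (fun x => f x + g x).
Proof.
move=> sf sg; apply: smooth_funI => c Ac k.
by apply: (CkD (open_chart_img Ac) (smooth_fun_chart sf Ac k) (smooth_fun_chart sg Ac k)).
Qed.

Lemma smoothM (f g : M -> R) :
  smooth_fun A f -> smooth_fun A g -> smooth_fun A (fun x => f x * g x).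
Proof.
move=> sf sg; apply: smooth_funI => c Ac k.
by apply: (CkM (open_chart_img Ac) (smooth_fun_chart sf Ac k) (smooth_fun_chart sg Ac k)).
Qed.

Lemma smoothZ (a : R) (f : M -> R) : smooth_fun A f -> smooth_fun A (fun x => a * f x).
Proof. by apply: smoothM; exact: smooth_cst. Qed.

Lemma smooth_sum (m : nat) (f : nat -> M -> R) :
  (forall i, smooth_fun A (f i)) -> smooth_fun A (fun x => \sum_(i < m) f i x).
Proof.
move=> sf; elim: m => [|m IH].
  rewrite (_ : (fun x => _) = fun=> 0); first exact: smooth_cst.
  by apply/funext => x; rewrite big_ord0.
rewrite (_ : (fun x => _) = fun x => \sum_(i < m) f i x + f m x); first exact: smoothD.
by apply/funext => x; rewrite big_ord_recr.
Qed.

(* Extension by zero of a function read in the chart [c]. *)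
Definition ext0 (c : chart 'rV[R]_n M) (F : 'rV[R]_n -> R) (x : M) : R :=
  if `[< dom c x >] then F (phi c x) else 0.

(** The image of [K] is compact, hence closed as the manifold is Hausdorff. Its complement is then
    an open set on which the extension vanishes, and with [dom c] it covers the manifold; on [dom c]
    the extension is [F] after a transition map. *)
Lemma ext0_smooth c (F : 'rV[R]_n -> R) (K : set 'rV[R]_n) :
  hausdorff_space M -> A c -> compact K -> K `<=` img c ->
  (forall u, F u != 0 -> K u) -> Cinfty setT (F : 'rV[R]_n -> R^o) ->
  smooth_fun A (ext0 c F).
Proof.
move=> hM Ac cK Kc FK CF; have cc := atlas_chart HA Ac.
have cPK : closed (psi c @` K).
  apply: compact_closed => //; apply: continuous_compact => //.
  apply/continuous_in_subspaceT => u /[!inE] Ku.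
  by apply: psi_continuous => //; exact: Kc.
have e0 x : ~ (psi c @` K) x -> ext0 c F x = 0.
  rewrite /ext0; case: asboolP => // cx nK; apply/eqP/negPn/negP => /FK Kx.
  by apply: nK; exists (phi c x) => //; rewrite phiK.
apply: smooth_funI => d Ad k; have cd := atlas_chart HA Ad.
apply/Ck_pointwise => u du.
have [cu|ncu] := pselect (dom c (psi d u)).
  pose U := img d `&` psi d @^-1` dom c.
  have oU : open U by apply: open_chart_preimage => //; exact: open_dom.
  apply: (@Ck_sub _ _ _ _ U); first by move=> _ ->.
  apply: (@Ck_eq _ _ _ R^o _ (F \o (phi c \o psi d))) => //.
    by move=> v /[!inE] -[_ /= cv]; rewrite /ext0; case: asboolP.
  apply: (@Ck_comp_rV _ _ _ _ U setT) => //; first exact: openT.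
  exact: (atlas_compatible HA Ad Ac).
pose U := img d `&` psi d @^-1` (~` (psi c @` K)).
have oU : open U by apply: open_chart_preimage => //; exact: closed_openC.
apply: (@Ck_sub _ _ _ _ U).
  by move=> _ ->; split => // -[v Kv /esym E]; apply: ncu; rewrite E; apply: psi_dom => //; exact: Kc.
apply: (@Ck_eq _ _ _ R^o _ (fun=> 0)) => //; last exact: Ck_cst.
by move=> v /[!inE] -[_ /= nv]; rewrite e0.
Qed.

Lemma compact_closed_ball (u0 : 'rV[R]_n) (r : R) : 0 < r -> compact [set u | `|u - u0| <= r].
Proof.
move=> r0; apply: bounded_closed_compact.
  exists (`|u0| + r); split => [|x xr u ur]; first exact: num_real.
  apply: le_trans (ltW xr); rewrite -(subrK u0 u) addrC.
  by apply: le_trans (ler_normD _ _) _; rewrite lerD2l.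
have -> : [set u | `|u - u0| <= r] = closed_ball u0 r.
  by rewrite closed_ballE//; apply/seteqP; split => u /=; rewrite distrC.
exact: closed_ball_closed.
Qed.

Lemma open_ball_subset (U : set 'rV[R]_n) u0 : open U -> U u0 ->
  exists2 r : R, 0 < r & [set u | `|u - u0| <= r] `<=` U.
Proof.
move=> oU Uu; have /nbhs_ballP[r /= r0 rU] : nbhs u0 U by exact: open_nbhs_nbhs.
exists (r / 2); first by rewrite divr_gt0.
move=> u /= ur; apply: rU; rewrite -ball_normE /= distrC (le_lt_trans ur)//.
by rewrite ltr_pdivrMr// ltr_pMr// ltr1n.
Qed.

Lemma smooth_bump (x : M) (N : set M) : hausdorff_space M -> open N -> N x ->
  exists b K, [/\ smooth_fun A b, (forall y, 0 <= b y <= 1), 0 < b x,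
    compact K & K `<=` N /\ forall y, b y != 0 -> K y].
Proof.
move=> hM oN Nx; have [c Ac cx] := atlas_cover HA x.
have cc := atlas_chart HA Ac.
have oU := open_chart_preimage cc oN.
have [|r r0 rU] := open_ball_subset oU (u0 := phi c x).
  by split => /=; [exact: phi_img|rewrite phiK].
pose B := [set u | `|u - phi c x| <= r].
exists (ext0 c (bump (phi c x) r)), (psi c @` B); split.
- apply: (@ext0_smooth _ _ B) => //; first exact: compact_closed_ball.
  + by move=> u /rU[].
  + by move=> u; exact: bump_supp.
  + by move=> k; exact: Ck_bump.
- move=> y; rewrite /ext0; case: ifP => _; last by rewrite lexx ler01.
  by rewrite bump_ge0 bump_le1.
- by rewrite /ext0 asboolT// bump_center.
- apply: continuous_compact; last exact: compact_closed_ball.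
  apply/continuous_in_subspaceT => u /[!inE] /rU[cu _].
  exact: psi_continuous.
- split=> [_ [u /rU[_ ?] <-] //|y]; rewrite /ext0; case: asboolP => [cy|_]; last by rewrite eqxx.
  by move=> /(bump_supp r0) By; exists (phi c y) => //; rewrite phiK.
Qed.

(** Nearby points of the source may need different charts of the target, hence the reduction to one
    point, around which a single chart [d] suffices. *)
Lemma Cinfty_comp_smooth (V : normedModType R) (N : topologicalType)
    (B : set (chart V N)) (O : set N) (f : N -> M) (g : M -> R) c :
  open O -> is_chart c -> B c -> smooth_on B A O f -> smooth_fun A g ->
  Cinfty (img c `&` psi c @^-1` O) (g \o f \o psi c : V -> R^o).
Proof.
move=> oO cc Bc [cf sf] sg k; apply/Ck_pointwise => u [cu /= Ou].
have [d Ad du] := atlas_cover HA (f (psi c u)); have cd := atlas_chart HA Ad.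
pose U := img c `&` psi c @^-1` (O `&` f @^-1` dom d).
have oU : open U.
  by apply: open_chart_preimage => //; apply: open_continuous_preimage => //; exact: open_dom.
apply: (@Ck_sub _ _ _ _ U); first by move=> _ ->.
apply: (@Ck_eq _ _ _ R^o _ ((g \o psi d) \o (phi d \o f \o psi c))) => //.
  by move=> v /[!inE] -[_ [/= _ dv]]; rewrite phiK.
apply: (@Ck_comp_rV _ _ _ _ U (img d)) => //.
- exact: open_img.
- by move=> v [_ [/= _ dv]]; exact: phi_img.
- exact: sf.
- exact: smooth_fun_chart.
Qed.

End SmoothFunctions.

(** * Dilations and the Euler operator *)

Section PairMaps.
Context {R : realType} {V W : normedModType R}.

Lemma pair_scaleD (h : R) (p q : V * W) : h *: p + q = (h *: p.1 + q.1, h *: p.2 + q.2).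
Proof. by case: p => ? ?; case: q. Qed.

Lemma Ck_slice2 k (Z : normedModType R) (U : set (V * W)) (v : V) (f : V * W -> Z) :
  Ck k U f -> Ck k [set w | U (v, w)] (fun w => f (v, w)).
Proof.
move=> Cf.
apply: (@Ck_affine _ k W _ Z U (fun w => (v, w)) (fun w => (0, w))) => // [w|h x w].
  by apply: cvg_pair; [exact: cvg_cst|exact: cvg_id].
by rewrite pair_scaleD /= scaler0 add0r.
Qed.

Lemma Ck_slice1 k (Z : normedModType R) (U : set (V * W)) (w : W) (f : V * W -> Z) :
  Ck k U f -> Ck k [set v | U (v, w)] (fun v => f (v, w)).
Proof.
move=> Cf.
apply: (@Ck_affine _ k V _ Z U (fun v => (v, w)) (fun v => (v, 0))) => // [v|h x v].
  by apply: cvg_pair; [exact: cvg_id|exact: cvg_cst].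
by rewrite pair_scaleD /= scaler0 add0r.
Qed.

End PairMaps.

Section GroupCalculus.
Context {R : realType} {n : nat} {G : groupSpaceType}.
Context {A : set (chart 'rV[R]_n G)}.
Hypothesis HL : lie_group A.
Let HA : smooth_atlas A := lie_atlas HL.

Lemma smooth_translate (a : G) (f : G -> R) :
  smooth_fun A f -> smooth_fun A (fun x => f (a * x)%g).
Proof.
move=> sf; apply: (smooth_funI HA) => c Ac k.
have [d Ad da] := atlas_cover HA a.
have cc := atlas_chart HA Ac; have cd := atlas_chart HA Ad.
have := @Cinfty_comp_smooth R n G A HA _ _ (prod_atlas A A) setT
   (fun x : G * G => (x.1 * x.2)%g) f (prod_chart d c) openT
   (prod_is_chart cd cc) _ (lie_mul HL) sf k.
move=> /(_ (ex_intro2 _ _ d Ad (ex_intro2 _ _ c Ac erefl))).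
move=> /(Ck_slice2 (phi d a)); rewrite /= phiK//.
apply: Ck_sub => u cu; do 2 split => //=; exact: phi_img.
Qed.

Context {E : 'rV[R]_n -> (G -> R) -> G -> R} {A0 : 'M[R]_n} {dil : R -> G -> G}.
Hypothesis HD : induced_dilations A E A0 dil.

Lemma dil_chart_Cinfty c (f : G -> R) : A c -> smooth_fun A f ->
  Cinfty [set lu : R^o * 'rV[R]_n | 0 < (lu.1 : R) /\ img c lu.2]
    (fun lu => f (dil lu.1 (psi c lu.2)) : R^o).
Proof.
move=> Ac sf k; have cc := atlas_chart HA Ac.
have oO : open [set lx : R^o * G | 0 < (lx.1 : R)].
  rewrite openE => -[l x] /= l0; exists ([set l : R^o | 0 < l], setT) => //=.
    split; last exact: filterT.
    by apply: open_nbhs_nbhs; split => //; exact: open_gt.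
  by move=> [l' x'] [].
have := @Cinfty_comp_smooth R n G A HA _ _ (prod_atlas (id_atlas R^o) A) _
   (fun lx => dil lx.1 lx.2) f (prod_chart (Chart setT setT id id) c) oO
   (prod_is_chart (id_is_chart _) cc) _ (dil_smooth HD) sf k.
move=> /(_ (ex_intro2 _ _ _ erefl (ex_intro2 _ _ c Ac erefl))).
by apply: Ck_sub => -[l u] /= [l0 cu]; split.
Qed.

Lemma smooth_dil (l : R) (f : G -> R) : 0 < l ->
  smooth_fun A f -> smooth_fun A (fun x => f (dil l x)).
Proof.
move=> l0 sf; apply: (smooth_funI HA) => c Ac k.
have := dil_chart_Cinfty Ac sf k => /(Ck_slice2 (l : R^o)).
by apply: Ck_sub.
Qed.

Lemma dil_continuous (l : R) : 0 < l -> continuous (dil l).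
Proof.
move=> l0 x; have [cd _] := dil_smooth HD.
have : {for x, continuous ((fun lx : R^o * G => dil lx.1 lx.2) \o (fun x => (l : R^o, x)))}.
  apply: continuous_comp; last exact: cd.
  exact: (@cvg_pair G R^o G (nbhs x) (nbhs (l : R^o)) (nbhs x) _ _ _
    (fun=> (l : R^o)) id (cvg_cst _) cvg_id).
by [].
Qed.

Lemma dil_id (l : R) : 0 < l -> dil l 1%g = 1%g.
Proof.
move=> l0; have := dil_morphism HD l0 1%g 1%g; rewrite mulg1 => /(congr1 (fun x => (dil l 1%g)^-1 * x)%g).
by rewrite mulVg mulKg => <-.
Qed.

Lemma dilK (l : R) : 0 < l -> cancel (dil l) (dil l^-1).
Proof.
move=> l0 x; rewrite -(dilM HD) ?invr_gt0// mulVf ?gt_eqF//; exact: (dil1 HD).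
Qed.

(** The real counterpart of [euler], which is computed separately on real and imaginary parts. *)
Definition eulerR (f : G -> R) (x : G) : R :=
  derive1 (fun t : R => f (dil (expR t) x) : R^o) 0.

Lemma derivable_dil (f : G -> R) (x : G) (l : R) : 0 < l -> smooth_fun A f ->
  derivable (fun l : R^o => f (dil l x) : R^o) l 1.
Proof.
move=> l0 sf; have [c Ac cx] := atlas_cover HA x; have cc := atlas_chart HA Ac.
have := dil_chart_Cinfty Ac sf 1%N => /(Ck_slice1 (phi c x)) [_ /(_ 1) [+ _]].
move=> /(_ l) /=; rewrite phiK//; apply; split => //; exact: phi_img.
Qed.

(** The dilations by e^t form a one-parameter group, so the derivative at time [t] is the derivative
    at time 0 seen from the moved point. *)
Lemma is_derive_eulerR (f : G -> R) (x : G) (t : R) : smooth_fun A f ->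
  is_derive t (1 : R^o) (fun t : R^o => f (dil (expR t) x) : R^o) (eulerR f (dil (expR t) x)).
Proof.
move=> sf.
have d0 y : is_derive (0 : R^o) (1 : R^o) (fun t : R^o => f (dil (expR t) y) : R^o) (eulerR f y).
  split; last by rewrite /eulerR derive1E.
  have df : derivable (fun l : R^o => f (dil l y) : R^o) (expR 0) 1.
    by apply: derivable_dil => //; exact: expR_gt0.
  have := @is_derive1_comp R (fun l : R^o => f (dil l y) : R^o) expR 0 _ (expR 0) (derivableP df).
  by move=> /(_ (is_derive_expR _)) [].
have E1 : (fun s : R^o => f (dil (expR s) x) : R^o) =
   (fun s : R^o => f (dil (expR s) (dil (expR t) x)) : R^o) \o (fun s : R^o => s - t : R^o).
  apply/funext => s /=; rewrite -(dilM HD) ?expR_gt0//.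
  by rewrite -expRD subrK.
rewrite E1.
have dsh : is_derive (t : R^o) (1 : R^o) (fun s : R^o => s - t : R^o) (1 : R).
  have := @is_deriveB R R^o R^o id (cst t) t 1 1 0 _ _.
  by rewrite subr0; apply.
have := @is_derive1_comp R (fun s : R^o => f (dil (expR s) (dil (expR t) x)) : R^o)
  (fun s : R^o => s - t : R^o) t _ 1 _ dsh.
move=> /(_ (eulerR f (dil (expR t) x))); rewrite subrr mulr1; apply; exact: d0.
Qed.

(** Dilations are jointly smooth in the factor and the point, and the Euler derivative is the
    partial derivative in the factor at 1; its reading in a chart is therefore a slice of a smooth
    function of two variables. *)
Lemma smooth_eulerR (f : G -> R) : smooth_fun A f -> smooth_fun A (eulerR f).
Proof.
move=> sf; apply: (smooth_funI HA) => c Ac k.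
pose H (lu : R^o * 'rV[R]_n) : R^o := f (dil lu.1 (psi c lu.2)).
have [_ /(_ (1, 0)) [_ C]] := dil_chart_Cinfty Ac sf k.+1.
have oc := open_chart_img HA Ac.
apply: (@Ck_eq _ _ _ _ _ (fun u => 'D_((1 : R^o), (0 : 'rV[R]_n)) H ((1 : R^o), u)) _ oc).
  move=> u /[!inE] cu /=.
  have [_ /(_ (1, 0)) [/(_ ((1 : R^o), u)) dH _]] := dil_chart_Cinfty Ac sf 1%N.
  have {}dH : derivable H ((1 : R^o), u) (1, 0) by apply: dH; split => //=.
  have E1 : (fun l : R^o => f (dil l (psi c u)) : R^o) = (fun l : R^o => H (l, u)) by [].
  have E2 : (fun h : R => h^-1 *: (((fun l : R^o => H (l, u)) \o shift (1 : R^o)) (h *: (1 : R^o)) - H (1, u)))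
     = (fun h : R => h^-1 *: ((H \o shift ((1 : R^o), u)) (h *: (1, 0)) - H (1, u))).
    by apply/funext => h /=; rewrite pair_scaleD /= scaler0 add0r.
  have dH1 : is_derive (1 : R^o) (1 : R^o) (fun l : R^o => f (dil l (psi c u)) : R^o) ('D_(1, 0) H (1, u)).
    by split; [rewrite E1 /derivable E2|rewrite E1 /derive E2].
  rewrite /eulerR derive1E.
  rewrite -[X in is_derive X]expR0 in dH1.
  have := @is_derive1_comp R (fun l : R^o => f (dil l (psi c u)) : R^o) expR 0 _ (expR 0) dH1.
  by move=> /(_ (is_derive_expR _)) [_ ->]; rewrite expR0 mulr1.
have := Ck_slice2 (1 : R^o) C; apply: Ck_sub.
by move=> u cu; split => //=.
Qed.

End GroupCalculus.

(** * Contraction and properness of the quasi-norm *)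

Section MatrixExponential.
Context {R : realType} {n : nat}.

Lemma cvg_sumR (I : Type) (r : seq I) (f : I -> nat -> R) (l : I -> R) :
  (forall i, (f i : nat -> R^o) @ \oo --> (l i : R^o)) ->
  (fun N => \sum_(i <- r) f i N : R^o) @ \oo --> (\sum_(i <- r) l i : R^o).
Proof.
move=> fl; elim: r => [|i r IH].
  rewrite big_nil (_ : (fun N => _) = fun=> 0); first exact: cvg_cst.
  by apply/funext => N; rewrite big_nil.
rewrite big_cons (_ : (fun N => _) = fun N => f i N + \sum_(j <- r) f j N).
  by apply: cvgD.
by apply/funext => N; rewrite big_cons.
Qed.

Lemma mx_cvg (f : nat -> 'M[R]_n) (L : 'M[R]_n) :
  (forall i j, (fun N => f N i j : R^o) @ \oo --> (L i j : R^o)) -> f @ \oo --> L.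
Proof.
move=> H; apply/cvgrPdist_le => e e0.
have : \forall N \near \oo, forall i j, `|L i j - f N i j| <= e.
  apply: filter_forall => i; apply: filter_forall => j.
  by have /cvgrPdist_le/(_ _ e0) := H i j.
apply: filterS => N HN.
rewrite [leLHS]/Num.Def.normr/= mx_normrE (bigmax_le _ (ltW e0))//= => -[i j] _.
by rewrite !mxE.
Qed.

Lemma diag_mxX (d : 'rV[R]_n) k : diag_mx d ^+ k = diag_mx (\row_i d 0 i ^+ k).
Proof.
elim: k => [|k IH].
  rewrite expr0; apply/matrixP => i j; rewrite !mxE.
  by case: eqP => // _; rewrite expr0.
rewrite exprS IH; apply/matrixP => i j.
rewrite -[diag_mx d * _]/(diag_mx d *m _) mul_diag_mx !mxE.
by case: eqP => [->|_]; rewrite ?exprS// !mulr0n mulr0.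
Qed.

(** Each entry of a partial sum is a fixed linear combination of partial sums of scalar exponential
    series, so convergence is entrywise. *)
Lemma expmx_conj (P : 'M[R]_n) (d : 'rV[R]_n) : P \in unitmx ->
  expmx (invmx P *m diag_mx d *m P) =
  invmx P *m diag_mx (\row_i expR (d 0 i)) *m P.
Proof.
move=> Pu; apply/cvg_lim => //; apply: mx_cvg => i j.
have powE k : (invmx P *m diag_mx d *m P) ^+ k =
    invmx P *m diag_mx (\row_i d 0 i ^+ k) *m P.
  rewrite -diag_mxX; elim: k => [|k IH].
    by rewrite !expr0 -[1]/(1%:M) mulmx1 mulVmx.
  rewrite exprS IH -[_ * _]/(_ *m _) exprS -[diag_mx d * _]/(_ *m _).
  by rewrite !mulmxA -(mulmxA _ P) mulmxV// mulmx1.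
have termE k : ((k`!)%:R^-1 *: (invmx P *m diag_mx d *m P) ^+ k) i j =
    \sum_(l < n) invmx P i l * P l j * exp_coeff (d 0 l) k.
  rewrite mxE powE mxE mulr_sumr; apply: eq_bigr => l _.
  by rewrite mul_mx_diag !mxE /exp_coeff/=; ring.
have E N : series (fun k => (k`!)%:R^-1 *: (invmx P *m diag_mx d *m P) ^+ k) N i j =
   \sum_(k < n) invmx P i k * P k j * series (exp_coeff (d 0 k)) N.
  rewrite /series/= summxE (eq_bigr _ (fun k _ => termE k)).
  by rewrite exchange_big/=; apply: eq_bigr => l _; rewrite mulr_sumr.
rewrite (_ : (fun N => _) = fun N => \sum_(k < n) invmx P i k * P k j * series (exp_coeff (d 0 k)) N); last first.
  by apply/funext => N; exact: E.
have -> : (invmx P *m diag_mx (\row_i expR (d 0 i)) *m P) i j =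
    \sum_(k < n) invmx P i k * P k j * expR (d 0 k).
  by rewrite mxE; apply: eq_bigr => l _; rewrite mul_mx_diag !mxE mulrAC.
apply: cvg_sumR => k; apply: cvgMl_tmp.
exact: is_cvg_series_exp_coeff.
Qed.

(** In an eigenbasis the dilation by e^-s is diagonal with entries e^(-s D_k), D_k > 0, and tends to
    0 as s grows. [M] will be the passage from Lie algebra coordinates to a chart; the factor 1/4
    leaves room for an equal linearisation error. *)
Lemma lie_dil_contracts (A0 M : 'M[R]_n) : diagonalizable A0 ->
  (forall a : R, eigenvalue A0 a -> 0 < a) -> M \in unitmx ->
  exists2 l : R, 0 < l < 1 &
    forall v : 'rV[R]_n, `|v *m (invmx M *m lie_dil A0 l *m M)| <= 4^-1 * `|v|.
Proof.
move=> [P Pu /(diagonalizable_forLR Pu)[D A0E]] Apos Mu.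
have {}A0E : A0 = invmx P *m diag_mx D *m P by rewrite A0E mxpoly.conjumx ?unitmx_inv// invmxK.
have Dpos k : 0 < D 0 k.
  apply: Apos; apply/eigenvalueP; exists (row k P).
    rewrite A0E !mulmxA -row_mul mulmxV// row1.
    by rewrite -rowE row_diag_mx -scalemxAl -rowE.
  apply/eqP => /(congr1 (mulmx^~ (invmx P))); rewrite mul0mx -row_mul mulmxV//.
  by move=> /rowP/(_ k); rewrite !mxE eqxx => /eqP; rewrite oner_eq0.
pose N := P *m M.
have Nu : N \in unitmx by rewrite unitmx_mul Pu.
have iN : invmx N = invmx M *m invmx P.
  apply: (can_inj (mulKmx Nu)).
  by rewrite mulmxV// /N mulmxA -(mulmxA P) mulmxV// mulmx1 mulmxV.
pose C : R := 1 + \sum_i \sum_j \sum_k `|invmx N i k| * `|N k j|.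
have C0 : 0 < C by rewrite ltr_pwDl// !sumr_ge0// => i _; rewrite !sumr_ge0// => j _; rewrite !sumr_ge0.
have : \forall s \near +oo, 0 < s /\ forall k, expR (- s * D 0 k) <= 4^-1 / C.
  apply: filterI; first exact: nbhs_pinfty_gt.
  suff : \forall s \near +oo, forall k, expR (- s * D 0 k) <= 4^-1 / C by [].
  apply: filter_forall => k.
  have e0 : 0 < 4^-1 / C by rewrite divr_gt0.
  apply: filterS (nbhs_pinfty_ge (num_real (- ln (4^-1 / C) / D 0 k))) => s hs.
  rewrite -[leRHS]lnK// ler_expR mulNr lerNl -ler_pdivrMr//.
move=> /filter_ex[s [s0 Hs]]; exists (expR (- s)).
  by rewrite expR_gt0 -expR0 ltr_expR oppr_lt0.
have -> : invmx M *m lie_dil A0 (expR (- s)) *m M =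
    invmx N *m diag_mx (\row_i expR (- s * D 0 i)) *m N.
  rewrite /lie_dil expRK A0E scalemxAl scalemxAr.
  have -> : - s *: diag_mx D = diag_mx (- s *: D) by rewrite linearZ.
  rewrite expmx_conj// iN /N !mulmxA.
  by congr (_ *m diag_mx _ *m _ *m _); apply/rowP => i; rewrite !mxE.
move=> v; apply: mx_norm_le => [|j]; first by rewrite mulr_ge0.
rewrite mxE; apply: le_trans (ler_norm_sum _ _ _) _.
apply: (@le_trans _ _ (\sum_i `|v| * (\sum_k `|invmx N i k| * `|N k j|) * (4^-1 / C))).
  apply: ler_sum => i _; rewrite normrM -mulrA.
  apply: ler_pM => //; first exact: mx_norm_coord.
  rewrite mxE; apply: le_trans (ler_norm_sum _ _ _) _.
  rewrite mulr_suml; apply: ler_sum => k _.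
  rewrite mul_mx_diag !mxE !normrM mulrAC.
  by apply: ler_wpM2l; rewrite ?mulr_ge0// ger0_norm ?expR_ge0.
rewrite -mulr_suml -mulr_sumr -mulrA mulrC; apply: ler_wpM2r => //.
rewrite mulrCA ger_pMr ?invr_gt0// ler_pdivrMr// mul1r /C.
apply: le_trans (_ : \sum_i \sum_j \sum_k `|invmx N i k| * `|N k j| <= _); last by rewrite lerDr.
apply: ler_sum => i _; rewrite [leRHS](bigD1 j)//= lerDl !sumr_ge0// => k _.
by rewrite sumr_ge0.
Qed.

End MatrixExponential.

(** * Dilations read in a chart at the identity *)

Section Properness.
Context {R : realType} {n : nat} {G : groupSpaceType}.
Context {A : set (chart 'rV[R]_n G)} {E : 'rV[R]_n -> (G -> R) -> G -> R}.
Context {A0 : 'M[R]_n} {dil : R -> G -> G}.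
Hypothesis HG : homogeneous_group A E A0.
Hypothesis HD : induced_dilations A E A0 dil.
Let HL := hg_lie HG.
Let HA := lie_atlas HL.
Let hG := lie_hausdorff HL.

(* A smooth function equal to the [i]-th coordinate up to a constant factor,
   to first order at the base point of the chart. *)
Definition coord_bump (u0 : 'rV[R]_n) (r : R) (i : 'I_n) (u : 'rV[R]_n) : R^o :=
  bump u0 r u * (u 0 i - u0 0 i).

Lemma Ck_coord_bump k u0 r i : Ck k setT (coord_bump u0 r i).
Proof.
apply: (@CkM R k _ setT (bump u0 r) (fun u : 'rV[R]_n => u 0 i - u0 0 i)).
- exact: openT.
- exact: Ck_bump.
- apply: (@CkD R k _ R^o setT (fun u : 'rV[R]_n => u 0 i) (fun=> - u0 0 i)).
  + exact: openT.
  + apply: (@Ck_coord _ _ _ _ _ id); first exact: openT.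
    by apply: (@Ck_linear _ _ _ _ _ idfun) => x; exact: cvg_id.
  + exact: Ck_cst.
Qed.

Lemma derive_coord_bump u0 r i (w : 'rV[R]_n) :
  'D_w (coord_bump u0 r i) u0 = bump u0 r u0 * w 0 i :> R.
Proof.
pose l (u : 'rV[R]_n) : R^o := u 0 i - u0 0 i.
have db : derivable (bump u0 r) u0 w.
  by have [_ /(_ w) [+ _]] := Ck_bump 1 u0 r; apply.
have dl : is_derive u0 w l (w 0 i).
  have E1 : (fun h : R => h^-1 *: ((l \o shift u0) (h *: w) - l u0)) @ 0^' --> (w 0 i : R^o).
    apply: cvg_near_cst; near=> h.
    rewrite /l /= !mxE subrr subr0 addrK -[_ *: _]/(_ * _) mulrA mulVf ?mul1r//.
    by near: h; exact: nbhs_dnbhs_neq.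
  split; first by apply/cvg_ex; exists (w 0 i).
  exact/cvg_lim.
have [dl1 dl2] := dl.
have -> : coord_bump u0 r i = bump u0 r * l by [].
by rewrite deriveM// dl2 /l subrr scale0r addr0.
Unshelve. all: by end_near. Qed.

(** Vector fields act on functions on the whole group, so the chart coordinates must be cut off
    before a field can be applied to them. These cut-offs still detect all tangent vectors at
    [u0]. *)
Lemma chart_ball c (u0 : 'rV[R]_n) : A c -> img c u0 ->
  exists2 r : R, 0 < r & forall i,
    smooth_fun A (ext0 c (coord_bump u0 r i)) /\
    {in img c, ext0 c (coord_bump u0 r i) \o psi c =1 coord_bump u0 r i}.
Proof.
move=> Ac cu; have oc := open_chart_img HA Ac.
have [r r0 rU] := open_ball_subset oc cu.
exists r => // i; split; last first.
  move=> u /[!inE] du /=; have cc := atlas_chart HA Ac.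
  by rewrite /ext0 asboolT ?psiK//; exact: psi_dom.
apply: (@ext0_smooth R n G A HA c (coord_bump u0 r i) _ hG Ac (@compact_closed_ball _ _ u0 r r0)) => //.
- move=> u; rewrite /coord_bump mulf_eq0 negb_or => /andP[b0 _].
  exact: bump_supp b0.
- by move=> k; exact: Ck_coord_bump.
Qed.

(** [M] is the evaluation of the Lie algebra at the identity, read in the chart. Tangent vectors are
    determined by their action on the coordinate bumps, whence linearity; a left-invariant field
    that vanishes at the identity vanishes everywhere, whence invertibility. *)
Lemma E_at (c : chart 'rV[R]_n G) : A c -> dom c 1%g ->
  exists2 M : 'M[R]_n, M \in unitmx & forall u f, smooth_fun A f ->
    E u f 1%g = 'D_(u *m M) (f \o psi c : 'rV[R]_n -> R^o) (phi c 1%g).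
Proof.
move=> Ac c1; have cc := atlas_chart HA Ac; set u0 := phi c 1%g.
have cu0 : img c u0 by exact: phi_img.
have [r r0 Hr] := chart_ball Ac cu0.
have HB := hg_basis HG.
have /choice[al Hal] : forall u, exists w, forall f, smooth_fun A f ->
    E u f 1%g = 'D_w (f \o psi c : 'rV[R]_n -> R^o) u0.
  move=> u; have [vf _] := basis_field HB u; have [a _ Ha] := vf c Ac.
  by exists (a u0) => f sf; rewrite -(Ha f sf u0 cu0) phiK.
have b0 : bump u0 r u0 != 0 by rewrite gt_eqF// bump_center.
have ext_al u i : E u (ext0 c (coord_bump u0 r i)) 1%g = bump u0 r u0 * al u 0 i.
  have [sf eqf] := Hr i; rewrite (Hal _ _ sf) -derive_coord_bump.
  apply: near_eq_derive; near=> v; apply: eqf; rewrite inE; near: v.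
  by apply: open_nbhs_nbhs; split => //; exact: open_chart_img Ac.
have al_lin : linear al.
  move=> k u v; apply/rowP => i; rewrite !mxE.
  apply: (mulfI b0); rewrite -ext_al (basis_linear HB k u v (Hr i).1) !ext_al.
  by rewrite mulrDr mulrCA.
pose al' : {linear 'rV[R]_n -> 'rV[R]_n} :=
  HB.pack al (GRing.isLinear.Build _ _ _ _ _ al_lin).
have alM u : al u = u *m lin1_mx al' by rewrite mul_rV_lin1.
exists (lin1_mx al'); last by move=> u f sf; rewrite -alM; exact: Hal.
rewrite -row_free_unit -kermx_eq0; apply/eqP/row_matrixP => i; rewrite row0.
set k := row i _; have k0 : al k = 0.
  by rewrite alM -row_mul mulmx_ker row0.
apply: (basis_inj HB) => f sf x.
have E0 : E 0 f x = 0.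
  have := basis_linear HB (-1) 0 0 sf x; rewrite scaler0 addr0 => ->.
  by rewrite mulN1r addNr.
rewrite E0 -[x]mulg1.
have [_ linv] := basis_field HB k.
rewrite -(linv f sf x 1%g) Hal ?k0 ?derive0//.
exact: smooth_translate.
Unshelve. all: by end_near. Qed.

Section DilationInChart.
Variable c : chart 'rV[R]_n G.
Hypothesis Ac : A c.
Hypothesis c1 : dom c 1%g.
Let u0 := phi c 1%g.
Let cc := atlas_chart HA Ac.
Let F l := phi c \o dil l \o psi c.

Lemma dil_chart_C1 l : 0 < l -> exists U : set 'rV[R]_n,
  [/\ open U, U u0, Ck 1 U (F l) & forall u, U u -> img c u /\ dom c (dil l (psi c u))].
Proof.
move=> l0; exists (img c `&` psi c @^-1` (dil l @^-1` dom c)).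
have oP : open (dil l @^-1` dom c).
  by apply: open_comp; [move=> x _; exact: (dil_continuous HD l0)|exact: open_dom].
split.
- exact: open_chart_preimage.
- by split => /=; [exact: phi_img|rewrite /u0 phiK// (dil_id HD)].
- have [_ /(_ (prod_chart (Chart setT setT id id) c) c)] := dil_smooth HD.
  move=> /(_ (ex_intro2 _ _ _ erefl (ex_intro2 _ _ c Ac erefl)) Ac 1%N).
  move=> /(Ck_slice2 (l : R^o)); apply: Ck_sub => u [cu /= du].
  by split => //=.
- by move=> u [].
Qed.

Lemma dil_chart_derive : exists2 M : 'M[R]_n, M \in unitmx &
  forall l, 0 < l -> forall v,
    'D_v (F l) u0 = v *m (invmx M *m lie_dil A0 l *m M).
Proof.
have [M Mu HM] := E_at Ac c1; exists M => // l l0 v.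
have cu0 : img c u0 by exact: phi_img.
have [r r0 Hr] := chart_ball Ac cu0.
have [U [oU Uu0 CF UF]] := dil_chart_C1 l0.
have Fu0 : F l u0 = u0 by rewrite /F /= /u0 phiK// (dil_id HD).
have b0 : bump u0 r u0 != 0 by rewrite gt_eqF// bump_center.
apply/rowP => i; apply: (mulfI b0).
have [sf eqf] := Hr i; set f := ext0 c (coord_bump u0 r i) in sf eqf.
(* [E (v *m invmx M)] is the left-invariant field whose value at the identity is [v] in the
   chart. *)
have := dil_differential HD l0 (v *m invmx M) sf 1%g.
rewrite (dil_id HD l0) HM; last exact: (smooth_dil HL HD).
rewrite HM// mulmxKV// !mulmxA -/u0.
have -> : 'D_(v *m invmx M *m lie_dil A0 l *m M) (f \o psi c : 'rV[R]_n -> R^o) u0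
    = 'D_(v *m invmx M *m lie_dil A0 l *m M) (coord_bump u0 r i) u0.
  apply: near_eq_derive; near=> w; apply: eqf; rewrite inE; near: w.
  by apply: open_nbhs_nbhs; split => //; exact: open_chart_img Ac.
rewrite derive_coord_bump => <-.
have -> : 'D_v (f \o dil l \o psi c : 'rV[R]_n -> R^o) u0 =
     'D_v (coord_bump u0 r i \o F l) u0.
  apply: near_eq_derive; near=> w.
  have [cw dw] : img c w /\ dom c (dil l (psi c w)).
    by apply: UF; near: w; exact: open_nbhs_nbhs.
  by rewrite /= -eqf ?inE /=; [rewrite phiK|exact: phi_img].
have [dg dgE] : differentiable (coord_bump u0 r i) (F l u0) /\
   forall h, 'd (coord_bump u0 r i) (F l u0) h = 'D_h (coord_bump u0 r i) (F l u0).
  have [dg _] := C1_differentiable openT I (Ck_coord_bump 1 u0 r i) (a := F l u0).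
  by split => // h; rewrite deriveE.
have [_ /(_ v) [dF _]] := CF.
have [_ ->] := derivable_comp_diff (dF u0 Uu0) dg.
by rewrite dgE Fu0 derive_coord_bump.
Unshelve. all: by end_near. Qed.

(** The derivative at the fixed point shrinks norms by 1/4 and differentiability adds an error of at
    most 1/4 near it; together this gives 1/2. *)
Lemma dil_chart_contraction : exists l r : R,
  [/\ 0 < l < 1, 0 < r, [set u | `|u - u0| <= r] `<=` img c &
   forall u, `|u - u0| <= r -> dom c (dil l (psi c u)) /\
     `|F l u - u0| <= 2^-1 * `|u - u0|].
Proof.
have [M Mu HM] := dil_chart_derive.
have [l l01 Hl] := lie_dil_contracts (hg_diag HG) (hg_pos HG) Mu.
have l0 : 0 < l by case/andP: l01.
have [U [oU Uu0 CF UF]] := dil_chart_C1 l0.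
have Fu0 : F l u0 = u0 by rewrite /F /= /u0 phiK// (dil_id HD).
have [_ DF] := CF.
have : \forall h \near (0 : 'rV[R]_n), forall i : 'I_n,
   `|F l (h + u0) 0 i - u0 0 i - ('D_h (F l) u0) 0 i| <= 4^-1 * `|h|.
  apply: (@filter_forall _ _ (fun i h => `|F l (h + u0) 0 i - u0 0 i - ('D_h (F l) u0) 0 i| <= 4^-1 * `|h|)
    (nbhs (0 : 'rV[R]_n)) (nbhs_filter _)) => i.
  have Ci : Ck 1 U (fun u => F l u 0 i : R^o) by exact: Ck_coord.
  have [di _] := C1_differentiable oU Uu0 Ci.
  have /eqaddoP := diff_locally di => /(_ 4^-1) /=.
  rewrite invr_gt0 ltr0n => /(_ isT).
  have : (nbhs (0 : 'rV[R]_n)) = nbhs (nbhs (0 : 'rV[R]_n)) by [].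
  move=> -> ; apply: filterS => h.
  rewrite !fctE /= Fu0 opprD addrA -deriveE//.
  by rewrite derive_mx ?mxE//; have [d1 _] := DF h; exact: d1.
move=> /nbhs_ballP[d /= d0 Hd].
have [r r0 rU] := open_ball_subset oU Uu0.
exists l, (Num.min r (d / 2)); split => //.
- by rewrite lt_min r0 divr_gt0.
- by move=> u /=; rewrite le_min => /andP[/rU /UF[]].
- move=> u; rewrite le_min => /andP[/rU Uu ud]; have [cu du] := UF u Uu.
  split => //; apply: mx_norm_le => [|i]; first by rewrite mulr_ge0.
  have /Hd/(_ i) : ball (0 : 'rV[R]_n) d (u - u0).
    rewrite -ball_normE /= sub0r normrN; apply: le_lt_trans ud _.
    by rewrite ltr_pdivrMr// ltr_pMr// ltr1n.
  rewrite subrK HM// => le.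
  have le2 : `|((u - u0) *m (invmx M *m lie_dil A0 l *m M)) 0 i| <= 4^-1 * `|u - u0|.
    exact: le_trans (mx_norm_coord _ _) (Hl _).
  rewrite !mxE -[X in `|X|](subrK (((u - u0) *m (invmx M *m lie_dil A0 l *m M)) 0 i)).
  apply: le_trans (ler_normD _ _) _.
  apply: le_trans (lerD le le2) _.
  by rewrite -mulrDl ler_wpM2r//; lra.
Qed.

End DilationInChart.
End Properness.

(** * Attraction to the identity and compactness of quasi-balls *)

Section QuasiNormProper.
Context {R : realType} {n : nat} {G : groupSpaceType}.
Context {A : set (chart 'rV[R]_n G)} {E : 'rV[R]_n -> (G -> R) -> G -> R}.
Context {A0 : 'M[R]_n} {dil : R -> G -> G}.
Hypothesis HG : homogeneous_group A E A0.
Hypothesis HD : induced_dilations A E A0 dil.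
Let HL := hg_lie HG.
Let HA := lie_atlas HL.
Let hG := lie_hausdorff HL.

Lemma mulG_continuous (x : G * G) : {for x, continuous (fun x : G * G => (x.1 * x.2)%g)}.
Proof. by have [+ _] := lie_mul HL; apply. Qed.

Lemma invG_continuous (x : G) : {for x, continuous (fun x : G => (x^-1)%g)}.
Proof. by have [+ _] := lie_inv HL; apply. Qed.

Lemma cvgMG (f g : nat -> G) (a b : G) : f @ \oo --> a -> g @ \oo --> b ->
  (fun k => f k * g k)%g @ \oo --> (a * b)%g.
Proof.
move=> fa gb.
have h : (fun k => (f k, g k)) @ \oo --> (a, b) by exact: cvg_pair.
have c := @mulG_continuous (a, b); rewrite /prop_for /continuous_at /= in c.
exact: (cvg_comp _ _ h c).
Qed.

Lemma cvgVG (f : nat -> G) (a : G) : f @ \oo --> a ->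
  (fun k => (f k)^-1)%g @ \oo --> (a^-1)%g.
Proof.
move=> fa; have c := @invG_continuous a; rewrite /prop_for /continuous_at /= in c.
exact: (cvg_comp _ _ fa c).
Qed.

Lemma lmulG_continuous (a : G) : continuous (fun x : G => (a * x)%g).
Proof.
move=> x.
have h : (fun x : G => (a, x)) @ x --> (a, x).
  exact: (@cvg_pair G G G (nbhs x) (nbhs a) (nbhs x) _ _ _ (fun=> a) id (cvg_cst _) cvg_id).
have c := @mulG_continuous (a, x); rewrite /prop_for /continuous_at /= in c.
exact: (cvg_comp _ _ h c).
Qed.

Lemma iter_dil (l : R) k x : 0 < l -> iter k (dil l) x = dil (l ^+ k) x.
Proof.
move=> l0; elim: k => [|k IH]; first by rewrite expr0 (dil1 HD).
by rewrite iterS IH exprS (dilM HD)// exprn_gt0.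
Qed.

(* A neighbourhood of the identity which is contracted by one dilation; its
   basin of attraction is an open, hence closed, subgroup. *)
Lemma contracted_nbhs : exists (l : R) (V K : set G),
  [/\ 0 < l < 1, open V, V 1%g, compact K &
   [/\ V `<=` K, K `<=` dil l @^-1` V &
   forall x, V x -> (fun k => iter k (dil l) x) @ \oo --> 1%g]].
Proof.
have [c Ac c1] := atlas_cover HA 1%g; have cc := atlas_chart HA Ac.
have [l [r [l01 r0 rc Hlr]]] := dil_chart_contraction HG HD Ac c1.
set u0 := phi c 1%g in rc Hlr.
have l0 : 0 < l by case/andP: l01.
pose B := [set u | `|u - u0| <= r].
pose V := dom c `&` phi c @^-1` ball u0 r.
have oV : open V.
  apply: open_continuous_preimage; first exact: open_dom.
    by move=> x cx; exact: phi_continuous.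
  exact: ball_open.
have step x rho : dom c x -> `|phi c x - u0| <= rho -> rho <= r ->
    dom c (dil l x) /\ `|phi c (dil l x) - u0| <= 2^-1 * rho.
  move=> cx xrho rhor; have [] := Hlr (phi c x) (le_trans xrho rhor).
  rewrite /= phiK// => d1 d2; split => //; apply: le_trans d2 _.
  by rewrite ler_wpM2l.
exists l, V, (psi c @` B); split => //.
- by split => //=; exact: ballxx.
- apply: continuous_compact; last exact: compact_closed_ball.
  apply/continuous_in_subspaceT => u /[!inE] /rc cu.
  exact: psi_continuous.
split.
- move=> x [cx]; rewrite /= -ball_normE /= distrC => xr.
  by exists (phi c x); [exact: ltW|rewrite phiK].
- move=> _ [u ur <-] /=; have cu := rc u ur.
  have := step (psi c u) r (psi_dom cc cu); rewrite psiK// => /(_ ur (lexx _))[d1 d2].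
  split => //; rewrite /= -ball_normE /= distrC (le_lt_trans d2)//.
  by rewrite mulrC ltr_pdivrMr// ltr_pMr// ltr1n.
- move=> x [cx]; rewrite /= -ball_normE /= distrC => /ltW xr.
  have itx k : dom c (iter k (dil l) x) /\ `|phi c (iter k (dil l) x) - u0| <= 2^-1 ^+ k * r.
    elim: k => [|k [d1 d2]]; first by rewrite expr0 mul1r.
    rewrite iterS exprS -mulrA; apply: step => //.
    by rewrite ger_pMl// exprn_ile1// invf_le1// ler1n.
  have phicvg : (fun k => phi c (iter k (dil l) x)) @ \oo --> u0.
    apply/cvgrPdist_le => e e0.
    have : (fun k => r * 2^-1 ^+ k : R^o) @ \oo --> (0 : R^o).
      by apply: cvg_geometric; rewrite ger0_norm// invf_lt1// ltr1n.
    move=> /cvgrPdist_le/(_ _ e0); apply: filterS => k; rewrite sub0r normrN => le.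
    rewrite distrC; apply: le_trans (itx k).2 _; rewrite mulrC.
    exact: le_trans (ler_norm _) le.
  have -> : (fun k => iter k (dil l) x) = psi c \o (fun k => phi c (iter k (dil l) x)).
    by apply/funext => k /=; rewrite phiK//; exact: (itx k).1.
  have -> : 1%g = psi c u0 by rewrite phiK.
  have h := psi_continuous cc (phi_img cc c1); exact: (cvg_comp _ _ phicvg h).
Qed.

Lemma dil_attracts (l : R) (V : set G) : 0 < l -> open V -> V 1%g ->
  (forall x, V x -> (fun k => iter k (dil l) x) @ \oo --> 1%g) ->
  forall x, (fun k => iter k (dil l) x) @ \oo --> 1%g.
Proof.
move=> l0 oV V1 HV.
pose B : set G := [set x | (fun k => iter k (dil l) x) @ \oo --> 1%g].
have B1 : B 1%g.
  rewrite /B /= (_ : (fun k => _) = fun=> 1%g); first exact: cvg_cst.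
  by apply/funext => k; rewrite iter_dil// (dil_id HD)// exprn_gt0.
have BM x y : B x -> B y -> B (x * y)%g.
  rewrite /B /= => Bx By; have := cvgMG Bx By; rewrite mulg1.
  suff -> : (fun k => iter k (dil l) x * iter k (dil l) y)%g =
    (fun k => iter k (dil l) (x * y)%g) by [].
  apply/funext => k.
  by rewrite !iter_dil// (dil_morphism HD)// exprn_gt0.
have BV x : B x -> B (x^-1)%g.
  rewrite /B /= => Bx; have := cvgVG Bx; rewrite invg1.
  suff -> : (fun k => (iter k (dil l) x)^-1)%g = (fun k => iter k (dil l) (x^-1)%g) by [].
  apply/funext => k; apply/esym.
  rewrite !iter_dil//; apply: (mulgI (dil (l ^+ k) x)).
  by rewrite mulgV -(dil_morphism HD) ?exprn_gt0// mulgV (dil_id HD)// exprn_gt0.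
have oB : open B.
  rewrite openE => x Bx.
  have [k Vk] : exists k, V (iter k (dil l) x).
    have : nbhs 1%g V by exact: open_nbhs_nbhs.
    by move=> /Bx [k _ Hk]; exists k; exact: Hk (leqnn k).
  have oP : open ((fun y => iter k (dil l) y) @^-1` V).
    apply: open_comp => // y _.
    rewrite (_ : (fun y => _) = dil (l ^+ k)); last by apply/funext => z; rewrite iter_dil.
    by apply: (dil_continuous HD); exact: exprn_gt0.
  have : nbhs x ((fun y => iter k (dil l) y) @^-1` V) by exact: open_nbhs_nbhs.
  apply: filterS => y /HV h; rewrite /B /= -(cvg_shiftn k).
  by under eq_fun do rewrite iterD.
(* For y outside the subgroup [B], the coset of y is an open neighbourhood of y disjoint from
   [B]. *)
have cB : closed B.
  rewrite -[B]setCK; apply: open_closedC; rewrite openE => y nBy.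
  have oP : open ((fun z => y^-1 * z)%g @^-1` B).
    by apply: open_comp => // z _; exact: lmulG_continuous.
  have : nbhs y ((fun z => y^-1 * z)%g @^-1` B).
    by apply: open_nbhs_nbhs; split => //=; rewrite mulVg.
  apply: filterS => z /= Byz Bz; apply: nBy.
  by have := BM _ _ Bz (BV _ Byz); rewrite invgM invgK mulVKg.
have BT : B = setT.
  apply: (hg_connected HG); first by exists 1%g.
    by exists B => //; rewrite setTI.
  by exists B => //; rewrite setTI.
by move=> x; have : B x by rewrite BT.
Qed.

Context {q : G -> R}.
Hypothesis HQ : homogeneous_quasi_norm dil q.

Lemma q_cont : continuous (q : G -> R^o).
Proof. exact: (qnorm_continuous HQ). Qed.

Lemma closed_qball (rho : R) : closed [set x | q x <= rho].
Proof.
have -> : [set x | q x <= rho] = (q : G -> R^o) @^-1` [set x | x <= rho] by [].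
by apply: preimage_closed; [move=> x _; exact: q_cont|exact: closed_le].
Qed.

(** The point is that a small quasi-norm forces membership in the contracted neighbourhood [V]. A
    ball of any radius is then carried into [V], hence into the compact [K], by a power of the
    dilation, and is a closed subset of a dilate of [K]. *)
Lemma compact_qball (rho : R) : compact [set x | q x <= rho].
Proof.
have [l [V [K [/andP[l0 l1] oV V1 cK [VK KV HV]]]]] := contracted_nbhs.
have attr := dil_attracts l0 oV V1 HV.
have [m m0 Hm] : exists2 m : R, 0 < m & forall z, q z < m -> V z.
  (* [Z] contains every first entry into [V] of an orbit that starts outside [V]. It is compact and
     avoids the identity, so [q] has a positive minimum on it; since [q] decreases along orbits,
     that minimum also bounds [q] below outside [V]. *)
  pose Z := K `&` ~` (dil l^-1 @^-1` V).
  have oP : open (dil l^-1 @^-1` V).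
    by apply: open_comp => // z _; apply: (dil_continuous HD); rewrite invr_gt0.
  have cZ : compact Z by apply: compact_closedI => //; exact: open_closedC.
  have [m m0 Zm] : exists2 m : R, 0 < m & forall z, Z z -> m <= q z.
    have [Z0|/set0P/negP/negPn/eqP Z0] := pselect (Z !=set0); last first.
      by exists 1 => // z; rewrite Z0.
    have [|z /[!inE] Zz Hz] := compact_EVT_min (f := q) Z0 cZ.
      by apply: continuous_subspaceT; exact: q_cont.
    exists (q z); last by move=> t Zt; apply: Hz; rewrite inE.
    rewrite lt_neqAle (qnorm_ge0 HQ) andbT eq_sym; apply/eqP => /(qnorm_eq0 HQ) z1.
    by move: Zz => [_]; apply; rewrite /= z1 (dil_id HD)// invr_gt0.
  exists m => // z zm; apply: contrapT => nVz.
  have exk : exists k, `[< V (iter k (dil l) z) >].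
    have : nbhs 1%g V by exact: open_nbhs_nbhs.
    by move=> /(attr z) [k _ Hk]; exists k; apply/asboolP; exact: Hk (leqnn k).
  case: (ex_minnP exk) => -[|k] /asboolP Vk mink; first exact: nVz.
  have /Zm : Z (iter k.+1 (dil l) z).
    split; first exact: VK.
    rewrite /= (dilK HD)// => Vk'.
    by have := mink k; rewrite ltnn asboolT// => /(_ isT).
  rewrite iter_dil// (qnorm_dil HQ) ?exprn_gt0// leNgt => /negP; apply.
  by apply: le_lt_trans zm; rewrite ler_piMl ?(qnorm_ge0 HQ)// exprn_ile1 ?ltW.
have [j Hk] : exists j, l ^+ j * rho < m.
  have : (fun j => rho * l ^+ j : R^o) @ \oo --> (0 : R^o).
    by apply: cvg_geometric; rewrite ger0_norm// ltW.
  move=> /cvgrPdist_lt/(_ _ m0)[j _ /(_ j (leqnn j))].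
  rewrite /= sub0r normrN mulrC => h; exists j; exact: le_lt_trans (ler_norm _) h.
have lj0 : 0 < l ^+ j by rewrite exprn_gt0.
apply: (@subclosed_compact _ _ (dil (l ^+ j)^-1 @` K)).
- exact: closed_qball.
- apply: continuous_compact => //; apply: continuous_subspaceT => z.
  by apply: (dil_continuous HD); rewrite invr_gt0.
- move=> z /= zr; exists (dil (l ^+ j) z); last by rewrite (dilK HD).
  apply/VK/Hm; rewrite (qnorm_dil HQ)//; apply: le_lt_trans Hk.
  by rewrite ler_wpM2l// ltW.
Qed.

End QuasiNormProper.

(** * Polar coordinates *)

Section BorelMeasures.
Context {R : realType} {G : groupSpaceType}.

Lemma borel_open (O : set G) : open O -> measurable (O : set (borel G)).
Proof. by move=> oO; apply: sub_sigma_algebra. Qed.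

Lemma borel_closed (F : set G) : closed F -> measurable (F : set (borel G)).
Proof.
by move=> cF; rewrite -[F]setCK; apply: measurableC; apply: borel_open; exact: closed_openC.
Qed.

Lemma continuous_borel (f : G -> R) : continuous (f : G -> R^o) ->
  measurable_fun setT (f : borel G -> R).
Proof.
move=> cf; apply: (measurability _ (RGenOInfty.measurableE R)) => //.
move=> _ [_ [a ->] <-]; rewrite setTI; apply: borel_open.
apply: (@open_comp G R^o f) => [x _|]; first exact: cf.
by have -> : `]a, +oo[%classic = [set x : R^o | a < x]; [exact: set_itvoy|exact: open_gt].
Qed.

Lemma compact_bounded_fun (T : topologicalType) (f : T -> R) (K : set T) : continuous (f : T -> R^o) ->
  compact K -> (forall x, f x != 0 -> K x) -> exists2 M, 0 <= M & forall x, `|f x| <= M.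
Proof.
move=> cf cK fK.
have [K0|/set0P/negP/negPn/eqP K0] := pselect (K !=set0); last first.
  exists 0 => // x; have [->|/fK] := eqVneq (f x) 0; first by rewrite normr0.
  by rewrite K0.
have [|z _ Hz] := @compact_EVT_max T R (fun x => `|f x|) K K0 cK.
  apply: continuous_subspaceT => x.
  apply: (@continuous_comp _ _ _ (f : T -> R^o) (Num.Def.normr : R^o -> R)); first exact: cf.
  exact: norm_continuous.
exists `|f z| => // x; have [->|/fK Kx] := eqVneq (f x) 0; first by rewrite normr0.
by apply: Hz; rewrite inE.
Qed.

End BorelMeasures.

Section PolarCoordinates.
Context {R : realType} {G : groupSpaceType} {dil : R -> G -> G} {q : G -> R}.
Context {mu sigma : {measure set (borel G) -> \bar R}} {Q : R}.
Hypothesis HQ : homogeneous_quasi_norm dil q.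
Hypothesis HM : haar_measure mu.
Hypothesis HS : sphere_measure dil q Q mu sigma.
Hypothesis compact_q : forall rho, compact [set x | q x <= rho].
Let S := quasi_sphere q.

Lemma q_continuous : continuous (q : G -> R^o).
Proof. exact: (qnorm_continuous HQ). Qed.

Lemma q_measurable : measurable_fun setT (q : borel G -> R).
Proof. by apply: continuous_borel; exact: q_continuous. Qed.

Lemma qball_measurable (rho : R) : measurable ([set x | q x <= rho] : set (borel G)).
Proof.
apply: borel_closed.
have -> : [set x | q x <= rho] = (q : G -> R^o) @^-1` [set x | x <= rho] by [].
by apply: preimage_closed; [move=> x _; exact: q_continuous|exact: closed_le].
Qed.

Lemma sphere_measurable : measurable (S : set (borel G)).
Proof.
apply: borel_closed.
have -> : S = (q : G -> R^o) @^-1` [set 1] by [].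
by apply: preimage_closed; [move=> x _; exact: q_continuous|exact: closed_eq].
Qed.

Lemma integrable_supp (f : G -> R) (rho M : R) :
  measurable_fun setT (f : borel G -> R) -> (forall x, `|f x| <= M) ->
  (forall x, f x != 0 -> q x <= rho) -> mu.-integrable setT (EFin \o (f : borel G -> R)).
Proof.
move=> mf fM fq; have mB := qball_measurable rho.
have ib : mu.-integrable [set x | q x <= rho] (EFin \o (f : borel G -> R)).
  apply: measurable_bounded_integrable => //.
  - by apply: (haar_compact HM); exact: compact_q.
  - exact: measurable_funTS.
  - exists M; split; first exact: num_real.
    by move=> z Mz x _ /=; apply: le_trans (ltW Mz).
rewrite (_ : EFin \o _ = (EFin \o (f : borel G -> R)) \_ [set x | q x <= rho]).
  exact/(integrable_mkcond _ mB).
apply/funext => x; rewrite patchE; case: ifPn => //.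
rewrite notin_setE /= => nq; have [->//|/fq] := eqVneq (f x) 0; by move/nq.
Qed.

(** [sigma S] stays an extended real here; this formula on shells and balls then yields its
    finiteness and its positivity. *)
Lemma polar_radial (H : R -> R) : measurable_fun setT H -> (forall r, 0 <= H r) ->
  mu.-integrable setT (EFin \o (fun x : borel G => H (q x))) ->
  (\int[mu]_x (H (q x))%:E =
   \int[lebesgue_measure]_(r in `]0%R, +oo[) (H r * r `^ (Q - 1))%:E * sigma S)%E.
Proof.
move=> mH H0 iH; rewrite (HS iH).
have -> : (\int[lebesgue_measure]_(r in `]0%R, +oo[) (H r * r `^ (Q - 1))%:E * sigma S =
  \int[lebesgue_measure]_(r in `]0%R, +oo[) ((H r * r `^ (Q - 1))%:E * sigma S))%E.
  rewrite ge0_integralZr//.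
  - apply/measurable_EFinP; apply: measurable_funM; first exact: measurable_funTS.
    exact: measurable_funTS (measurable_powR _).
  - by move=> r _; rewrite lee_fin mulr_ge0// powR_ge0.
apply: eq_integral => r.
rewrite inE /= in_itv /= andbT => r0.
rewrite -[in RHS](@integral_cst _ _ _ sigma S sphere_measurable).
apply: eq_integral => y; rewrite inE => Sy.
by rewrite (qnorm_dil HQ)// Sy mulr1.
Qed.

Lemma mindic (a b : R) : measurable_fun setT (\1_`[a, b] : R -> R).
Proof. exact: measurable_indic. Qed.

Lemma qshell_integrable (a b : R) : mu.-integrable setT
  (EFin \o (fun x : borel G => \1_`[a, b] (q x) : R)).
Proof.
apply: (@integrable_supp (fun x => \1_`[a, b] (q x) : R) b 1).
- apply: (@measurableT_comp _ _ _ _ _ _ (\1_`[a, b] : R -> R)); last exact: q_measurable.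
  exact: measurable_indic.
- by move=> x; rewrite indicE; case: (_ \in _); rewrite ?normr1 ?normr0.
- move=> x; rewrite indicE; have [|_] := boolP (q x \in `[a, b]%classic); last by rewrite eqxx.
  by rewrite inE /= in_itv /= => /andP[].
Qed.

Hypothesis Q1 : 1 <= Q.

Lemma shell_ge1 : (1 <= \int[lebesgue_measure]_(r in `]0%R, +oo[)
  (\1_`[1, 2] r * r `^ (Q - 1))%:E)%E.
Proof.
apply: (@le_trans _ _ (\int[lebesgue_measure]_(r in `]0%R, +oo[) (\1_`[1%R, 2%R] r : R)%:E)%E).
  rewrite integral_indic// (_ : _ `&` _ = `[1, 2]%classic).
    rewrite -[leRHS]/(lebesgue_measure `[1%R, 2%R]%classic) lebesgue_measure_itv /=.
    by rewrite lte_fin ltr1n -EFinB lee_fin; lra.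
  apply/seteqP; split => [r []//|r /=]; rewrite !in_itv /= andbT => /andP[r1 r2]; split.
    by rewrite r1.
  exact: lt_le_trans r1.
apply: ge0_le_integral => //.
- by apply/measurable_EFinP; exact: measurable_indic.
- apply/measurable_EFinP; apply: measurable_funM; first exact: measurable_indic.
  exact: measurable_funTS (measurable_powR _).
- move=> r _; rewrite lee_fin indicE.
  have [|_] := boolP (r \in `[1, 2]%classic); last by rewrite mul0r.
  rewrite inE /= in_itv /= => /andP[r1 _]; rewrite mul1r.
  by rewrite -[leLHS](powRr0 r); apply: ler_powR => //; rewrite subr_ge0.
Qed.

(** The shell 1 <= q <= 2 has finite Haar measure because quasi-balls are compact, whereas an
    infinite [sigma S] would make the right side of the polar formula infinite. *)
Lemma sigma_sphere_fin : (sigma S < +oo)%E.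
Proof.
rewrite ltey; apply/negP => /eqP sS.
have iH := qshell_integrable 1 2.
have /integrableP[_] := iH; apply/negP; rewrite -leNgt.
rewrite (eq_integral (fun x : borel G => (\1_`[1, 2] (q x) : R)%:E)); last first.
  by move=> x _ /=; rewrite ger0_norm// indicE.
rewrite (@polar_radial (\1_`[1, 2] : R -> R) (mindic _ _) _ iH)//.
by rewrite sS gt0_muley//; apply: lt_le_trans shell_ge1; exact: lte01.
Qed.

(** If [sigma S] were 0, the polar formula would make every quasi-ball null, and hence the whole
    group. *)
Lemma sigma_sphere_gt0 : (0 < sigma S)%E.
Proof.
rewrite lt0e measure_ge0 andbT; apply/eqP => sS.
have mu0 (k : nat) : mu [set x | q x <= k%:R] = 0%E.
  have mB := qball_measurable k%:R.
  transitivity (\int[mu]_x (\1_`[0, k%:R] (q x) : R)%:E)%E.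
    transitivity (\int[mu]_x (\1_[set x : borel G | q x <= k%:R] x : R)%:E)%E.
      by rewrite integral_indic// setIT.
    apply: eq_integral => x _; congr EFin.
    rewrite !indicE; congr ((nat_of_bool _)%:R).
    by apply/idP/idP; rewrite !inE /= in_itv /= (qnorm_ge0 HQ).
  have iH := qshell_integrable 0 k%:R.
  by rewrite (@polar_radial (\1_`[0, k%:R] : R -> R) (mindic _ _) _ iH)// sS mule0.
have := haar_neq0 HM; apply/negP; rewrite negbK.
have -> : [set: borel G] = \bigcup_k [set x | q x <= k%:R].
  apply/seteqP; split => // x _; exists (Num.bound (q x)) => //=.
  by apply/ltW/archi_boundP; exact: (qnorm_ge0 HQ).
apply/eqP/measure_negligible.
  by apply: bigcupT_measurable => k; exact: qball_measurable.
apply: negligible_bigcup => k.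
by apply/(negligibleP _ (qball_measurable k%:R)); exact: mu0.
Qed.

Definition area : R := sphere_area q sigma.

Lemma area_gt0 : 0 < area.
Proof. by rewrite /area /sphere_area fine_gt0// sigma_sphere_gt0 sigma_sphere_fin. Qed.

Lemma sigma_sphereE : sigma S = area%:E.
Proof.
by rewrite /area /sphere_area fineK// fin_numElt sigma_sphere_fin (lt_trans _ sigma_sphere_gt0).
Qed.

End PolarCoordinates.

(** * Integration on the half-line *)

Section HalfLine.
Context {R : realType}.
Local Notation leb := (@lebesgue_measure R).
Implicit Types (f F dF G : R -> R).

Lemma pos_continuous_within f (a b : R) : 0 < a ->
  (forall r, 0 < r -> {for r, continuous (f : R^o -> R^o)}) ->
  {within `[a, b], continuous f}.
Proof.
move=> a0 cf; apply: continuous_in_subspaceT => r /[!inE] /=.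
by rewrite in_itv /= => /andP[ar _]; apply: cf; exact: lt_le_trans ar.
Qed.

Lemma pos_measurable f : (forall r, 0 < r -> {for r, continuous (f : R^o -> R^o)}) ->
  measurable_fun (`]0%R, +oo[%classic : set R) f.
Proof.
move=> cf; apply: open_continuous_measurable_fun.
  by rewrite set_itvoy; exact: open_gt.
by move=> r /[!inE] /=; rewrite in_itv /= andbT; exact: cf.
Qed.

Lemma FTC_pos F dF (a b : R) : 0 < a -> a <= b ->
  (forall r, 0 < r -> is_derive (r : R^o) (1 : R^o) (F : R^o -> R^o) (dF r)) ->
  (forall r, 0 < r -> {for r, continuous (dF : R^o -> R^o)}) ->
  (\int[leb]_(r in `[a, b]) (dF r)%:E = (F b - F a)%:E)%E.
Proof.
move=> a0; rewrite le_eqVlt => /predU1P[<-|ab] DF cdF.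
  by rewrite set_itv1 integral_set1 subrr.
have cF r : 0 < r -> {for r, continuous (F : R^o -> R^o)}.
  by move=> /DF[dFr _]; apply: differentiable_continuous; apply/derivable1_diffP.
rewrite (@continuous_FTC2 _ _ F a b ab) ?EFinB//.
- exact: pos_continuous_within.
- split=> [r||].
  + rewrite in_itv /= => /andP[ar _]; have r0 := lt_trans a0 ar.
    by case: (DF r r0).
  + by apply: cvg_at_right_filter; exact: cF.
  + by apply: cvg_at_left_filter; apply: cF; exact: lt_trans ab.
- move=> r; rewrite in_itv /= => /andP[ar _]; rewrite derive1E.
  by case: (DF r (lt_trans a0 ar)).
Qed.

(** Compact intervals exhausting the half-line; they stay away from 0, where the integrands need not
    be continuous. *)
Definition shell (n : nat) : set R := `[n.+1%:R^-1, n.+1%:R].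

Lemma shell_bigcup : \bigcup_n shell n = `]0, +oo[%classic.
Proof.
apply/seteqP; split=> [r [n _]|r]; rewrite /shell /= !in_itv /= ?andbT.
  by move=> /andP[+ _]; apply: lt_le_trans; rewrite invr_gt0.
move=> r0; have b0 : 0 <= r + r^-1 by rewrite addr_ge0 ?invr_ge0 ?ltW.
exists (Num.bound (r + r^-1)) => //=.
have := archi_boundP b0; set N := Num.bound _ => hN.
have hN1 : r + r^-1 <= N.+1%:R by rewrite -natr1 ltW// (lt_trans hN)// ltrDl.
rewrite in_itv /=; apply/andP; split.
  rewrite -[leRHS]invrK lef_pV2 ?posrE ?invr_gt0// (le_trans _ hN1)// lerDr ltW//.
by rewrite (le_trans _ hN1)// lerDl invr_ge0 ltW.
Qed.

Lemma shell_nd : nondecreasing_seq shell.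
Proof.
move=> m n mn; apply/subsetPset => r; rewrite /shell /= !in_itv /= => /andP[h1 h2].
apply/andP; split; last by rewrite (le_trans h2)// ler_nat.
by apply: le_trans h1; rewrite lef_pV2 ?posrE ?ltr0n// ler_nat.
Qed.

Lemma shell_sub n : shell n `<=` `]0, +oo[%classic.
Proof. by rewrite -shell_bigcup; exact: bigcup_sup. Qed.

Lemma cvg_shell_integrable f : leb.-integrable (`]0%R, +oo[%classic : set R) (EFin \o f) ->
  (fun n => \int[leb]_(r in shell n) (f r)%:E)%E @ \oo -->
  (\int[leb]_(r in `]0%R, +oo[) (f r)%:E)%E.
Proof.
move=> fi; have mf := measurable_int _ fi.
have mS n : measurable (shell n) by exact: measurable_itv.
have [|||||_ _] := @dominated_convergence _ _ R leb `]0, +oo[%classic (measurable_itv _)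
  (fun n => (EFin \o f) \_ (shell n)) (EFin \o f) (abse \o (EFin \o f)).
- move=> n; apply/(measurable_restrict _ (mS n) (measurable_itv _)).
  by apply: measurable_funS mf => //; exact: subIsetl.
- exact: mf.
- apply: aeW => r r0; apply: cvg_near_cst.
  have : (\bigcup_n shell n) r by rewrite shell_bigcup.
  move=> [N _ NS]; exists N => // n /= Nn; rewrite patchE ifT// inE.
  by have /subsetPset := shell_nd Nn; apply.
- exact: integrable_abse.
- apply: aeW => r r0 n; rewrite patchE; case: ifP => _ //=.
  by rewrite normr0 lee_fin.
- apply: cvg_trans; apply: near_eq_cvg; apply: nearW => n.
  have := integral_mkcondr leb (`]0%R, +oo[%classic : set R) (shell n) (EFin \o f).
  by rewrite (setIidr (@shell_sub n)) => ->.
Qed.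

Lemma cvg_shell_ge0 f : measurable_fun (`]0%R, +oo[%classic : set R) f ->
  (forall r, 0 < r -> 0 <= f r) ->
  (fun n => \int[leb]_(r in shell n) (f r)%:E)%E @ \oo -->
  (\int[leb]_(r in `]0%R, +oo[) (f r)%:E)%E.
Proof.
move=> mf f0; rewrite -shell_bigcup; apply: ge0_nondecreasing_set_cvg_integral.
- exact: shell_nd.
- by move=> n; exact: measurable_itv.
- move=> n; apply/measurable_EFinP; apply: measurable_funS mf => //.
  exact: shell_sub.
- move=> n r /shell_sub /=; rewrite in_itv /= andbT => r0.
  by rewrite lee_fin f0.
Qed.

(* The lower bound for [f] is allowed to switch from one derivative to another at [r0]. *)
Lemma FTC_ge f F1 F2 dF1 dF2 (r0 A B : R) :
  leb.-integrable (`]0%R, +oo[%classic : set R) (EFin \o f) -> 0 < r0 ->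
  (forall r, 0 < r -> is_derive (r : R^o) (1 : R^o) (F1 : R^o -> R^o) (dF1 r)) ->
  (forall r, 0 < r -> is_derive (r : R^o) (1 : R^o) (F2 : R^o -> R^o) (dF2 r)) ->
  (forall r, 0 < r -> {for r, continuous (dF1 : R^o -> R^o)}) ->
  (forall r, 0 < r -> {for r, continuous (dF2 : R^o -> R^o)}) ->
  (forall r, 0 < r <= r0 -> dF1 r <= f r) ->
  (forall r, r0 <= r -> dF2 r <= f r) ->
  (fun n => F1 n.+1%:R^-1 : R^o) @ \oo --> (A : R^o) ->
  (fun n => F2 n.+1%:R : R^o) @ \oo --> (B : R^o) ->
  ((F1 r0 - A + (B - F2 r0))%:E <= \int[leb]_(r in `]0%R, +oo[) (f r)%:E)%E.
Proof.
move=> fi r00 D1 D2 c1 c2 le1 le2 cA cB.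
have cvg1 : (fun n => (F1 r0 - F1 n.+1%:R^-1 + (F2 n.+1%:R - F2 r0))%:E) @ \oo -->
    (F1 r0 - A + (B - F2 r0))%:E.
  apply: cvg_EFin; first exact: nearW.
  apply: (@cvgD _ R^o).
    by apply: (@cvgB _ R^o) => //; exact: cvg_cst.
  by apply: (@cvgB _ R^o) => //; exact: cvg_cst.
have cvg2 := cvg_shell_integrable fi.
rewrite -(cvg_lim _ cvg1)// -(cvg_lim _ cvg2)//.
apply: lee_lim; [by apply/cvg_ex; eexists; exact: cvg1|by apply/cvg_ex; eexists; exact: cvg2|].
have [N _ HN] : \forall n \near \oo, shell n r0.
  have : (\bigcup_n shell n) r0 by rewrite shell_bigcup /= in_itv /= r00.
  move=> [N _ NS]; exists N => // n /= Nn.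
  by have /subsetPset := shell_nd Nn; apply.
exists N => // n /HN; rewrite /shell /= in_itv /= => /andP[ar0 r0b].
have a0 : 0 < n.+1%:R^-1 :> R by rewrite invr_gt0.
have fiS (a b : R) : 0 < a -> leb.-integrable `[a, b] (EFin \o f).
  move=> a0'; apply: integrableS fi => // r /=; rewrite !in_itv /= andbT => /andP[ar _].
  exact: lt_le_trans ar.
have iD dF (a b : R) : 0 < a -> (forall r, 0 < r -> {for r, continuous (dF : R^o -> R^o)}) ->
    leb.-integrable `[a, b] (EFin \o dF).
  move=> a0' cdF; apply: continuous_compact_integrable; first exact: segment_compact.
  exact: pos_continuous_within.
have mfS (a b : R) : 0 < a -> measurable_fun (`[a, b]%classic : set R) (EFin \o f).
  by move=> a0'; exact: (measurable_int _ (fiS a b a0')).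
have setE : (`[n.+1%:R^-1, n.+1%:R]%classic : set R) =
    `[n.+1%:R^-1, r0]%classic `|` `]r0, n.+1%:R]%classic.
  apply/seteqP; split => r /=; rewrite !in_itv /=.
    by move=> /andP[-> rb]; case: (leP r r0) => h; [left|right].
  by move=> [/andP[-> h]|/andP[h ->]] /=; [exact: le_trans r0b|rewrite andbT (le_trans ar0)// ltW].
have -> : (\int[leb]_(r in shell n) (f r)%:E =
   \int[leb]_(r in `[n.+1%:R^-1%R, r0]) (f r)%:E + \int[leb]_(r in `[r0, n.+1%:R%R]) (f r)%:E)%E.
  rewrite /shell setE integral_setU//.
  - rewrite integral_itv_obnd_cbnd//.
    have h := mfS r0 n.+1%:R r00.
    by apply: measurable_funS h => //; exact: subset_itv_oc_cc.
  - by rewrite -setE; exact: mfS.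
  - apply/disj_setPLR => r /=; rewrite !in_itv /= => /andP[_ h] /andP[h' _].
    by move: (lt_le_trans h' h); rewrite ltxx.
rewrite EFinD -(FTC_pos a0 ar0 D1 c1) -(FTC_pos r00 r0b D2 c2).
apply: leeD; apply: le_integral => //.
- exact: iD.
- exact: fiS.
- by move=> r; rewrite inE /= in_itv /= => /andP[r1 r2]; rewrite lee_fin le1// r2 (lt_le_trans a0).
- exact: iD.
- exact: fiS.
- by move=> r; rewrite inE /= in_itv /= => /andP[r1 r2]; rewrite lee_fin le2.
Qed.

End HalfLine.

(** * Gamma and Beta integrals *)

Section GammaBeta.
Context {R : realType}.
Local Notation leb := (@lebesgue_measure R).
Local Notation pos := (`]0%R, +oo[%classic : set R).

Lemma derive_continuous (f : R -> R) (r d : R) :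
  is_derive (r : R^o) (1 : R^o) (f : R^o -> R^o) d -> {for r, continuous (f : R^o -> R^o)}.
Proof. by move=> [df _]; apply: differentiable_continuous; apply/derivable1_diffP. Qed.

Lemma is_derive_powR (a r : R) : 0 < r ->
  is_derive (r : R^o) (1 : R^o) (fun x : R^o => x `^ a : R^o) (a * r `^ (a - 1)).
Proof.
move=> r0; have rp : r \in `]0, +oo[ by rewrite in_itv /= r0.
by split; [exact: derivable_powR|rewrite -derive1E powR_derive1].
Qed.

Lemma powR_cont (a r : R) : 0 < r -> {for r, continuous (fun x : R^o => x `^ a : R^o)}.
Proof. by move=> /(is_derive_powR a)/derive_continuous. Qed.

(** The substitution is made on the compact shells and passed to the limit by monotone convergence
    on both sides; surjectivity of [phi] ensures that the images of the shells exhaust the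
    half-line. *)
Lemma subst_pos (phi dphi G : R -> R) :
  (forall r, 0 < r -> 0 < phi r) ->
  (forall r, 0 < r -> is_derive (r : R^o) (1 : R^o) (phi : R^o -> R^o) (dphi r)) ->
  (forall r, 0 < r -> {for r, continuous (dphi : R^o -> R^o)}) ->
  (forall r s, 0 < r -> r < s -> phi r < phi s) ->
  (forall u, 0 < u -> exists2 r, 0 < r & phi r = u) ->
  (forall r, 0 < r -> 0 <= dphi r) ->
  (forall u, 0 < u -> {for u, continuous (G : R^o -> R^o)}) ->
  (forall u, 0 < u -> 0 <= G u) ->
  (\int[leb]_(u in pos) (G u)%:E = \int[leb]_(r in pos) (G (phi r) * dphi r)%:E)%E.
Proof.
move=> phi0 Dphi cdphi incr surj dphi0 cG G0.
have cphi r : 0 < r -> {for r, continuous (phi : R^o -> R^o)}.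
  by move=> /Dphi; exact: derive_continuous.
have dE r : 0 < r -> derive1 phi r = dphi r.
  by move=> r0; rewrite derive1E; case: (Dphi r r0).
have cd1 r : 0 < r -> {for r, continuous (derive1 phi : R^o -> R^o)}.
  move=> r0; have c := cdphi r r0; rewrite /prop_for /continuous_at dE//.
  apply: cvg_trans c; apply: near_eq_cvg; near=> x; rewrite dE//.
  by near: x; exact: lt_nbhsr.
have cH r : 0 < r -> {for r, continuous (fun r : R^o => G (phi r) * dphi r : R^o)}.
  move=> r0; apply: (@cvgM R R^o _ _ (G \o phi) dphi); last exact: cdphi.
  by apply: (@continuous_comp _ _ _ phi G); [exact: cphi|apply/cG/phi0].
have H0 r : 0 < r -> 0 <= G (phi r) * dphi r.
  by move=> r0; rewrite mulr_ge0 ?dphi0// G0// phi0.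
have cv1 := cvg_shell_ge0 (pos_measurable cH) H0.
pose T n : set R := `[phi n.+1%:R^-1, phi n.+1%:R]%classic.
have TE n : (\int[leb]_(u in T n) (G u)%:E =
    \int[leb]_(r in shell n) (G (phi r) * dphi r)%:E)%E.
  have a0 : 0 < n.+1%:R^-1 :> R by rewrite invr_gt0.
  have ab : n.+1%:R^-1 <= n.+1%:R :> R by rewrite (@le_trans _ _ 1) ?invf_le1 ?ler1n// ltr0n.
  rewrite /T integration_by_substitution_increasing//.
  - apply: eq_integral => r; rewrite inE /= in_itv /= => /andP[ar _].
    by rewrite fctE dE// (lt_le_trans a0).
  - move=> x y; rewrite !in_itv /= => /andP[ax _] _; apply: incr.
    exact: lt_le_trans ax.
  - by move=> r; rewrite in_itv /= => /andP[ar _]; apply: cd1; exact: lt_trans ar.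
  - apply/cvg_ex; exists (derive1 phi n.+1%:R^-1); apply: cvg_at_right_filter; exact: cd1.
  - apply/cvg_ex; exists (derive1 phi n.+1%:R); apply: cvg_at_left_filter; exact: cd1.
  - split.
    + move=> r; rewrite in_itv /= => /andP[ar _].
      by case: (Dphi r (lt_trans a0 ar)).
    + by apply: cvg_at_right_filter; exact: cphi.
    + by apply: cvg_at_left_filter; exact: cphi.
  - by apply: pos_continuous_within => //; exact: phi0.
have nd r s : 0 < r -> r <= s -> phi r <= phi s.
  by move=> r0; rewrite le_eqVlt => /predU1P[->//|/(incr _ _ r0)/ltW].
have Tnd : nondecreasing_seq T.
  move=> m n mn; apply/subsetPset => r; rewrite /T /= !in_itv /= => /andP[h1 h2].
  apply/andP; split.
    apply: le_trans h1; apply: nd; first by rewrite invr_gt0.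
    by rewrite lef_pV2 ?posrE ?ltr0n// ler_nat.
  by apply: le_trans h2 _; apply: nd => //; rewrite ler_nat.
have TU : \bigcup_n T n = pos.
  apply/seteqP; split=> [u [n _]|u /=].
    rewrite /T /= !in_itv /= ?andbT => /andP[+ _]; apply: lt_le_trans.
    by apply: phi0; rewrite invr_gt0.
  rewrite in_itv /= andbT => /surj[r r0 <-].
  have : (\bigcup_n shell n) r by rewrite shell_bigcup /= in_itv /= r0.
  move=> [n _]; rewrite /shell /= in_itv /= => /andP[h1 h2]; exists n => //.
  by rewrite /T /= in_itv /= !nd// invr_gt0.
have cv2 : (fun n => \int[leb]_(u in T n) (G u)%:E)%E @ \oo --> (\int[leb]_(u in pos) (G u)%:E)%E.
  rewrite -TU; apply: ge0_nondecreasing_set_cvg_integral => //.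
  - by move=> n; exact: measurable_itv.
  - move=> n; apply/measurable_EFinP; apply: measurable_funS (pos_measurable cG) => //.
    by rewrite -TU; exact: bigcup_sup.
  - move=> n u Tu; rewrite lee_fin G0//.
    have : (\bigcup_n T n) u by exists n.
    by rewrite TU /= in_itv /= andbT.
have E : (fun n => \int[leb]_(u in T n) (G u)%:E)%E =
    (fun n => \int[leb]_(r in shell n) (G (phi r) * dphi r)%:E)%E.
  by apply/funext => n; exact: TE.
rewrite E in cv2; apply: (cvg_unique _ cv2 cv1).
exact: ereal_hausdorff.
Unshelve. all: by end_near. Qed.

Lemma subst_powR (c b : R) (G : R -> R) : 0 < c -> 0 < b ->
  (forall u, 0 < u -> {for u, continuous (G : R^o -> R^o)}) ->
  (forall u, 0 < u -> 0 <= G u) ->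
  (\int[leb]_(u in pos) (G u)%:E =
   \int[leb]_(r in pos) (G (c * r `^ b) * (c * (b * r `^ (b - 1))))%:E)%E.
Proof.
move=> c0 b0 cG G0.
apply: (@subst_pos (fun r => c * r `^ b) (fun r => c * (b * r `^ (b - 1)))) => //.
- by move=> r r0; rewrite mulr_gt0// powR_gt0.
- by move=> r r0; exact: is_deriveZ (is_derive_powR b r0).
- move=> r r0; apply: (@cvgMl_tmp R R^o); apply: (@cvgMl_tmp R R^o).
  exact: powR_cont.
- move=> r s r0 rs; rewrite ltr_pM2l// gt0_ltr_powR// nnegrE ltW//.
  exact: lt_trans rs.
- move=> u u0; exists ((u / c) `^ b^-1); first by rewrite powR_gt0// divr_gt0.
  rewrite -powRrM mulVf ?gt_eqF// powRr1 ?divr_ge0 ?ltW//.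
  by rewrite mulrCA mulfV ?mulr1// gt_eqF.
- by move=> r r0; rewrite !mulr_ge0 ?powR_ge0 ?ltW.
Qed.

Lemma subst_scale (c : R) (G : R -> R) : 0 < c ->
  (forall u, 0 < u -> {for u, continuous (G : R^o -> R^o)}) ->
  (forall u, 0 < u -> 0 <= G u) ->
  (\int[leb]_(u in pos) (G u)%:E = \int[leb]_(r in pos) (G (c * r) * c)%:E)%E.
Proof.
move=> c0 cG G0; rewrite (subst_powR c0 ltr01 cG G0); apply: eq_integral => r.
rewrite inE /= in_itv /= andbT => r0.
by rewrite subrr powRr0 !mulr1 powRr1// ltW.
Qed.

Definition gamma_fun (s t : R) : R := t `^ (s - 1) * expR (- t).
Definition gamma_int (s : R) : \bar R := (\int[leb]_(t in pos) (gamma_fun s t)%:E)%E.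
(** The integrand of the Beta function B(s, s) in its form on the half-line. *)
Definition beta_fun (s u : R) : R := u `^ (s - 1) * (1 + u) `^ (- (2 * s)).
Definition beta_int (s : R) : \bar R := (\int[leb]_(u in pos) (beta_fun s u)%:E)%E.

Lemma gamma_fun_ge0 s t : 0 <= gamma_fun s t.
Proof. by rewrite mulr_ge0 ?powR_ge0 ?expR_ge0. Qed.

Lemma gamma_fun_cont s t : 0 < t -> {for t, continuous (gamma_fun s : R^o -> R^o)}.
Proof.
move=> t0; apply: (@cvgM R R^o _ _ (fun t => t `^ (s - 1)) (fun t => expR (- t))).
  exact: powR_cont.
by apply: (@continuous_comp _ _ _ (fun t : R => - t) expR); [exact: opp_continuous|exact: continuous_expR].
Qed.

Lemma beta_fun_ge0 s u : 0 <= beta_fun s u.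
Proof. by rewrite mulr_ge0 ?powR_ge0. Qed.

(** Tonelli's theorem for t^(2s-1) u^(s-1) e^(-t(1+u)), extended by zero to the plane. Integrating
    first in u rescales by t and gives the left side; integrating first in t rescales by 1+u and
    gives the right side. Both sides are extended reals, so convergence is settled later. *)
Lemma gamma_int_beta_int (s : R) : (gamma_int s * gamma_int s = gamma_int (2 * s) * beta_int s)%E.
Proof.
pose f (x : R * R) : R := \1_pos x.1 * \1_pos x.2 *
  (x.1 `^ (2 * s - 1) * x.2 `^ (s - 1) * expR (- (x.1 * (1 + x.2)))).
have mf : measurable_fun setT (EFin \o f).
  have m1 : measurable_fun setT (\1_pos : R -> R) by exact: measurable_indic.
  apply/measurable_EFinP; apply: measurable_funM.
    by apply: measurable_funM; [exact: (measurableT_comp m1 measurable_fst)|exact: (measurableT_comp m1 measurable_snd)].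
  apply: measurable_funM.
    apply: measurable_funM.
      exact: (measurableT_comp (measurable_powR _) measurable_fst).
    exact: (measurableT_comp (measurable_powR _) measurable_snd).
  apply: (@measurableT_comp _ _ _ _ _ _ expR); first exact: measurable_expR.
  apply: (@measurableT_comp _ _ _ _ _ _ (-%R : R -> R)); first exact: oppr_measurable.
  apply: measurable_funM; first exact: measurable_fst.
  by apply: measurable_funD => //; exact: measurable_snd.
have f0 x : (0 <= (EFin \o f) x)%E.
  by rewrite lee_fin !mulr_ge0 ?powR_ge0 ?expR_ge0.
have patch (h : R -> R) (g : R -> R) : (forall x, 0 < x -> g x = h x) ->
    (forall x, x <= 0 -> g x = 0) ->
    (\int[leb]_x (g x)%:E = \int[leb]_(x in pos) (h x)%:E)%E.
  move=> gh g0; rewrite [RHS]integral_mkcond; apply: eq_integral => x _.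
  rewrite patchE; case: ifPn; rewrite ?inE ?notin_setE /= in_itv /= andbT.
    by move=> x0; rewrite gh.
  by move=> /negP; rewrite -leNgt => x0; rewrite g0.
have i1 (x : R) : 0 < x -> \1_pos x = 1 :> R.
  by move=> x0; rewrite indicE mem_set//= in_itv /= x0.
have i0 (x : R) : x <= 0 -> \1_pos x = 0 :> R.
  by move=> x0; rewrite indicE memNset//= in_itv /= andbT; apply/negP; rewrite -leNgt.
have pw (x a b : R) : 0 < x -> x `^ a * x `^ b = x `^ (a + b).
  by move=> x0; rewrite powRD//; apply/implyP => _; rewrite gt_eqF.
have pw1 (x a : R) : 0 < x -> x `^ a * x = x `^ (a + 1).
  by move=> x0; rewrite -{2}(powRr1 (ltW x0)) pw.
have inner1 t : 0 < t -> (\int[leb]_u (f (t, u))%:E = (gamma_fun s t)%:E * gamma_int s)%E.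
  move=> t0; rewrite {1}/gamma_int (subst_scale t0 (@gamma_fun_cont s) (fun u _ => gamma_fun_ge0 s u)).
  rewrite -ge0_integralZl//; last 2 first.
  - by move=> u _; rewrite lee_fin mulr_ge0 ?gamma_fun_ge0// ltW.
  - by rewrite lee_fin gamma_fun_ge0.
  - apply: (patch (fun u => gamma_fun s t * (gamma_fun s (t * u) * t))) => u u0; last first.
      by rewrite /f /= (i0 u)// mulr0 mul0r.
    rewrite /f /= (i1 t)// (i1 u)// !mul1r /gamma_fun powRM ?ltW// mulrDr mulr1 opprD expRD.
    have -> : t `^ (2 * s - 1) = t `^ (s - 1) * t `^ (s - 1) * t.
      by rewrite pw// pw1//; congr (_ `^ _); ring.
    by ring.
  - apply/measurable_EFinP; apply: measurable_funM => //.
    apply: pos_measurable => u u0.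
    apply: (@continuous_comp _ _ _ (fun u : R^o => t * u : R^o) (gamma_fun s : R^o -> R^o)).
      by apply: (@cvgMl_tmp R R^o); exact: cvg_id.
    by apply: gamma_fun_cont; rewrite mulr_gt0.
have inner2 u : 0 < u -> (\int[leb]_t (f (t, u))%:E = (beta_fun s u)%:E * gamma_int (2 * s))%E.
  move=> u0; have v0 : 0 < 1 + u by rewrite addr_gt0.
  rewrite {1}/gamma_int (subst_scale v0 (@gamma_fun_cont (2 * s)) (fun u _ => gamma_fun_ge0 _ u)).
  rewrite -ge0_integralZl//; last 2 first.
  - by move=> t _; rewrite lee_fin mulr_ge0 ?gamma_fun_ge0// ltW.
  - by rewrite lee_fin beta_fun_ge0.
  - apply: (patch (fun t => beta_fun s u * (gamma_fun (2 * s) ((1 + u) * t) * (1 + u)))) => t t0; last first.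
      by rewrite /f /= (i0 t)// !mul0r.
    rewrite /f /= (i1 t)// (i1 u)// !mul1r /gamma_fun /beta_fun powRM ?ltW//.
    have -> : (1 + u) `^ (- (2 * s)) = ((1 + u) `^ (2 * s - 1) * (1 + u))^-1.
      rewrite powRN; congr (_^-1).
      by rewrite pw1// subrK.
    have : (1 + u) `^ (2 * s - 1) != 0 by rewrite gt_eqF// powR_gt0.
    move: ((1 + u) `^ (2 * s - 1)) => z z0; rewrite (mulrC t).
    by field; rewrite z0 gt_eqF.
  - apply/measurable_EFinP; apply: measurable_funM => //.
    apply: pos_measurable => t t0.
    apply: (@continuous_comp _ _ _ (fun t : R^o => (1 + u) * t : R^o) (gamma_fun (2 * s) : R^o -> R^o)).
      by apply: (@cvgMl_tmp R R^o); exact: cvg_id.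
    by apply: gamma_fun_cont; rewrite mulr_gt0.
have := fubini_tonelli (m1 := leb) (m2 := leb) (EFin \o f) mf f0.
have patchE' (h : R -> \bar R) (g : R -> \bar R) : (forall x, 0 < x -> g x = h x) ->
    (forall x, x <= 0 -> g x = 0%E) ->
    (\int[leb]_x g x = \int[leb]_(x in pos) h x)%E.
  move=> gh g0; rewrite [RHS]integral_mkcond; apply: eq_integral => x _.
  rewrite patchE; case: ifPn; rewrite ?inE ?notin_setE /= in_itv /= andbT.
    by move=> x0; rewrite gh.
  by move=> /negP; rewrite -leNgt => x0; rewrite g0.
rewrite (patchE' (fun t => (gamma_fun s t)%:E * gamma_int s)%E); last 2 first.
- by move=> t t0; exact: inner1.
- by move=> t t0; rewrite integral0_eq// => u _; rewrite /f /= (i0 t)// !mul0r.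
rewrite (patchE' (fun u => (beta_fun s u)%:E * gamma_int (2 * s))%E); last 2 first.
- by move=> t t0; exact: inner2.
- by move=> u u0; rewrite integral0_eq// => t _; rewrite /f /= (i0 u)// mulr0 !mul0r.
have Gm0 z : (0 <= gamma_int z)%E by apply: integral_ge0 => t _; rewrite lee_fin gamma_fun_ge0.
have -> : (\int[leb]_(t in pos) ((gamma_fun s t)%:E * gamma_int s) = gamma_int s * gamma_int s)%E.
  apply: ge0_integralZr => //.
  - by apply/measurable_EFinP; apply: pos_measurable => u u0; exact: gamma_fun_cont.
  - by move=> u _; rewrite lee_fin gamma_fun_ge0.
have -> : (\int[leb]_(u in pos) ((beta_fun s u)%:E * gamma_int (2 * s)) = beta_int s * gamma_int (2 * s))%E.
  apply: ge0_integralZr => //.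
  - apply/measurable_EFinP; apply: pos_measurable => u u0.
    apply: (@cvgM R R^o _ _ (fun u => u `^ (s - 1)) (fun u => (1 + u) `^ (- (2 * s)))).
      exact: powR_cont.
    apply: (@continuous_comp _ _ _ (fun u : R^o => 1 + u : R^o) (fun u : R^o => u `^ (- (2 * s)) : R^o)).
      by apply: (@cvgD _ R^o); [exact: cvg_cst|exact: cvg_id].
    by apply: powR_cont; rewrite addr_gt0.
  - by move=> u _; rewrite lee_fin beta_fun_ge0.
by move=> ->; rewrite muleC.
Qed.

End GammaBeta.

(** * Finiteness and positivity of the Gamma integral *)

Section GammaFinite.
Context {R : realType}.
Local Notation leb := (@lebesgue_measure R).
Local Notation pos := (`]0%R, +oo[%classic : set R).

Lemma shell_integral_le (f : R -> R) (M : R) : measurable_fun pos f ->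
  (forall r, 0 < r -> 0 <= f r) ->
  (forall n, (\int[leb]_(r in shell n) (f r)%:E <= M%:E)%E) ->
  (\int[leb]_(r in pos) (f r)%:E <= M%:E)%E.
Proof.
move=> mf f0 le; have cv := cvg_shell_ge0 mf f0.
rewrite -(cvg_lim _ cv)//; apply: lime_le; first by apply/cvg_ex; eexists; exact: cv.
exact: nearW.
Qed.

Lemma exp_half_integral : (\int[leb]_(t in pos) (expR (- (t / 2)))%:E <= 2%:E)%E.
Proof.
have D (r : R) : is_derive (r : R^o) (1 : R^o) (fun t : R^o => - 2 * expR (- (t / 2)) : R^o) (expR (- (r / 2))).
  have d1 : is_derive (r : R^o) (1 : R^o) (fun t : R^o => - (t / 2) : R^o) (- 2^-1).
    have -> : (fun t : R^o => - (t / 2) : R^o) = (fun t : R^o => (- 2^-1) * t : R^o).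
      by apply/funext => t; rewrite mulrC mulNr.
    have := is_deriveZ (- 2^-1) (is_derive_id (r : R^o) (1 : R^o)).
    by rewrite -[X in is_derive _ _ _ X]/(_ * _) mulr1.
  have d2 := @is_derive1_comp R expR (fun t : R^o => - (t / 2) : R^o) r _ _ (is_derive_expR _) d1.
  apply: is_derive_eq (is_deriveZ (- 2 : R) d2) _.
  by rewrite -[LHS]/(_ * _); field.
have cE (r : R) : {for r, continuous (fun t : R^o => expR (- (t / 2)) : R^o)}.
  apply: (@continuous_comp _ _ _ (fun t : R^o => - (t / 2) : R^o) expR); last exact: continuous_expR.
  by apply: (@cvgN _ R^o); apply: (@cvgMr_tmp R R^o); exact: cvg_id.
apply: shell_integral_le.
- by apply: pos_measurable => r _; exact: cE.
- by move=> r _; exact: expR_ge0.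
- move=> n; rewrite (@FTC_pos _ (fun t => - 2 * expR (- (t / 2))) (fun t => expR (- (t / 2))))//.
  + have h1 := expR_ge0 (- (n.+1%:R / 2 : R)).
    have h2 : expR (- (n.+1%:R^-1 / 2 : R)) <= 1.
      by rewrite -expR0 ler_expR oppr_le0 divr_ge0// invr_ge0.
    by rewrite lee_fin; lra.
  + by rewrite (@le_trans _ _ 1) ?invf_le1 ?ler1n// ltr0n.
Qed.

Lemma gamma_fun_bound (s : R) : 1 <= s -> exists2 C : R, 0 <= C & forall t, 0 < t -> gamma_fun s t <= C * expR (- (t / 2)).
Proof.
move=> s1; have s0 : 0 <= s - 1 by rewrite subr_ge0.
pose m := Num.bound (s - 1); have hm : s - 1 <= m%:R by exact/ltW/archi_boundP.
(* The summand 1 serves t <= 1. For t > 1 the power is at most t^m, and [exprn_expRN_le] at t/2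
   gives the rest: 2^m comes from (t/2)^m, and the last factor from 2/t <= 2. *)
pose C : R := 1 + 2 ^+ m * (m.+1%:R ^+ m.+1 * 2).
have C0 : 0 <= 2 ^+ m * (m.+1%:R ^+ m.+1 * 2) :> R.
  by apply: mulr_ge0; [|apply: mulr_ge0 => //]; apply: exprn_ge0.
exists C; first by rewrite addr_ge0.
move=> t t0; have e2 : expR (- t) = expR (- (t / 2)) * expR (- (t / 2)).
  by rewrite -expRD; congr expR; field.
rewrite /gamma_fun e2 mulrA ler_wpM2r ?expR_ge0//.
have [t1|t1] := leP t 1.
  apply: (@le_trans _ _ 1); last by rewrite /C lerDl.
  rewrite -[leRHS]mulr1 ler_pM ?powR_ge0 ?expR_ge0//.
    by rewrite -[leRHS](powRr0 t); apply: ger_powR => //; rewrite t0.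
  by rewrite -expR0 ler_expR oppr_le0 divr_ge0// ltW.
apply: (@le_trans _ _ (t ^+ m * expR (- (t / 2)))).
  rewrite ler_wpM2r ?expR_ge0// -powR_mulrn ?(ltW t0)//.
  by apply: ler_powR => //; exact: ltW.
have t20 : 0 < t / 2 by rewrite divr_gt0.
have := exprn_expRN_le m t20.
rewrite expr_div_n mulrAC ler_pdivrMr ?exprn_gt0// => le.
apply: le_trans le _; rewrite /C mulrC.
apply: (@le_trans _ _ (2 ^+ m * (m.+1%:R ^+ m.+1 * 2))); last by rewrite lerDr.
rewrite ler_wpM2l ?exprn_ge0// ler_wpM2l ?exprn_ge0//.
by rewrite -[leRHS]invrK lef_pV2 ?posrE// ler_pdivlMr// mulVf// ltW.
Qed.

Lemma gamma_fun_integrable (s : R) : 1 <= s -> leb.-integrable pos (EFin \o gamma_fun s).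
Proof.
move=> /gamma_fun_bound[C C0 le].
have mg : measurable_fun pos (gamma_fun s) by apply: pos_measurable => u u0; exact: gamma_fun_cont.
have me : measurable_fun pos (fun t : R => expR (- (t / 2))).
  apply: pos_measurable => r _.
  apply: (@continuous_comp _ _ _ (fun t : R^o => - (t / 2) : R^o) expR); last exact: continuous_expR.
  by apply: (@cvgN _ R^o); apply: (@cvgMr_tmp R R^o); exact: cvg_id.
apply/integrableP; split; first exact/measurable_EFinP.
apply: (@le_lt_trans _ _ (\int[leb]_(t in pos) (C%:E * (expR (- (t / 2)))%:E))%E).
  apply: ge0_le_integral => //.
  - by apply/measurable_EFinP; exact: measurableT_comp.
  - by apply/measurable_EFinP; apply: measurable_funM.
  - move=> t /=; rewrite in_itv /= andbT => t0.
    by rewrite lee_fin ger0_norm ?gamma_fun_ge0// le.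
rewrite ge0_integralZl//.
- apply: le_lt_trans (ltry (C * 2)); rewrite EFinM; apply: lee_wpmul2l => //.
  exact: exp_half_integral.
- exact/measurable_EFinP.
Qed.

Lemma gamma_int_gt0 (s : R) : 1 <= s -> (0 < gamma_int s)%E.
Proof.
move=> s1; apply: (@lt_le_trans _ _ (\int[leb]_(t in `[1%R, 2%R]) (expR (- 2))%:E)%E).
  rewrite integral_cst// -[X in (_ * X)%E]/(lebesgue_measure `[1%R, 2%R]%classic) lebesgue_measure_itv /=.
  by rewrite lte_fin ltr1n -EFinB -EFinM lte_fin mulr_gt0 ?expR_gt0//; lra.
have mg : measurable_fun pos (EFin \o gamma_fun s) by exact: measurable_int (gamma_fun_integrable s1).
have sub : (`[1, 2]%classic : set R) `<=` pos.
  by move=> r /=; rewrite !in_itv /= andbT => /andP[r1 _]; exact: lt_le_trans r1.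
apply: (@le_trans _ _ (\int[leb]_(t in `[1%R, 2%R]) (gamma_fun s t)%:E)%E); last first.
  by apply: ge0_subset_integral => // t _; rewrite lee_fin gamma_fun_ge0.
apply: ge0_le_integral => //.
- exact: measurable_funS mg.
- move=> t /=; rewrite in_itv /= => /andP[t1 t2]; rewrite lee_fin /gamma_fun.
  rewrite -[leLHS]mul1r ler_pM ?expR_ge0//.
    by rewrite -[leLHS](powRr0 t); apply: ler_powR => //; rewrite subr_ge0.
  by rewrite ler_expR lerN2.
Qed.

Lemma gamma_int_fin (s : R) : 1 <= s -> gamma_int s \is a fin_num.
Proof. by move=> s1; apply: integrable_fin_num => //; exact: gamma_fun_integrable. Qed.

End GammaFinite.

(** * The functional equation of Gamma and the value of the Beta integral *)

Section GammaRecurrence.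
Context {R : realType}.
Local Notation leb := (@lebesgue_measure R).
Local Notation pos := (`]0%R, +oo[%classic : set R).

Lemma cvg0_harmonic (u : nat -> R) (C : R) :
  (forall n, `|u n| <= C * n.+1%:R^-1) -> (fun n => u n : R^o) @ \oo --> (0 : R^o).
Proof.
move=> le; apply/cvgrPdist_le => e e0.
have : (fun n => C * n.+1%:R^-1 : R^o) @ \oo --> (C * 0 : R^o).
  by apply: (@cvgMl_tmp R nat); exact: cvg_harmonic.
rewrite mulr0 => /cvgrPdist_le/(_ _ e0); apply: filterS => n.
rewrite !sub0r !normrN => h; apply: le_trans (le n) _.
exact: le_trans (ler_norm _) h.
Qed.

(** Both inequalities are instances of [FTC_ge], one for [dF] and one for its opposite, with the
    same derivative on either side of 1. *)
Lemma FTC_eq0 (F dF : R -> R) :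
  leb.-integrable pos (EFin \o dF) ->
  (forall r, 0 < r -> is_derive (r : R^o) (1 : R^o) (F : R^o -> R^o) (dF r)) ->
  (forall r, 0 < r -> {for r, continuous (dF : R^o -> R^o)}) ->
  (fun n => F n.+1%:R^-1 : R^o) @ \oo --> (0 : R^o) ->
  (fun n => F n.+1%:R : R^o) @ \oo --> (0 : R^o) ->
  (\int[leb]_(r in pos) (dF r)%:E = 0)%E.
Proof.
move=> idF D c cA cB; apply/eqP; rewrite eq_le; apply/andP; split.
  have idN : leb.-integrable pos (EFin \o (fun r => - dF r)).
    have -> : EFin \o (fun r => - dF r) = (fun r => - (EFin \o dF) r)%E by [].
    exact: integrableN.
  have DN r : 0 < r -> is_derive (r : R^o) (1 : R^o) (fun r : R^o => - F r : R^o) (- dF r).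
    by move=> /D; exact: is_deriveN.
  have cN r : 0 < r -> {for r, continuous (fun r : R^o => - dF r : R^o)}.
    by move=> r0; apply: (@cvgN _ R^o); exact: c.
  have cAN : (fun n => - F n.+1%:R^-1 : R^o) @ \oo --> (0 : R^o).
    by rewrite -oppr0; exact: (@cvgN _ R^o).
  have cBN : (fun n => - F n.+1%:R : R^o) @ \oo --> (0 : R^o).
    by rewrite -oppr0; exact: (@cvgN _ R^o).
  have := FTC_ge idN ltr01 DN DN cN cN (fun _ _ => lexx _) (fun _ _ => lexx _) cAN cBN.
  rewrite subr0 sub0r opprK addNr => h.
  have E : (\int[leb]_(r in pos) (- dF r)%:E = - \int[leb]_(r in pos) (dF r)%:E)%E.
    rewrite -mulN1e -integralZl//; apply: eq_integral => r _.
    by rewrite -EFinM mulN1r.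
  by rewrite E oppe_ge0 in h.
have := FTC_ge idF ltr01 D D c c (fun _ _ => lexx _) (fun _ _ => lexx _) cA cB.
by rewrite subr0 sub0r subrr.
Qed.

(** Integration by parts, in the form that the derivative of -t^s e^(-t) has integral zero. *)
Lemma gamma_int_succ (s : R) : 1 <= s -> gamma_int (1 + s) = (s%:E * gamma_int s)%E.
Proof.
move=> s1; have s0 : 0 < s by exact: lt_le_trans s1.
have s2 : 1 <= 1 + s by rewrite lerDl ltW.
have i1 := gamma_fun_integrable s2; have i2 := gamma_fun_integrable s1.
have i3 : leb.-integrable pos (fun t => s%:E * (EFin \o gamma_fun s) t)%E by exact: integrableZl.
pose dF t := gamma_fun (1 + s) t - s * gamma_fun s t.
have idF : leb.-integrable pos (EFin \o dF).
  have -> : EFin \o dF = ((EFin \o gamma_fun (1 + s)) \- (fun t => s%:E * (EFin \o gamma_fun s) t))%E by [].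
  exact: integrableB.
have gE t : gamma_fun (1 + s) t = t `^ s * expR (- t) by rewrite /gamma_fun addrAC subrr add0r.
have := @FTC_eq0 (fun t => - gamma_fun (1 + s) t) dF idF.
have E : (\int[leb]_(r in pos) (dF r)%:E = gamma_int (1 + s) - s%:E * gamma_int s)%E.
  have -> : (\int[leb]_(r in pos) (dF r)%:E =
    \int[leb]_(r in pos) ((EFin \o gamma_fun (1 + s)) r - s%:E * (EFin \o gamma_fun s) r))%E by [].
  by rewrite integralB// integralZl.
have [g1 G1] : exists g, gamma_int (1 + s) = g%:E by exists (fine (gamma_int (1 + s))); rewrite fineK ?gamma_int_fin.
have [g2 G2] : exists g, gamma_int s = g%:E by exists (fine (gamma_int s)); rewrite fineK ?gamma_int_fin.
rewrite E G1 G2 -EFinM -EFinB => H.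
suff [] : (g1 - s * g2)%:E = 0%E by move=> /eqP; rewrite subr_eq0 => /eqP ->.
apply: H.
- move=> t t0; have -> : (fun r : R^o => - gamma_fun (1 + s) r : R^o) = (fun r : R^o => - (r `^ s * expR (- r)) : R^o).
    by apply/funext => r; rewrite gE.
  have de : is_derive (t : R^o) (1 : R^o) (fun r : R^o => expR (- r) : R^o) (- expR (- t)).
    have := @is_derive1_comp R expR (fun r : R^o => - r : R^o) t _ _ (is_derive_expR _) (is_deriveN (is_derive_id (t : R^o) (1 : R^o))).
    by rewrite mulrN1.
  apply: is_derive_eq (is_deriveN (is_deriveM (is_derive_powR s t0) de)) _.
  by rewrite /dF gE /gamma_fun -![_ *: _]/(_ * _); ring.
- move=> t t0; apply: (@cvgB _ R^o); first exact: gamma_fun_cont.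
  by apply: (@cvgMl_tmp R R^o); exact: gamma_fun_cont.
- apply: (@cvg0_harmonic _ 1) => n; rewrite normrN ger0_norm ?gamma_fun_ge0// gE.
  set x := n.+1%:R^-1; have x0 : 0 < x by rewrite invr_gt0.
  have x1 : x <= 1 by rewrite invf_le1 ?ler1n// ltr0n.
  rewrite mulrC ler_pM ?expR_ge0 ?powR_ge0//.
    by rewrite -expR0 ler_expR oppr_le0 ltW.
  by apply: ge1r_powR => //; rewrite x0.
- have [C C0 le] := gamma_fun_bound s2.
  apply: (@cvg0_harmonic _ (C * 2)) => n; rewrite normrN ger0_norm ?gamma_fun_ge0//.
  have x0 : 0 < n.+1%:R :> R by [].
  apply: le_trans (le _ x0) _; rewrite -mulrA ler_wpM2l//.
  rewrite expRN -[leRHS]invrK lef_pV2 ?posrE ?expR_gt0 ?invr_gt0 ?divr_gt0//.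
  rewrite invfM invrK mulrC; apply: le_trans (expR_ge1Dx _).
  by rewrite lerDr.
Qed.

Lemma gamma_intE (s : R) : 1 <= s -> gamma_int s = (Gamma s)%:E.
Proof. by move=> s1; rewrite /Gamma /Rintegral fineK// gamma_int_fin. Qed.

Lemma Gamma_gt0 (s : R) : 1 <= s -> 0 < Gamma s.
Proof. by move=> s1; rewrite -lte_fin -gamma_intE// gamma_int_gt0. Qed.

Lemma Gamma_succ (s : R) : 1 <= s -> Gamma (1 + s) = s * Gamma s.
Proof.
move=> s1; apply: EFin_inj; rewrite -gamma_intE.
  by rewrite gamma_int_succ// gamma_intE.
by rewrite lerDl (le_trans _ s1).
Qed.

Lemma beta_intE (s : R) : 1 <= s -> beta_int s = (Gamma s ^+ 2 / Gamma (2 * s))%:E.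
Proof.
move=> s1; have s2 : 1 <= 2 * s by lra.
have g0 := Gamma_gt0 s2.
have := gamma_int_beta_int s; rewrite !gamma_intE//.
have : (0 <= beta_int s)%E by apply: integral_ge0 => t _; rewrite lee_fin beta_fun_ge0.
case: (beta_int s) => [x _ [h]|_|//].
  by congr EFin; rewrite expr2 h mulrAC mulfV ?mul1r// gt_eqF.
by rewrite gt0_muley ?lte_fin// -EFinM.
Qed.

End GammaRecurrence.

(** * Nagy's inequality on the half-line *)

Section Theta.
Context {R : realType}.
Local Notation leb := (@lebesgue_measure R).
Local Notation pos := (`]0%R, +oo[%classic : set R).

(** The absolute value keeps the base where [powR] is a genuine power, so that continuity at 0 holds
    from both sides. *)
Lemma normpowR_cont (c y : R) : 0 < c ->
  {for y, continuous (fun y : R^o => `|y| `^ c : R^o)}.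
Proof.
move=> c0; have [->|y0] := eqVneq y 0.
  rewrite /prop_for /continuous_at normr0 powR0 ?gt_eqF//.
  apply/cvgrPdist_lt => e e0; near=> x.
  rewrite sub0r normrN ger0_norm ?powR_ge0//.
  have -> : e = (e `^ c^-1) `^ c by rewrite -powRrM mulVf ?gt_eqF// powRr1// ltW.
  rewrite gt0_ltr_powR// ?nnegrE ?powR_ge0//.
  near: x; apply: (@pseudometric_normed_Zmodule.nbhs0_lt R R^o).
  by rewrite powR_gt0.
apply: (@continuous_comp _ _ _ (Num.Def.normr : R^o -> R^o) (fun y : R^o => y `^ c : R^o)).
  exact: norm_continuous.
by apply: powR_cont; rewrite normr_gt0.
Unshelve. all: by end_near. Qed.

Definition theta_density (c y : R) : R := Num.sqrt (1 - `|y| `^ c).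

Lemma theta_density_cont (c y : R) : 0 < c -> {for y, continuous (theta_density c : R^o -> R^o)}.
Proof.
move=> c0; apply: (@continuous_comp _ _ _ (fun y : R^o => 1 - `|y| `^ c : R^o) (Num.sqrt : R^o -> R^o)).
  by apply: (@cvgB _ R^o); [exact: cvg_cst|exact: normpowR_cont].
exact: sqrt_continuous.
Qed.

(** Starting at -1 instead of 0 makes 0 an interior point: [theta] is differentiated at |h|^2/M^2,
    which tends to 0 at both ends of the half-line and may vanish in between. Only differences of
    values of [theta] count. *)
Definition theta (c z : R) : R := (\int[leb]_(y in `[(-1)%R, z]) theta_density c y)%R.

Lemma is_derive_theta (c z : R) : 0 < c -> -1 < z ->
  is_derive (z : R^o) (1 : R^o) (theta c : R^o -> R^o) (theta_density c z).
Proof.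
move=> c0 z1.
have zz : z < z + 1 by rewrite ltrDl.
have ik : leb.-integrable `[-1, z + 1] (EFin \o theta_density c).
  apply: continuous_compact_integrable; first exact: segment_compact.
  by apply: continuous_subspaceT => y; exact: theta_density_cont.
have [d1 d2] := continuous_FTC1_closed zz ik z1 (@theta_density_cont c z c0).
by split; [exact: d1|rewrite -derive1E; exact: d2].
Qed.

End Theta.

(** * The increment of theta as the integral of a power of sech *)

Section ThetaBeta.
Context {R : realType}.
Local Notation leb := (@lebesgue_measure R).
Local Notation pos := (`]0%R, +oo[%classic : set R).
Variable a : R.
Hypothesis a0 : 0 < a.
Let c := a^-1.
Let c0 : 0 < c. Proof. by rewrite invr_gt0. Qed.

(* With [u = e^(2t)]: [sech2_ln u = sech(t)^2] and [tanh_ln u = tanh t]. *)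
Definition sech2_ln (u : R) : R := 4 * u / (1 + u) ^+ 2.
Definition tanh_ln (u : R) : R := (u - 1) / (u + 1).
(** For u = e^(2t) one has dt = du/(2u), so the integral over the half-line is that of
    sech(t)^(2a+2) over the line. *)
Definition sech_kernel (u : R) : R := sech2_ln u `^ (a + 1) / (2 * u).

Lemma sech2_ln_gt0 u : 0 < u -> 0 < sech2_ln u.
Proof.
by move=> u0; rewrite divr_gt0 ?mulr_gt0 ?exprn_gt0 ?addr_gt0.
Qed.

Lemma sech2_ln_tanh_ln u : 0 < u -> 1 - sech2_ln u = tanh_ln u ^+ 2.
Proof.
move=> u0; rewrite /sech2_ln /tanh_ln; field.
by rewrite (addrC u) gt_eqF// addr_gt0.
Qed.

Lemma theta_density_sech2_ln u : 0 < u -> theta_density c (sech2_ln u `^ a) = `|tanh_ln u|.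
Proof.
move=> u0; rewrite /theta_density ger0_norm ?powR_ge0// -powRrM mulfV ?gt_eqF//.
by rewrite powRr1 ?ltW ?sech2_ln_gt0// sech2_ln_tanh_ln// sqrtr_sqr.
Qed.

Lemma is_derive_sech2_ln u : 0 < u ->
  is_derive (u : R^o) (1 : R^o) (sech2_ln : R^o -> R^o) (- sech2_ln u * tanh_ln u / u).
Proof.
move=> u0; have u1 : 1 + u != 0 by rewrite gt_eqF// addr_gt0.
have dP : is_derive (u : R^o) (1 : R^o) (fun u : R^o => 1 + u : R^o) (1 : R).
  by have := @is_deriveD R R^o R^o (cst 1) id u 1 0 1 _ _; rewrite add0r; apply.
have dI : is_derive (u : R^o) (1 : R^o) (fun u : R^o => (1 + u)^-1 : R^o) (- (1 + u) ^- 2).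
  split; first by apply: derivableV => //; case: dP.
  rewrite deriveV//.
  by have [_ ->] := dP; rewrite [LHS]mulr1.
have dU : is_derive (u : R^o) (1 : R^o) (fun u : R^o => 4 * u : R^o) (4 : R).
  apply: is_derive_eq (is_deriveZ (4 : R) (is_derive_id (u : R^o) (1 : R^o))) _.
  by rewrite [LHS]mulr1.
have -> : (sech2_ln : R^o -> R^o) = (fun u : R^o => (4 * u) * ((1 + u)^-1 * (1 + u)^-1) : R^o).
  by apply/funext => x; rewrite /sech2_ln expr2 invfM.
apply: is_derive_eq (is_deriveM dU (is_deriveM dI dI)) _.
rewrite -![_ *: _]/(_ * _) mulrfctE /sech2_ln /tanh_ln; field.
by rewrite ?(addrC u 1) ?u1 ?gt_eqF.
Qed.

Lemma is_derive_tanh_ln u : 0 < u ->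
  is_derive (u : R^o) (1 : R^o) (tanh_ln : R^o -> R^o) (sech2_ln u / (2 * u)).
Proof.
move=> u0; have u1 : 1 + u != 0 by rewrite gt_eqF// addr_gt0.
have u1' : u + 1 != 0 by rewrite addrC.
have dP : is_derive (u : R^o) (1 : R^o) (fun u : R^o => u + 1 : R^o) (1 : R).
  by have := @is_deriveD R R^o R^o id (cst 1) u 1 1 0 _ _; rewrite addr0; apply.
have dM : is_derive (u : R^o) (1 : R^o) (fun u : R^o => u - 1 : R^o) (1 : R).
  by have := @is_deriveB R R^o R^o id (cst 1) u 1 1 0 _ _; rewrite subr0; apply.
have dI : is_derive (u : R^o) (1 : R^o) (fun u : R^o => (u + 1)^-1 : R^o) (- (u + 1) ^- 2).
  split; first by apply: derivableV => //; case: dP.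
  rewrite deriveV//.
  by have [_ ->] := dP; rewrite [LHS]mulr1.
apply: is_derive_eq (is_deriveM dM dI) _.
rewrite -![_ *: _]/(_ * _) /sech2_ln; field.
by rewrite ?(addrC u 1) ?u1 ?gt_eqF.
Qed.

Definition sech_pow (u : R) : R := sech2_ln u `^ a.

Lemma is_derive_sech_pow u : 0 < u ->
  is_derive (u : R^o) (1 : R^o) (sech_pow : R^o -> R^o) (- a * sech_pow u * tanh_ln u / u).
Proof.
move=> u0; have z0 := sech2_ln_gt0 u0.
apply: is_derive_eq (@is_derive1_comp R (fun x : R^o => x `^ a : R^o) (sech2_ln : R^o -> R^o) u _ _
  (is_derive_powR a z0) (is_derive_sech2_ln u0)) _.
rewrite /sech_pow -(@mulr_powRB1 _ (sech2_ln u) a) ?ltW//.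
by field; rewrite gt_eqF.
Qed.

Lemma sech_kernelE u : 0 < u -> sech_kernel u = sech_pow u * sech2_ln u / (2 * u).
Proof.
move=> u0; rewrite /sech_kernel /sech_pow powRD; last by rewrite (gt_eqF (sech2_ln_gt0 u0)) implybT.
by rewrite powRr1// ltW// sech2_ln_gt0.
Qed.

Lemma sech_kernel_beta_fun u : 0 < u -> sech_kernel u = 2 `^ (2 * a + 1) * beta_fun (a + 1) u.
Proof.
move=> u0; have u1 : 0 < 1 + u by rewrite addr_gt0.
rewrite /sech_kernel /beta_fun /sech2_ln addrK.
have -> : 4 * u / (1 + u) ^+ 2 = (2 * 2) * u * ((1 + u) * (1 + u))^-1 :> R.
  by rewrite expr2; congr (_ * _ / _); lra.
rewrite !powRM ?mulr_ge0 ?invr_ge0 ?mulr_ge0 ?ltW//.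
have pD (x : R) (s t : R) : 0 < x -> x `^ s * x `^ t = x `^ (s + t).
  by move=> x0; rewrite powRD//; apply/implyP => _; rewrite gt_eqF.
have -> : ((1 + u) * (1 + u))^-1 `^ (a + 1) = (1 + u) `^ (- (2 * (a + 1))).
  rewrite -powR_inv1 ?mulr_ge0 ?ltW// -powRrM mulN1r powRM ?ltW// pD//.
  by congr (_ `^ _); ring.
rewrite (_ : u `^ (a + 1) = u `^ a * u); last by rewrite -pD// powRr1// ltW.
rewrite pD// (_ : a + 1 + (a + 1) = 2 * a + 1 + 1); last by ring.
rewrite -(pD 2)// powRr1//.
by field; rewrite gt_eqF.
Qed.

Lemma tanh_ln_continuous u : 0 < u -> {for u, continuous (tanh_ln : R^o -> R^o)}.
Proof. by move=> /is_derive_tanh_ln/derive_continuous. Qed.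
Lemma sech2_ln_continuous u : 0 < u -> {for u, continuous (sech2_ln : R^o -> R^o)}.
Proof. by move=> /is_derive_sech2_ln/derive_continuous. Qed.
Lemma sech_pow_continuous u : 0 < u -> {for u, continuous (sech_pow : R^o -> R^o)}.
Proof. by move=> /is_derive_sech_pow/derive_continuous. Qed.

Lemma sech2_ln_le u : 0 < u -> sech2_ln u <= 4 * u /\ sech2_ln u <= 4 / u.
Proof.
move=> u0; have u1 : 0 < (1 + u) ^+ 2 by rewrite exprn_gt0// addr_gt0.
have u3 : 0 < u ^+ 2 by rewrite exprn_gt0.
split; rewrite /sech2_ln ler_pdivrMr//.
  have -> : 4 * u * (1 + u) ^+ 2 = 4 * u + 4 * u * (2 * u + u ^+ 2) by ring.
  by rewrite lerDl !mulr_ge0// ?addr_ge0 ?mulr_ge0// ltW.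
rewrite mulrAC ler_pdivlMr//.
have -> : 4 * (1 + u) ^+ 2 = 4 * u * u + 4 * (1 + 2 * u) by ring.
by rewrite lerDl mulr_ge0// addr_ge0// mulr_ge0// ltW.
Qed.

Lemma tanh_ln_le1 u : 0 < u -> `|tanh_ln u| <= 1.
Proof.
move=> u0; have u1 : 0 < u + 1 by rewrite addr_gt0.
by rewrite /tanh_ln normrM (gtr0_norm (_ : 0 < (u + 1)^-1)) ?invr_gt0// ler_pdivrMr// mul1r ler_norml; lra.
Qed.

Lemma cvg_sech_pow (x : nat -> R) : (forall n, 0 < x n) ->
  (forall n, sech2_ln (x n) <= 4 * n.+1%:R^-1) -> (fun n => sech_pow (x n) : R^o) @ \oo --> (0 : R^o).
Proof.
move=> x0 le.
have zc : (fun n => sech2_ln (x n) : R^o) @ \oo --> (0 : R^o).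
  by apply: (@cvg0_harmonic _ _ 4) => n; rewrite ger0_norm// ltW// sech2_ln_gt0.
have := @normpowR_cont R a 0 a0; rewrite /prop_for /continuous_at normr0 powR0 ?gt_eqF// => ch.
have := cvg_comp _ _ zc ch; apply: cvg_trans; apply: near_eq_cvg; apply: nearW => n /=.
by rewrite ger0_norm// ltW// sech2_ln_gt0.
Qed.

Lemma cvg_sech_pow_tanh (x : nat -> R) (e : R) : (forall n, 0 < x n) ->
  (forall n, sech2_ln (x n) <= 4 * n.+1%:R^-1) ->
  (fun n => - (sech_pow (x n) * tanh_ln (x n) + e * theta c (sech_pow (x n))) : R^o) @ \oo --> (- (e * theta c 0) : R^o).
Proof.
move=> x0 le; have zc := cvg_sech_pow x0 le.
apply: (@cvgN _ R^o); rewrite -[X in _ --> X]add0r; apply: (@cvgD _ R^o).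
  apply/cvgrPdist_le => ep ep0; move/cvgrPdist_le : zc => /(_ _ ep0).
  apply: filterS => n; rewrite !sub0r !normrN normrM => h.
  by apply: le_trans h; rewrite ler_piMr// tanh_ln_le1.
apply: (@cvgMl_tmp R nat).
have thc : {for (0 : R^o), continuous (theta c : R^o -> R^o)}.
  by apply: derive_continuous (is_derive_theta c0 _); rewrite oppr_lt0.
exact: (cvg_comp _ _ zc thc).
Qed.

(* [tanh] is a primitive of [sech^2]; the two signs handle [t < 0] and [t > 0]. *)
Lemma sech_kernel_theta : leb.-integrable pos (EFin \o sech_kernel) ->
  (\int[leb]_(u in pos) (sech_kernel u)%:E <= (2 * (theta c 1 - theta c 0))%:E)%E.
Proof.
move=> ij.
have iN : leb.-integrable pos (EFin \o (fun u => - sech_kernel u)).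
  by have := integrableN ij; apply: eq_integrable.
(* By [theta_density_sech2_ln], theta composed with [sech_pow] has the derivative of [sech_pow]
   times |tanh|. With [e] = 1 before u = 1 and [e] = -1 after, it cancels the other term of the
   product rule, leaving exactly minus the kernel. *)
pose F (e u : R) : R := - (sech_pow u * tanh_ln u + e * theta c (sech_pow u)).
pose dF (e u : R) : R :=
  - (sech_pow u * (sech2_ln u / (2 * u)) + tanh_ln u * (- a * sech_pow u * tanh_ln u / u) + e * (`|tanh_ln u| * (- a * sech_pow u * tanh_ln u / u))).
have D e (u : R) : 0 < u -> is_derive (u : R^o) (1 : R^o) (F e : R^o -> R^o) (dF e u).
  move=> u0; have ze0 : -1 < sech_pow u by rewrite (@lt_le_trans _ _ 0) ?oppr_lt0// powR_ge0.
  have dt := @is_derive1_comp R (theta c) (sech_pow : R^o -> R^o) u _ _ (is_derive_theta c0 ze0) (is_derive_sech_pow u0).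
  rewrite {1}/sech_pow theta_density_sech2_ln// in dt.
  apply: is_derive_eq (is_deriveN (is_deriveD (is_deriveM (is_derive_sech_pow u0) (is_derive_tanh_ln u0)) (is_deriveZ e dt))) _.
  by rewrite /dF -![_ *: _]/(_ * _).
have dc e (u : R) : 0 < u -> {for u, continuous (dF e : R^o -> R^o)}.
  move=> u0; have ct := tanh_ln_continuous u0; have cz := sech2_ln_continuous u0; have cze := sech_pow_continuous u0.
  have cVu : {for u, continuous (fun u : R^o => u^-1 : R^o)}.
    by apply: (@cvgV _ R^o); [rewrite gt_eqF|exact: cvg_id].
  have cVu2 : {for u, continuous (fun u : R^o => (2 * u)^-1 : R^o)}.
    apply: (@cvgV _ R^o); first by rewrite gt_eqF// mulr_gt0.
    by apply: (@cvgMl_tmp R R^o); exact: cvg_id.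
  have cp : {for u, continuous (fun u : R^o => - a * sech_pow u * tanh_ln u / u : R^o)}.
    apply: (@cvgM _ R^o) => //; apply: (@cvgM _ R^o) => //.
    exact: (@cvgMl_tmp R R^o).
  apply: (@cvgN _ R^o); apply: (@cvgD _ R^o).
    apply: (@cvgD _ R^o).
      by apply: (@cvgM _ R^o) => //; apply: (@cvgM _ R^o).
    exact: (@cvgM _ R^o).
  apply: (@cvgMl_tmp R R^o); apply: (@cvgM _ R^o) => //.
  apply: (@continuous_comp _ _ _ (tanh_ln : R^o -> R^o) (Num.Def.normr : R^o -> R^o)) => //.
  exact: norm_continuous.
have t1 : sech_pow 1 = 1.
  by rewrite /sech_pow /sech2_ln (_ : 4 * 1 / (1 + 1) ^+ 2 = 1) ?powR1//; field.
have t0 : tanh_ln 1 = 0 by rewrite /tanh_ln subrr mul0r.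
have x1 n : 0 < n.+1%:R^-1 :> R by rewrite invr_gt0.
have x2 n : 0 < n.+1%:R :> R by [].
have := FTC_ge iN ltr01 (D 1) (D (-1)) (dc 1) (dc (-1)) _ _
  (@cvg_sech_pow_tanh _ 1 x1 (fun n => (sech2_ln_le (x1 n)).1)) (@cvg_sech_pow_tanh _ (-1) x2 (fun n => (sech2_ln_le (x2 n)).2)).
rewrite /F t1 t0.
have E : (\int[leb]_(r in pos) (- sech_kernel r)%:E = - \int[leb]_(r in pos) (sech_kernel r)%:E)%E.
  by rewrite -mulN1e -integralZl//; apply: eq_integral => r _; rewrite -EFinM mulN1r.
have : (\int[leb]_(r in pos) (sech_kernel r)%:E)%E \is a fin_num by exact: integrable_fin_num.
rewrite E; case: (\int[leb]_(r in pos) (sech_kernel r)%:E)%E => // x _.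
rewrite -EFinN !lee_fin => H.
have : - (1 * 0 + 1 * theta c 1) - - (1 * theta c 0) + (- (-1 * theta c 0) - - (1 * 0 + -1 * theta c 1)) <= - x.
  apply: H => u.
    move=> /andP[u0 u1]; rewrite /dF sech_kernelE// ler0_norm; last first.
      by rewrite /tanh_ln mulr_le0_ge0 ?subr_le0// invr_ge0 addr_ge0// ltW.
    by rewrite le_eqVlt; apply/orP; left; apply/eqP; field; rewrite gt_eqF.
  move=> u1; have u0 : 0 < u by exact: lt_le_trans u1.
  rewrite /dF sech_kernelE// ger0_norm; last first.
    by rewrite /tanh_ln divr_ge0 ?subr_ge0// addr_ge0// ltW.
  by rewrite le_eqVlt; apply/orP; left; apply/eqP; field; rewrite gt_eqF.
by lra.
Qed.

End ThetaBeta.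

(** * Nagy's method for a profile with two real components *)

Section Nagy.
Context {R : realType}.
Local Notation leb := (@lebesgue_measure R).
Local Notation pos := (`]0%R, +oo[%classic : set R).

(* AM-GM: [k^2 x (1 - y) + t >= 2 k sqrt(x (1 - y) t)], with [w] half the derivative of [x = |h|^2]. *)
Lemma nagy_pointwise (k w x y t : R) : 0 <= k -> 0 <= y <= 1 -> 0 <= x ->
  0 <= t -> w ^+ 2 <= x * t ->
  k ^+ 2 * (x * y) + 2 * (k * (Num.sqrt (1 - y) * w)) <= t + k ^+ 2 * x.
Proof.
move=> k0 /andP[y0 y1] x0 t0 wxt.
set r := Num.sqrt (1 - y); have r0 : 0 <= r by exact: sqrtr_ge0.
have r2 : r ^+ 2 = 1 - y by rewrite sqr_sqrtr// subr_ge0.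
have [x_eq0|x_neq0] := eqVneq x 0.
  have -> : w = 0.
    by apply/eqP; rewrite -sqrf_eq0 eq_le sqr_ge0 andbT (le_trans wxt)// x_eq0 mul0r.
  by rewrite x_eq0 !(mul0r, mulr0) !addr0.
have {}x0 : 0 < x by rewrite lt_neqAle eq_sym x_neq0.
have : w ^+ 2 / x <= t by rewrite ler_pdivrMr// mulrC.
have : 0 <= (w - k * r * x) ^+ 2 / x by rewrite divr_ge0 ?sqr_ge0// ltW.
have -> : (w - k * r * x) ^+ 2 / x = w ^+ 2 / x - 2 * (k * (r * w)) + k ^+ 2 * (r ^+ 2 * x).
  by field.
rewrite r2; move: (w ^+ 2 / x) => z h1 h2.
have -> : k ^+ 2 * (x * y) = k ^+ 2 * x - k ^+ 2 * ((1 - y) * x) by ring.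
lra.
Qed.

Variables (s k M c r0 : R) (A B dA dB W dW F : R -> R).
Hypotheses (s0 : 0 < s) (k0 : 0 < k) (M0 : 0 < M) (c0 : 0 < c) (r00 : 0 < r0).
Hypothesis DA : forall r, 0 < r -> is_derive (r : R^o) (1 : R^o) (A : R^o -> R^o) (dA r).
Hypothesis DB : forall r, 0 < r -> is_derive (r : R^o) (1 : R^o) (B : R^o -> R^o) (dB r).
Hypothesis DW : forall r, 0 < r -> is_derive (r : R^o) (1 : R^o) (W : R^o -> R^o) (dW r).
Hypothesis cdA : forall r, 0 < r -> {for r, continuous (dA : R^o -> R^o)}.
Hypothesis cdB : forall r, 0 < r -> {for r, continuous (dB : R^o -> R^o)}.
Hypothesis cdW : forall r, 0 < r -> {for r, continuous (dW : R^o -> R^o)}.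
Let v r := A r ^+ 2 + B r ^+ 2.
Hypothesis vM : forall r, 0 < r -> v r <= M ^+ 2.
Hypothesis vr0 : v r0 = M ^+ 2.
(** This is s k^2 M^(2-p) |h|^p / r with p = 2(1+c), h = A + iB; dividing by M^2 first keeps the
    base of the power in [0,1]. *)
Let N r := s * k ^+ 2 * M ^+ 2 * (v r / M ^+ 2) `^ (1 + c) / r.
Hypothesis iF : leb.-integrable pos (EFin \o F).
Hypothesis iN : leb.-integrable pos (EFin \o N).
Hypothesis leF : forall r, 0 < r ->
  s * (r * (dA r ^+ 2 + dB r ^+ 2) + k ^+ 2 * v r / r) <= F r + dW r.
Hypothesis v_at0 : (fun n => v n.+1%:R^-1 : R^o) @ \oo --> (0 : R^o).
Hypothesis v_aty : (fun n => v n.+1%:R : R^o) @ \oo --> (0 : R^o).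
Hypothesis W_at0 : (fun n => W n.+1%:R^-1 : R^o) @ \oo --> (0 : R^o).
Hypothesis W_aty : (fun n => W n.+1%:R : R^o) @ \oo --> (0 : R^o).

Let M2 : 0 < M ^+ 2. Proof. by rewrite exprn_gt0. Qed.
Let v_ge0 r : 0 <= v r. Proof. by rewrite addr_ge0 ?sqr_ge0. Qed.
Let dv r := 2 * (A r * dA r + B r * dB r).

Let Dv r : 0 < r -> is_derive (r : R^o) (1 : R^o) (v : R^o -> R^o) (dv r).
Proof.
move=> rp; apply: is_derive_eq (is_deriveD (is_deriveX 2 (DA rp)) (is_deriveX 2 (DB rp))) _.
by rewrite /dv -![_ *: _]/(_ * _) !expr1; ring.
Qed.

(** [W] is the primitive of the exact derivative by which the energy [F] differs from the square
    form in [leF]; subtracting it lets [F - N] dominate the derivative of [G e] for both signs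
    [e]. *)
Let G (e r : R) := e * (s * k * M ^+ 2) * theta c (v r / M ^+ 2) - W r.
Let dG (e r : R) := e * (s * k * M ^+ 2) * (theta_density c (v r / M ^+ 2) * (dv r / M ^+ 2)) - dW r.

Let DG e r : 0 < r -> is_derive (r : R^o) (1 : R^o) (G e : R^o -> R^o) (dG e r).
Proof.
move=> rp.
have z1 : -1 < v r / M ^+ 2 by rewrite (@lt_le_trans _ _ 0) ?oppr_lt0// divr_ge0 ?v_ge0// ltW.
have Dz : is_derive (r : R^o) (1 : R^o) (fun r : R^o => v r / M ^+ 2 : R^o) (dv r / M ^+ 2).
  have -> : (fun r : R^o => v r / M ^+ 2 : R^o) = (fun r : R^o => (M ^+ 2)^-1 * v r : R^o).
    by apply/funext => x; rewrite mulrC.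
  by apply: is_derive_eq (is_deriveZ (M ^+ 2)^-1 (Dv rp)) _; rewrite [LHS]mulrC.
have Dt := @is_derive1_comp R (theta c) (fun r : R^o => v r / M ^+ 2 : R^o) r _ _ (is_derive_theta c0 z1) Dz.
exact: (is_deriveB (is_deriveZ (e * (s * k * M ^+ 2)) Dt) (DW rp)).
Qed.

Let cA r : 0 < r -> {for r, continuous (A : R^o -> R^o)}.
Proof. by move=> /DA/derive_continuous. Qed.
Let cB r : 0 < r -> {for r, continuous (B : R^o -> R^o)}.
Proof. by move=> /DB/derive_continuous. Qed.

Let cG e r : 0 < r -> {for r, continuous (dG e : R^o -> R^o)}.
Proof.
move=> rp; apply: (@cvgB _ R^o); last exact: cdW.
apply: (@cvgMl_tmp R R^o); apply: (@cvgM _ R^o).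
  apply: (@continuous_comp _ _ _ (fun r : R^o => v r / M ^+ 2 : R^o) (theta_density c : R^o -> R^o)); last exact: theta_density_cont.
  apply: (@cvgMr_tmp R R^o).
  exact: derive_continuous (Dv rp).
apply: (@cvgMr_tmp R R^o); apply: (@cvgMl_tmp R R^o); apply: (@cvgD _ R^o).
  by apply: (@cvgM _ R^o); [exact: cA|exact: cdA].
by apply: (@cvgM _ R^o); [exact: cB|exact: cdB].
Qed.

Let dG_le e r : 0 < r -> `|e| = 1 -> dG e r <= F r - N r.
Proof.
move=> rp e1; have := leF rp; rewrite /dG /N => le.
set y := (v r / M ^+ 2) `^ c.
have z0 : 0 <= v r / M ^+ 2 by rewrite divr_ge0 ?v_ge0// ltW.
have yE : theta_density c (v r / M ^+ 2) = Num.sqrt (1 - y) by rewrite /theta_density ger0_norm.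
have y01 : 0 <= y <= 1.
  have h1 : 1 `^ c = 1 :> R by rewrite powR1.
  rewrite powR_ge0 /= -[leRHS]h1; apply: ge0_ler_powR; rewrite ?nnegrE ?ler01 ?(ltW c0)//.
  by rewrite ler_pdivrMr// mul1r vM.
have NE : (v r / M ^+ 2) `^ (1 + c) = v r / M ^+ 2 * y.
  have [->|z_neq0] := eqVneq (v r / M ^+ 2) 0.
    by rewrite powR0 ?mul0r// gt_eqF// addr_gt0.
  by rewrite powRD ?powRr1 ?z_neq0 ?implybT.
have := @nagy_pointwise k (e * (r * (A r * dA r + B r * dB r))) (v r) y
  (r ^+ 2 * (dA r ^+ 2 + dB r ^+ 2)) (ltW k0) y01 (v_ge0 r).
rewrite mulr_ge0 ?addr_ge0 ?sqr_ge0// => /(_ isT) H.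
have {}H : k ^+ 2 * (v r * y) + 2 * (k * (Num.sqrt (1 - y) *
     (e * (r * (A r * dA r + B r * dB r))))) <= r ^+ 2 * (dA r ^+ 2 + dB r ^+ 2) + k ^+ 2 * v r.
  apply: H; rewrite exprMn -[e ^+ 2]real_normK ?num_real// e1 expr1n mul1r exprMn.
  rewrite [leRHS]mulrCA ler_wpM2l ?sqr_ge0// /v.
  (* Lagrange's identity: it does the work of comparing the derivative of |h| with |h'| without
     dividing by |h|, which may vanish. *)
  have -> : (A r ^+ 2 + B r ^+ 2) * (dA r ^+ 2 + dB r ^+ 2) =
     (A r * dA r + B r * dB r) ^+ 2 + (A r * dB r - B r * dA r) ^+ 2 by ring.
  by rewrite lerDl sqr_ge0.
rewrite NE yE.
have -> : e * (s * k * M ^+ 2) * (Num.sqrt (1 - y) * (dv r / M ^+ 2)) =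
   s / r * (2 * (k * (Num.sqrt (1 - y) * (e * (r * (A r * dA r + B r * dB r)))))).
  by rewrite /dv; field; rewrite !gt_eqF.
have -> : s * k ^+ 2 * M ^+ 2 * (v r / M ^+ 2 * y) / r = s / r * (k ^+ 2 * (v r * y)).
  by field; rewrite !gt_eqF.
have sr : 0 <= s / r by rewrite divr_ge0 ?ltW.
have := ler_wpM2l sr H; rewrite mulrDr => H2.
have E : s / r * (r ^+ 2 * (dA r ^+ 2 + dB r ^+ 2) + k ^+ 2 * v r) =
   s * (r * (dA r ^+ 2 + dB r ^+ 2) + k ^+ 2 * v r / r).
  by field; rewrite gt_eqF.
rewrite E in H2.
by move: le H2; lra.
Qed.

Let cvg_theta (x : nat -> R) (e : R) : (fun n => v (x n) : R^o) @ \oo --> (0 : R^o) ->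
  (fun n => W (x n) : R^o) @ \oo --> (0 : R^o) ->
  (fun n => G e (x n) : R^o) @ \oo --> (e * (s * k * M ^+ 2) * theta c 0 : R^o).
Proof.
move=> vx Wx; rewrite -[X in _ --> X]subr0; apply: (@cvgB _ R^o) => //.
apply: (@cvgMl_tmp R nat).
have zx : (fun n => v (x n) / M ^+ 2 : R^o) @ \oo --> (0 : R^o).
  by rewrite -(mul0r (M ^+ 2)^-1); apply: (@cvgMr_tmp R nat).
have thc : {for (0 : R^o), continuous (theta c : R^o -> R^o)}.
  by apply: derive_continuous (is_derive_theta c0 _); rewrite oppr_lt0.
exact: (cvg_comp _ _ zx thc).
Qed.

(** [G 1] is used up to the maximum point and [G (-1)] after it. As v/M^2 goes from 0 to 1 and back
    to 0, each side contributes the same increment of theta, and the boundary values of [W]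
    cancel. *)
Lemma nagy_inequality :
  (\int[leb]_(r in pos) (N r)%:E + (s * k * M ^+ 2 * (2 * (theta c 1 - theta c 0)))%:E <=
   \int[leb]_(r in pos) (F r)%:E)%E.
Proof.
have iD : leb.-integrable pos (EFin \o (fun r => F r - N r)).
  have -> : EFin \o (fun r => F r - N r) = ((EFin \o F) \- (EFin \o N))%E by [].
  exact: integrableB.
have := FTC_ge iD r00 (@DG 1) (@DG (-1)) (@cG 1) (@cG (-1)) _ _ (@cvg_theta _ 1 v_at0 W_at0) (@cvg_theta _ (-1) v_aty W_aty).
rewrite {1 2}/G vr0 divff ?gt_eqF// => H.
have {}H := H (fun r rp => @dG_le 1 r (proj1 (andP rp)) (normr1 _)) _.
have {}H := H (fun r rp => @dG_le (-1) r (lt_le_trans r00 rp) (normrN1 _)).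
have E : (\int[leb]_(r in pos) (F r - N r)%:E =
   \int[leb]_(r in pos) (F r)%:E - \int[leb]_(r in pos) (N r)%:E)%E.
  have -> : (\int[leb]_(r in pos) (F r - N r)%:E =
    \int[leb]_(r in pos) ((EFin \o F) r - (EFin \o N) r))%E by [].
  by rewrite integralB.
rewrite E in H; move: H.
have : (\int[leb]_(r in pos) (F r)%:E)%E \is a fin_num by exact: integrable_fin_num.
have : (\int[leb]_(r in pos) (N r)%:E)%E \is a fin_num by exact: integrable_fin_num.
case: (\int[leb]_(r in pos) (N r)%:E)%E => // x _.
case: (\int[leb]_(r in pos) (F r)%:E)%E => // z _.
rewrite -EFinB -EFinD !lee_fin; lra.
Qed.

End Nagy.

(** * Spherical integrals *)

Section SphericalIntegrals.
Context {R : realType} {n : nat} {G : groupSpaceType}.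
Context {A : set (chart 'rV[R]_n G)} {E : 'rV[R]_n -> (G -> R) -> G -> R}.
Context {A0 : 'M[R]_n} {dil : R -> G -> G} {q : G -> R}.
Context {mu sigma : {measure set (borel G) -> \bar R}}.
Local Notation Q := (\tr A0).
Hypothesis HG : homogeneous_group A E A0.
Hypothesis HD : induced_dilations A E A0 dil.
Hypothesis HQ : homogeneous_quasi_norm dil q.
Hypothesis HM : haar_measure mu.
Hypothesis HS : sphere_measure dil q Q mu sigma.
Hypothesis Q1 : 1 <= Q.
Let HL := hg_lie HG.
Let HA := lie_atlas HL.
Let S := quasi_sphere q.
Local Notation leb := (@lebesgue_measure R).
Local Notation pos := (`]0%R, +oo[%classic : set R).
Let cq : forall rho : R, compact [set x | q x <= rho].
Proof. by move=> rho; exact: (@compact_qball R n G A E A0 dil HG HD q HQ rho). Qed.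
Arguments cq : clear implicits.
Let ar : R := sphere_area q sigma.
Let mS : measurable (S : set (borel G)) := sphere_measurable HQ.
Let sS : sigma S = ar%:E := sigma_sphereE HQ HM HS cq Q1.
Let ar0 : 0 < ar := area_gt0 HQ HM HS cq Q1.

(** Measuring the support by the quasi-norm makes the class stable under products and the Euler
    operator with the same [rho], and makes radial integrands vanish beyond [rho]. *)
Definition tame (rho : R) (w : G -> R) :=
  smooth_fun A w /\ forall x, w x != 0 -> q x <= rho.

Lemma tameD rho u w : tame rho u -> tame rho w -> tame rho (fun x => u x + w x).
Proof.
move=> [su hu] [sw hw]; split; first exact: smoothD.
move=> x; have [u0|/hu//] := eqVneq (u x) 0; have [w0|/hw//] := eqVneq (w x) 0.
by rewrite u0 w0 addr0 eqxx.
Qed.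

Lemma tameM rho u w : tame rho u -> tame rho w -> tame rho (fun x => u x * w x).
Proof.
move=> [su hu] [sw hw]; split; first exact: smoothM.
by move=> x; rewrite mulf_eq0 negb_or => /andP[/hu].
Qed.

Lemma tameZ rho (a : R) w : tame rho w -> tame rho (fun x => a * w x).
Proof.
move=> [sw hw]; split; first exact: smoothZ.
by move=> x; rewrite mulf_eq0 negb_or => /andP[_ /hw].
Qed.

Lemma tame_bounded rho w : tame rho w -> exists2 C, 0 <= C & forall x, `|w x| <= C.
Proof.
move=> [sw hw].
have [C C0 wC] := @compact_bounded_fun R G w _ (smooth_fun_continuous sw) (cq rho) hw.
by exists C.
Qed.

Lemma tame_measurable rho w : tame rho w -> measurable_fun setT (w : borel G -> R).
Proof. by move=> [sw _]; exact: continuous_borel (smooth_fun_continuous sw). Qed.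

Lemma tame_integrable rho w : tame rho w -> mu.-integrable setT (EFin \o (w : borel G -> R)).
Proof.
move=> tw; have [C C0 wC] := tame_bounded tw.
exact: (integrable_supp HQ HM cq (tame_measurable tw) wC tw.2).
Qed.

Lemma tame_dil rho w (r : R) : 0 < r -> tame rho w -> tame (rho / r) (fun x => w (dil r x)).
Proof.
move=> r0 [sw hw]; split; first exact: (smooth_dil HL HD).
by move=> x /hw; rewrite (qnorm_dil HQ)// ler_pdivlMr// mulrC.
Qed.

(** If q x > rho, the dilates of x stay beyond [rho] for small times, so the function is zero along
    the orbit near time 0. *)
Lemma tame_euler rho w : tame rho w -> tame rho (eulerR (dil := dil) w).
Proof.
move=> [sw hw]; split; first exact: (smooth_eulerR HL HD).
move=> x; apply: contraNT; rewrite -ltNge => qx; apply/eqP.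
have [_] := is_derive_eulerR HL HD x 0 sw; rewrite expR0 (dil1 HD) => <-.
rewrite (@near_eq_derive _ _ _ _ (cst (0 : R^o))); first exact: derive_cst.
have q0 : 0 <= q x := qnorm_ge0 HQ x.
have : {for (0 : R^o), continuous (fun t : R^o => expR t * q x : R^o)}.
  by apply: (@cvgMr_tmp R R^o); exact: continuous_expR.
rewrite /prop_for /continuous_at expR0 mul1r => /cvgr_gt/(_ _ qx); apply: filterS => t ht.
by apply/eqP/negPn/negP => /hw; rewrite (qnorm_dil HQ) ?expR_gt0// leNgt ht.
Qed.

Lemma eulerR_dil rho w (y : G) (r : R) : 0 < r -> tame rho w ->
  is_derive (r : R^o) (1 : R^o) (fun r : R^o => w (dil r y) : R^o) (eulerR (dil := dil) w (dil r y) / r).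
Proof.
move=> r0 [sw _].
have d1 := is_derive_eulerR HL HD y (ln r) sw.
have dl : is_derive (r : R^o) (1 : R^o) (@ln R : R^o -> R^o) r^-1 by exact: is_derive1_ln.
have := @is_derive1_comp R (fun t : R^o => w (dil (expR t) y) : R^o) (@ln R) r _ _ d1 dl.
rewrite lnK ?posrE//; apply: near_eq_is_derive.
near=> s; rewrite /= lnK// posrE; near: s; exact: lt_nbhsr.
Unshelve. all: by end_near. Qed.

Definition sint (w : G -> R) (r : R) : R := \int[sigma]_(y in S) w (dil r y).

Lemma sphere_cst_integrable (k : R) :
  sigma.-integrable (S : set (borel G)) (EFin \o (fun=> k : R)).
Proof.
apply: (measurable_bounded_integrable mS).
- exact: (sigma_sphere_fin HQ HM HS cq Q1).
- exact: measurable_cst.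
- exists `|k|; split; first exact: num_real.
  by move=> z Cz y _ /=; exact: ltW.
Qed.

Lemma sphere_integrable rho w (r : R) : 0 < r -> tame rho w ->
  sigma.-integrable (S : set (borel G)) (EFin \o (fun y : borel G => w (dil r y))).
Proof.
move=> r0 tw; have [C C0 wC] := tame_bounded tw.
apply: (measurable_bounded_integrable mS).
- exact: (sigma_sphere_fin HQ HM HS cq Q1).
- exact: measurable_funTS (tame_measurable (tame_dil r0 tw)).
- exists C; split; first exact: num_real.
  by move=> z Cz y _ /=; exact: le_trans (wC _) (ltW Cz).
Qed.

Lemma sint_bound rho w C : tame rho w -> (forall x, `|w x| <= C) ->
  forall r, 0 < r -> `|sint w r| <= C * ar.
Proof.
move=> tw wC r r0; have iw := sphere_integrable r0 tw.
apply: le_trans (le_normr_Rintegral mS iw) _.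
have := @le_Rintegral _ _ _ sigma S (fun y => `|w (dil r y)|) (fun=> C) mS.
rewrite Rintegral_cst// sS /=; apply.
- by have := integrable_norm iw.
- exact: sphere_cst_integrable.
- by move=> y _; exact: wC.
Qed.

Lemma sint_supp rho w r : tame rho w -> rho < r -> 0 < r -> sint w r = 0.
Proof.
move=> [_ hw] rr r0; rewrite /sint /Rintegral integral0_eq// => y Sy.
have [->//|/hw] := eqVneq (w (dil r y)) 0.
by rewrite (qnorm_dil HQ)// Sy mulr1 leNgt rr.
Qed.

Lemma sintD rho u w r : 0 < r -> tame rho u -> tame rho w ->
  sint (fun x => u x + w x) r = sint u r + sint w r.
Proof. by move=> r0 tu tw; apply: RintegralD; [exact: mS|exact: sphere_integrable tu|exact: sphere_integrable tw]. Qed.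

Lemma sintZ rho a w r : 0 < r -> tame rho w -> sint (fun x => a * w x) r = a * sint w r.
Proof. by move=> r0 tw; apply: RintegralZl; [exact: mS|exact: sphere_integrable tw]. Qed.

(** Differentiation under the integral sign: the Euler derivative is bounded, and 1/x <= 2/r on the
    window (r/2, 2r), so a constant dominates, integrable because the sphere has finite measure. *)
Lemma is_derive_sint rho w (r : R) : 0 < r -> tame rho w ->
  is_derive (r : R^o) (1 : R^o) (sint w : R^o -> R^o) (sint (eulerR (dil := dil) w) r / r).
Proof.
move=> r0 tw; have tE := tame_euler tw; have [C C0 EC] := tame_bounded tE.
pose f (r : R) (y : borel G) : R := w (dil r y).
have rI : `]r / 2, r * 2[%classic r.
  by rewrite /= in_itv /= ltr_pdivrMr// ltr_pMr// ltr1n.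
have Ipos x : `]r / 2, r * 2[%classic x -> 0 < x.
  by rewrite /= in_itv /= => /andP[h _]; apply: lt_trans h; rewrite divr_gt0.
have d1 x y : 0 < x -> partial1of2 f x y = eulerR (dil := dil) w (dil x y) / x.
  by move=> x0; rewrite partial1of2E; case: (eulerR_dil y x0 tw).
have h1 x : `]r / 2, r * 2[%classic x -> sigma.-integrable (S : set (borel G)) (EFin \o f x).
  by move=> /Ipos x0; exact: sphere_integrable tw.
have h2 x y : `]r / 2, r * 2[%classic x -> S y -> derivable (f ^~ y : R^o -> R^o) x 1.
  by move=> /Ipos x0 _; case: (eulerR_dil y x0 tw).
have h3 : sigma.-integrable (S : set (borel G)) (EFin \o (fun=> C / (r / 2))).
  exact: sphere_cst_integrable.
have h4 x y : `]r / 2, r * 2[%classic x -> S y -> `|partial1of2 f x y| <= C / (r / 2).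
  move=> xI _; have x0 := Ipos x xI; rewrite d1// normrM.
  apply: ler_pM; [by []|by []|exact: EC|].
  rewrite gtr0_norm ?invr_gt0// lef_pV2 ?posrE ?divr_gt0//.
  by move: xI; rewrite /= in_itv /= => /andP[/ltW].
have h0 (y : borel G) : 0 <= C / (r / 2) by rewrite !divr_ge0// ltW.
have := derivable_under_integral mS rI h1 h2 h0 h3 h4.
have := differentiation_under_integral mS rI h1 h2 h0 h3 h4.
rewrite derive1E => dE dd; split; first exact: dd.
rewrite dE /sint mulrC -RintegralZl; [|exact: mS|exact: sphere_integrable tE].
by apply: eq_Rintegral => y _; rewrite d1// mulrC.
Qed.

Lemma sint_cont rho w (r : R) : 0 < r -> tame rho w ->
  {for r, continuous (sint w : R^o -> R^o)}.
Proof. by move=> r0 tw; exact: derive_continuous (is_derive_sint r0 tw). Qed.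

(** The variance of [w] on the sphere of radius [r] is nonnegative. *)
Lemma jensen rho w (r : R) : 0 < r -> tame rho w ->
  ar * (ar^-1 * sint w r) ^+ 2 <= sint (fun x => w x * w x) r.
Proof.
move=> r0 tw; have tw2 := tameM tw tw; set m := ar^-1 * sint w r.
have : 0 <= \int[sigma]_(y in S) ((w (dil r y) - m) ^+ 2).
  by apply: Rintegral_ge0 => y _; rewrite sqr_ge0.
have ic : sigma.-integrable (S : set (borel G)) (EFin \o (fun=> m ^+ 2)).
  exact: sphere_cst_integrable.
have i1 := sphere_integrable r0 tw2.
have i2 := sphere_integrable r0 (tameZ (- (2 * m)) tw).
have -> : \int[sigma]_(y in S) ((w (dil r y) - m) ^+ 2) =
    \int[sigma]_(y in S) (w (dil r y) * w (dil r y) + (- (2 * m)) * w (dil r y) + m ^+ 2).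
  by apply: eq_Rintegral => y _; ring.
have i3 : sigma.-integrable (S : set (borel G))
    (EFin \o (fun y : borel G => w (dil r y) * w (dil r y) + (- (2 * m)) * w (dil r y))).
  exact: sphere_integrable r0 (tameD tw2 (tameZ (- (2 * m)) tw)).
rewrite (RintegralD mS i3 ic) (RintegralD mS i1 i2) Rintegral_cst; last exact: mS.
rewrite -/(sint (fun x => w x * w x) r) -/(sint (fun x => - (2 * m) * w x) r) (sintZ _ r0 tw).
rewrite sS /=; have -> : sint w r = ar * m by rewrite /m mulrA mulfV ?mul1r// gt_eqF.
by move=> h; lra.
Qed.

Lemma pos_integrable_bounded (f : R -> R) (rho C : R) : measurable_fun pos f ->
  (forall r, 0 < r -> `|f r| <= C) -> (forall r, 0 < r -> rho < r -> f r = 0) ->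
  leb.-integrable pos (EFin \o f).
Proof.
move=> mf fC f0.
have [rho0|rho0] := leP rho 0.
  apply: (@eq_integrable _ _ _ _ _ _ (cst 0%E)) => //; last exact: integrable0.
  by move=> r; rewrite inE /= in_itv /= andbT => r0; rewrite f0// (le_lt_trans rho0).
have mI : measurable (`]0%R, rho] : set R) by exact: measurable_itv.
have sub : (`]0%R, rho]%classic : set R) `<=` pos.
  by move=> r /=; rewrite !in_itv /= andbT => /andP[].
have ib : leb.-integrable (`]0%R, rho]%classic : set R) (EFin \o f).
  apply: measurable_bounded_integrable => //.
  - by rewrite -[X in (X < _)%E]/(lebesgue_measure `]0%R, rho]%classic) lebesgue_measure_itv /= lte_fin rho0 -EFinB ltry.
  - exact: measurable_funS mf.
  - exists C; split; first exact: num_real.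
    move=> z Cz y /=; rewrite in_itv /= => /andP[y0 _].
    exact: le_trans (fC _ y0) (ltW Cz).
have mP : measurable (pos : set R) by exact: measurable_itv.
apply: (@integrable_mkcond _ _ R leb pos (EFin \o f) mP).2.
rewrite (_ : _ \_ _ = (EFin \o f) \_ `]0%R, rho]); first exact: (@integrable_mkcond _ _ R leb _ (EFin \o f) mI).1.
apply/funext => r; rewrite !patchE.
have [r0|r0] := boolP (r \in pos); have [r1|r1] := boolP (r \in (`]0%R, rho]%classic : set R)) => //.
  move: r0 r1; rewrite inE notin_setE /= !in_itv /= andbT => r0 /negP.
  by rewrite r0 /= -ltNge => r1; rewrite f0.
by move: r0 r1; rewrite inE notin_setE => r0 /sub.
Qed.

Lemma sint_measurable rho w : tame rho w -> measurable_fun pos (sint w).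
Proof. by move=> tw; apply: pos_measurable => r r0; exact: sint_cont tw. Qed.

Lemma powRQ_bound (rho r : R) : 0 < r -> r <= rho -> `|r `^ (Q - 1)| <= rho `^ (Q - 1).
Proof.
move=> r0 rr; rewrite ger0_norm ?powR_ge0// ge0_ler_powR ?nnegrE ?subr_ge0//; first exact: ltW.
by rewrite ltW// (lt_le_trans r0).
Qed.

Lemma sint_integrable rho w : tame rho w ->
  leb.-integrable pos (EFin \o (fun r => sint w r * r `^ (Q - 1))).
Proof.
move=> tw; have [C C0 wC] := tame_bounded tw.
apply: (@pos_integrable_bounded _ rho (C * ar * rho `^ (Q - 1))).
- apply: measurable_funM; first exact: sint_measurable tw.
  exact: measurable_funTS (measurable_powR _).
- move=> r r0; have [rr|rr] := leP r rho; last first.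
    rewrite (sint_supp tw)// mul0r normr0 mulr_ge0 ?powR_ge0//.
    by rewrite mulr_ge0// ltW.
  rewrite normrM; apply: ler_pM => //; first exact: (sint_bound tw).
  exact: powRQ_bound.
- by move=> r r0 rr; rewrite (sint_supp tw)// mul0r.
Qed.

Lemma polar_tame rho w : tame rho w ->
  (\int[mu]_x (w x)%:E = \int[leb]_(r in pos) (sint w r * r `^ (Q - 1))%:E)%E.
Proof.
move=> tw; rewrite (HS (tame_integrable tw)); apply: eq_integral => r.
rewrite inE /= in_itv /= andbT => r0; have iw := sphere_integrable r0 tw.
rewrite /sint -(RintegralZr _ mS iw).
rewrite /Rintegral fineK//; apply: (@integrable_fin_num _ _ _ sigma S mS).
have := integrableZr mS (r `^ (Q - 1)) iw.
by apply: eq_integrable.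
Qed.

End SphericalIntegrals.

Lemma powR_pred {R : realType} (b r : R) : 0 < r -> r `^ b = r `^ (b - 1) * r.
Proof.
move=> r0; rewrite -[X in _ * X](powRr1 (ltW r0)) -powRD ?subrK//.
by rewrite (gt_eqF r0) implybT.
Qed.

(** * Functions of linear size near 0 and of bounded support *)

Section VanishingAtEnds.
Context {R : realType}.
Local Notation pos := (`]0%R, +oo[%classic : set R).
Variables (g : R -> R) (C rho : R).
Hypothesis gC : forall r, 0 < r -> `|g r| <= C * r.
Hypothesis g0 : forall r, 0 < r -> rho < r -> g r = 0.

Lemma vanish_at0 : (fun n => g n.+1%:R^-1 : R^o) @ \oo --> (0 : R^o).
Proof. by apply: (@cvg0_harmonic R _ C) => n; apply: gC; rewrite invr_gt0. Qed.

Lemma vanish_aty : (fun n => g n.+1%:R : R^o) @ \oo --> (0 : R^o).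
Proof.
have C0 : 0 <= C by have := gC ltr01; rewrite mulr1; apply: le_trans.
apply: (@cvg0_harmonic R _ (C * rho ^+ 2)) => n.
have [nr|nr] := ltP rho n.+1%:R.
  by rewrite g0// normr0 divr_ge0// mulr_ge0// sqr_ge0.
apply: le_trans (gC _) _; first by [].
rewrite -mulrA ler_wpM2l// ler_pdivlMr// -expr2.
by rewrite lerXn2r ?nnegrE//; exact: le_trans nr.
Qed.

(** Below [e] the linear bound already gives g <= g r1, and beyond [rho] the function is zero, so
    the supremum is that over a compact interval. *)
Lemma max_attained r1 : (forall r, 0 < r -> {for r, continuous (g : R^o -> R^o)}) ->
  0 < r1 -> 0 < g r1 -> exists2 r0, 0 < r0 & forall r, 0 < r -> g r <= g r0.
Proof.
move=> gc r10 gr1.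
have C0 : 0 <= C by have := gC ltr01; rewrite mulr1; apply: le_trans.
pose e := g r1 / (C + 1).
have C1 : 0 < C + 1 by rewrite ltr_wpDl.
have e0 : 0 < e by rewrite divr_gt0.
have small r : 0 < r -> r <= e -> g r <= g r1.
  move=> r0 re; apply: le_trans (ler_norm _) _; apply: le_trans (gC r0) _.
  have : (C + 1) * r <= g r1 by rewrite mulrC -ler_pdivlMr.
  by rewrite mulrDl mul1r; apply: le_trans; rewrite lerDl ltW.
have er1 : Num.min e r1 <= Num.max rho r1 by rewrite ge_min !le_max lexx !orbT.
have m0 : 0 < Num.min e r1 by rewrite lt_min e0.
have [|r0 r0I hr0] := @EVT_max R g _ _ er1.
  by apply: pos_continuous_within => //.
have r0p : 0 < r0 by move: r0I; rewrite in_itv /= => /andP[h _]; apply: lt_le_trans h.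
have r1le : g r1 <= g r0.
  by apply: hr0; rewrite in_itv /= ge_min le_max !lexx !orbT.
exists r0 => // r rp.
have [re|re] := leP r e; first exact: le_trans (small _ rp re) r1le.
have [rr|rr] := ltP rho r; first by rewrite g0// ltW// (lt_le_trans gr1).
by apply: hr0; rewrite in_itv /= ge_min le_max (ltW re) rr.
Qed.

End VanishingAtEnds.

(** * From functions on the group to profiles on the half-line *)

Section RadialReduction.
Context {R : realType} {n : nat} {G : groupSpaceType}.
Context {A : set (chart 'rV[R]_n G)} {E : 'rV[R]_n -> (G -> R) -> G -> R}.
Context {A0 : 'M[R]_n} {dil : R -> G -> G} {q : G -> R}.
Context {mu sigma : {measure set (borel G) -> \bar R}}.
Local Notation Q := (\tr A0).
Hypothesis HG : homogeneous_group A E A0.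
Hypothesis HD : induced_dilations A E A0 dil.
Hypothesis HQ : homogeneous_quasi_norm dil q.
Hypothesis HM : haar_measure mu.
Hypothesis HS : sphere_measure dil q Q mu sigma.
Hypothesis Q3 : 3 <= Q.
Let HL := hg_lie HG.
Let HA := lie_atlas HL.
Let S := quasi_sphere q.
Local Notation leb := (@lebesgue_measure R).
Local Notation pos := (`]0%R, +oo[%classic : set R).
Let Q1 : 1 <= Q. Proof. by apply: le_trans Q3; rewrite ler1n. Qed.
Let cq : forall rho : R, compact [set x | q x <= rho].
Proof. by move=> rho; exact: (@compact_qball R n G A E A0 dil HG HD q HQ rho). Qed.
Arguments cq : clear implicits.
Let ar : R := sphere_area q sigma.
Let ar0 : 0 < ar := area_gt0 HQ HM HS cq Q1.
Local Notation eu := (eulerR (dil := dil)).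
Local Notation tame := (tame (A := A) (q := q)).
Local Notation sint := (sint (dil := dil) (q := q) (sigma := sigma)).

Lemma eulerRM u w x : smooth_fun A u -> smooth_fun A w ->
  eu (fun x => u x * w x) x = eu u x * w x + u x * eu w x.
Proof.
move=> su sw.
have [_ d1] := is_derive_eulerR HL HD x 0 (smoothM HA su sw).
have := is_deriveM (is_derive_eulerR HL HD x 0 su) (is_derive_eulerR HL HD x 0 sw).
move=> [_ d2]; move: d1 d2; rewrite !expR0 !(dil1 HD) => <-.
have -> : (fun t : R^o => u (dil (expR t) x) : R^o) * (fun t : R^o => w (dil (expR t) x) : R^o) =
  (fun t : R^o => u (dil (expR t) x) * w (dil (expR t) x) : R^o) by [].
by move=> ->; rewrite -![_ *: _]/(_ * _) addrC; congr (_ + _); rewrite mulrC.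
Qed.

Definition mean (w : G -> R) (r : R) := ar^-1 * sint w r.

Lemma mean_bound rho w : tame rho w -> exists2 C, 0 <= C & forall r, 0 < r -> `|mean w r| <= C.
Proof.
move=> tw; have [C C0 wC] := tame_bounded HG HD HQ tw.
exists C => // r r0; rewrite /mean normrM gtr0_norm ?invr_gt0// mulrC ler_pdivrMr//.
exact: (sint_bound HG HD HQ HM HS Q1 tw wC).
Qed.

Lemma mean_supp rho w r : tame rho w -> rho < r -> 0 < r -> mean w r = 0.
Proof. by move=> tw rr r0; rewrite /mean (sint_supp HQ tw rr r0) mulr0. Qed.

Lemma is_derive_mean rho w (r : R) : 0 < r -> tame rho w ->
  is_derive (r : R^o) (1 : R^o) (mean w : R^o -> R^o) (mean (eu w) r / r).
Proof.
move=> r0 tw; apply: is_derive_eq (is_deriveZ ar^-1 (is_derive_sint HG HD HQ HM HS Q1 r0 tw)) _.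
by rewrite /mean -![_ *: _]/(_ * _) mulrA.
Qed.

Definition prof (w : G -> R) (r : R) := r `^ (Q / 2) * mean w r.
Definition dprof (w : G -> R) (r : R) := r `^ (Q / 2 - 1) * (Q / 2 * mean w r + mean (eu w) r).

Lemma is_derive_prof rho w (r : R) : 0 < r -> tame rho w ->
  is_derive (r : R^o) (1 : R^o) (prof w : R^o -> R^o) (dprof w r).
Proof.
move=> r0 tw.
apply: is_derive_eq (is_deriveM (is_derive_powR (Q / 2) r0) (is_derive_mean r0 tw)) _.
rewrite -![_ *: _]/(_ * _) /dprof.
rewrite (powR_pred (Q / 2) r0).
by field; rewrite gt_eqF.
Qed.

Lemma mean_cont rho w (r : R) : 0 < r -> tame rho w ->
  {for r, continuous (mean w : R^o -> R^o)}.
Proof. by move=> r0 tw; exact: derive_continuous (is_derive_mean r0 tw). Qed.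

Lemma dprof_cont rho w (r : R) : 0 < r -> tame rho w ->
  {for r, continuous (dprof w : R^o -> R^o)}.
Proof.
move=> r0 tw; apply: (@cvgM R R^o); first exact: powR_cont.
apply: (@cvgD _ R^o); last exact: mean_cont r0 (tame_euler HG HD HQ tw).
by apply: (@cvgMl_tmp R R^o); exact: mean_cont r0 tw.
Qed.

Variables (rho : R) (u w : G -> R) (delta : R).
Hypotheses (tu : tame rho u) (tw : tame rho w) (dQ : delta < Q ^+ 2 / 4).
Let a := (Q - 2) / 2.
Let c := a^-1.
Let k := Num.sqrt (Q ^+ 2 / 4 - delta).
Let ff x := u x * u x + w x * w x.
Let ee x := eu u x * eu u x + eu w x * eu w x.
Let F r := (sint ee r - delta * sint ff r) * r `^ (Q - 1).
(** The boundary term (Q/2)|h|^2 before averaging, that is with |f|^2 integrated over the sphere. *)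
Let W r := Q / 2 * (r `^ Q * sint ff r).
Let dW r := Q / 2 * (r `^ (Q - 1) * (Q * sint ff r + sint (eu ff) r)).
Let v r := prof u r ^+ 2 + prof w r ^+ 2.
Let teu : tame rho (eu u) := tame_euler HG HD HQ tu.
Let tew : tame rho (eu w) := tame_euler HG HD HQ tw.
Let tff : tame rho ff := tameD HG (tameM HG tu tu) (tameM HG tw tw).
Let tee : tame rho ee := tameD HG (tameM HG teu teu) (tameM HG tew tew).
Let teff : tame rho (eu ff) := tame_euler HG HD HQ tff.
Let Q0 : 0 < Q. Proof. exact: lt_le_trans Q3. Qed.
Let a0 : 0 < a. Proof. by rewrite divr_gt0// subr_gt0 (lt_le_trans _ Q3)// ltr_nat. Qed.
Let c0 : 0 < c. Proof. by rewrite invr_gt0. Qed.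
Let k0 : 0 < k. Proof. by rewrite sqrtr_gt0 subr_gt0. Qed.
Let k2 : k ^+ 2 = Q ^+ 2 / 4 - delta. Proof. by rewrite sqr_sqrtr// ltW// subr_gt0. Qed.

Let powQ (r : R) : 0 < r -> r `^ Q = r * r `^ (Q - 1).
Proof. by move=> r0; rewrite (powR_pred Q r0) mulrC. Qed.

Let powQ2 (r : R) : 0 < r -> (r `^ (Q / 2)) ^+ 2 = r * r `^ (Q - 1).
Proof.
move=> r0; rewrite -powQ// expr2 -powRD ?(gt_eqF r0) ?implybT//.
by congr (_ `^ _); field.
Qed.

Lemma energy_integrable : leb.-integrable pos (EFin \o F).
Proof.
have tz := tameD HG tee (tameZ HG (- delta) tff).
have := sint_integrable HG HD HQ HM HS Q1 tz.
apply: eq_integrable; first exact: measurable_itv.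
move=> r; rewrite inE /= in_itv /= andbT => r0; congr EFin.
rewrite /F (sintD HG HD HQ HM HS Q1 r0 tee (tameZ HG (- delta) tff)).
by rewrite (sintZ HG HD HQ HM HS Q1 _ r0 tff) mulNr.
Qed.

Let DW r : 0 < r -> is_derive (r : R^o) (1 : R^o) (W : R^o -> R^o) (dW r).
Proof.
move=> r0.
have := is_deriveM (is_derive_powR Q r0) (is_derive_sint HG HD HQ HM HS Q1 r0 tff).
move=> /(is_deriveZ (Q / 2)) h; apply: is_derive_eq h _.
rewrite -![_ *: _]/(_ * _) /dW powQ//.
by field; rewrite gt_eqF.
Qed.

Let cdW r : 0 < r -> {for r, continuous (dW : R^o -> R^o)}.
Proof.
move=> r0; apply: (@cvgMl_tmp R R^o); apply: (@cvgM R R^o); first exact: powR_cont.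
apply: (@cvgD _ R^o); last exact: (sint_cont HG HD HQ HM HS Q1 r0 teff).
by apply: (@cvgMl_tmp R R^o); exact: (sint_cont HG HD HQ HM HS Q1 r0 tff).
Qed.

Let vE r : 0 < r -> v r = r * r `^ (Q - 1) * (mean u r ^+ 2 + mean w r ^+ 2).
Proof. by move=> r0; rewrite /v /prof !exprMn powQ2// mulrDr. Qed.

Let v_supp r : 0 < r -> rho < r -> v r = 0.
Proof.
move=> r0 rr; rewrite /v /prof (mean_supp tu)// (mean_supp tw)//.
by rewrite mulr0 expr2 mul0r addr0.
Qed.

Let v_bound : exists C, forall r, 0 < r -> `|v r| <= C * r.
Proof.
have [C1 C10 uC] := mean_bound tu; have [C2 C20 wC] := mean_bound tw.
exists (rho `^ (Q - 1) * (C1 ^+ 2 + C2 ^+ 2)) => r r0.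
have [rr|rr] := ltP rho r.
  rewrite v_supp// normr0 !mulr_ge0 ?powR_ge0//; last exact: ltW.
  by rewrite addr_ge0 ?sqr_ge0.
rewrite vE// !normrM (gtr0_norm r0) -mulrA [leLHS]mulrC ler_wpM2r ?(ltW r0)//.
apply: ler_pM => //; first exact: powRQ_bound.
rewrite ger0_norm ?addr_ge0 ?sqr_ge0//; apply: lerD.
  by rewrite -real_normK ?num_real// lerXn2r ?nnegrE ?uC.
by rewrite -real_normK ?num_real// lerXn2r ?nnegrE ?wC.
Qed.

Let v_cont r : 0 < r -> {for r, continuous (v : R^o -> R^o)}.
Proof.
move=> r0; apply: (@cvgD _ R^o).
  by apply: (@cvgM R R^o); exact: derive_continuous (is_derive_prof r0 tu).
by apply: (@cvgM R R^o); exact: derive_continuous (is_derive_prof r0 tw).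
Qed.

Let W_supp r : 0 < r -> rho < r -> W r = 0.
Proof. by move=> r0 rr; rewrite /W (sint_supp HQ tff rr r0) !mulr0. Qed.

Let W_bound : exists C, forall r, 0 < r -> `|W r| <= C * r.
Proof.
have [C C0 wC] := tame_bounded HG HD HQ tff.
exists (Q / 2 * (rho `^ (Q - 1) * (C * ar))) => r r0.
have Q20 : 0 <= Q / 2 by rewrite divr_ge0 ?ltW.
have [rr|rr] := ltP rho r.
  by rewrite W_supp// normr0 !mulr_ge0 ?powR_ge0// ltW.
rewrite /W normrM (ger0_norm Q20) -[leRHS]mulrA ler_wpM2l//.
rewrite powQ// !normrM (gtr0_norm r0) -mulrA [leLHS]mulrC ler_wpM2r ?(ltW r0)//.
apply: ler_pM => //; first exact: powRQ_bound.
exact: (sint_bound HG HD HQ HM HS Q1 tff wC).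
Qed.

(** For each component Jensen is applied twice: to E u + (Q/2) u, whose mean is the derivative of
    the profile up to a power of r, and to u. Expanding the first square, the cross term is (Q/2)
    E(u^2), which together with half of the term (Q^2/2) u^2 of [dW] accounts for everything beyond
    [F]; the other half combines with -delta to k^2. *)
Let leF r : 0 < r ->
  ar * (r * (dprof u r ^+ 2 + dprof w r ^+ 2) + k ^+ 2 * v r / r) <= F r + dW r.
Proof.
move=> r0.
pose zu x := eu u x + Q / 2 * u x; pose zw x := eu w x + Q / 2 * w x.
have tzu : tame rho zu := tameD HG teu (tameZ HG _ tu).
have tzw : tame rho zw := tameD HG tew (tameZ HG _ tw).
have mz x : tame rho x -> mean (fun y => eu x y + Q / 2 * x y) r = mean (eu x) r + Q / 2 * mean x r.
  move=> tx; have tex := tame_euler HG HD HQ tx.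
  rewrite /mean (sintD HG HD HQ HM HS Q1 r0 tex (tameZ HG _ tx)).
  by rewrite (sintZ HG HD HQ HM HS Q1 _ r0 tx) mulrDr mulrCA.
have ju := jensen HG HD HQ HM HS Q1 r0 tzu.
have jw := jensen HG HD HQ HM HS Q1 r0 tzw.
have j1 := jensen HG HD HQ HM HS Q1 r0 tu.
have j2 := jensen HG HD HQ HM HS Q1 r0 tw.
rewrite -/ar -/(mean zu r) (mz u tu) in ju.
rewrite -/ar -/(mean zw r) (mz w tw) in jw.
rewrite -/ar -/(mean u r) in j1; rewrite -/ar -/(mean w r) in j2.
pose sq x := sint (fun y => x y * x y) r.
have sqz x : tame rho x -> sq (fun y => eu x y + Q / 2 * x y) =
    sq (eu x) + Q / 2 * sint (eu (fun y => x y * x y)) r + Q ^+ 2 / 4 * sq x.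
  move=> tx; have tex := tame_euler HG HD HQ tx.
  have txx := tameM HG tx tx; have texx := tame_euler HG HD HQ txx.
  have t1 := tameM HG tex tex.
  rewrite /sq -(sintZ HG HD HQ HM HS Q1 (Q / 2) r0 texx) -(sintZ HG HD HQ HM HS Q1 (Q ^+ 2 / 4) r0 txx).
  rewrite -(sintD HG HD HQ HM HS Q1 r0 t1 (tameZ HG _ texx)).
  rewrite -(sintD HG HD HQ HM HS Q1 r0 (tameD HG t1 (tameZ HG _ texx)) (tameZ HG _ txx)).
  by congr sint; apply/funext => y; rewrite (eulerRM _ tx.1 tx.1); field.
rewrite -/(sq _) (sqz u tu) in ju; rewrite -/(sq _) (sqz w tw) in jw.
rewrite -/(sq _) in j1; rewrite -/(sq _) in j2.
have ffE : sint ff r = sq u + sq w.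
  by rewrite /ff (sintD HG HD HQ HM HS Q1 r0 (tameM HG tu tu) (tameM HG tw tw)).
have eeE : sint ee r = sq (eu u) + sq (eu w).
  by rewrite /ee (sintD HG HD HQ HM HS Q1 r0 (tameM HG teu teu) (tameM HG tew tew)).
have effE : sint (eu ff) r = sint (eu (fun y => u y * u y)) r + sint (eu (fun y => w y * w y)) r.
  have t1 := tameM HG tu tu; have t2 := tameM HG tw tw.
  rewrite -(sintD HG HD HQ HM HS Q1 r0 (tame_euler HG HD HQ t1) (tame_euler HG HD HQ t2)).
  congr sint; apply/funext => y.
  have [_ d1] := is_derive_eulerR HL HD y 0 tff.1.
  have [_ d2] := is_deriveD (is_derive_eulerR HL HD y 0 t1.1) (is_derive_eulerR HL HD y 0 t2.1).
  by move: d1 d2; rewrite !expR0 !(dil1 HD) => <- <-.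
have pr : (r `^ (Q / 2 - 1)) ^+ 2 * r = r `^ (Q - 1).
  have -> : r `^ (Q / 2 - 1) = r `^ (Q / 2) / r.
    by rewrite (powR_pred (Q / 2) r0); field; rewrite gt_eqF.
  by rewrite expr_div_n powQ2//; field; rewrite gt_eqF.
have P0 : 0 <= r `^ (Q - 1) by exact: powR_ge0.
have -> : ar * (r * (dprof u r ^+ 2 + dprof w r ^+ 2) + k ^+ 2 * v r / r) =
  r `^ (Q - 1) * (ar * (mean (eu u) r + Q / 2 * mean u r) ^+ 2 +
     ar * (mean (eu w) r + Q / 2 * mean w r) ^+ 2 +
     k ^+ 2 * (ar * mean u r ^+ 2 + ar * mean w r ^+ 2)).
  rewrite vE// -pr /dprof.
  move: (mean u r) (mean w r) (mean (eu u) r) (mean (eu w) r) (r `^ (Q / 2 - 1)) (k) Q (ar).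
  by move=> m1 m2 m3 m4 z theta_density tr ar'; field; rewrite gt_eqF.
have -> : F r + dW r = r `^ (Q - 1) * (sq (eu u) + Q / 2 * sint (eu (fun y => u y * u y)) r + Q ^+ 2 / 4 * sq u
   + (sq (eu w) + Q / 2 * sint (eu (fun y => w y * w y)) r + Q ^+ 2 / 4 * sq w) + k ^+ 2 * (sq u + sq w)).
  rewrite k2 /F /dW ffE eeE effE; move: (sq u) (sq w) (sq (eu u)) (sq (eu w)) (r `^ (Q - 1)).
  move: (sint (eu (fun y => u y * u y)) r) (sint (eu (fun y => w y * w y)) r) Q.
  by move=> m1 m2 m3 m4 m5 m6 m7 z; field.
rewrite ler_wpM2l// lerD ?lerD// ler_wpM2l ?sqr_ge0//; exact: lerD.
Qed.

(** Serves functions whose spherical mean vanishes identically, for which Nagy's method has no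
    positive maximum to start from. *)
Lemma energy_ge0 : (0 <= \int[leb]_(r in pos) (F r)%:E)%E.
Proof.
have [C WC] := W_bound.
have DN r : 0 < r -> is_derive (r : R^o) (1 : R^o) (fun r : R^o => - W r : R^o) (- dW r).
  by move=> r0; exact: is_deriveN (DW r0).
have cN r : 0 < r -> {for r, continuous (fun r : R^o => - dW r : R^o)}.
  by move=> r0; apply: (@cvgN _ R^o); exact: cdW.
have NC r : 0 < r -> `|- W r| <= C * r by rewrite normrN; exact: WC.
have NS r : 0 < r -> rho < r -> - W r = 0 by move=> r0 rr; rewrite W_supp// oppr0.
have le r : 0 < r -> - dW r <= F r.
  move=> r0; rewrite -subr_ge0 opprK; apply: le_trans (leF r0).
  have h1 : 0 <= r * (dprof u r ^+ 2 + dprof w r ^+ 2).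
    by rewrite mulr_ge0 ?(ltW r0)// addr_ge0 ?sqr_ge0.
  have h2 : 0 <= k ^+ 2 * v r / r.
    by rewrite divr_ge0 ?(ltW r0)// mulr_ge0 ?sqr_ge0// addr_ge0 ?sqr_ge0.
  by rewrite mulr_ge0 ?(ltW ar0)// addr_ge0.
have := FTC_ge energy_integrable ltr01 DN DN cN cN
  (fun r rp => le r (proj1 (andP rp))) (fun r rp => le r (lt_le_trans ltr01 rp))
  (vanish_at0 NC) (vanish_aty NC NS).
by rewrite subr0 sub0r subrr.
Qed.

Lemma profile_integrable (s : R) : 0 < s ->
  leb.-integrable pos (EFin \o (fun r => v r `^ (1 + s) / r)).
Proof.
move=> s0; have [C vC] := v_bound.
have C0 : 0 <= C by have := vC 1 ltr01; rewrite mulr1; apply: le_trans.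
have v0 r : 0 <= v r by rewrite addr_ge0 ?sqr_ge0.
apply: (@pos_integrable_bounded _ _ rho (C * (C * rho) `^ s)).
- apply: pos_measurable => r r0.
  have cv : {for r, continuous (fun r : R^o => v r `^ (1 + s) : R^o)}.
    have -> : (fun r : R^o => v r `^ (1 + s) : R^o) = (fun y : R => `|y| `^ (1 + s)) \o v.
      by apply/funext => x; rewrite /= ger0_norm.
    apply: (@continuous_comp _ _ _ (v : R^o -> R^o) (fun y : R^o => `|y| `^ (1 + s) : R^o)).
      exact: v_cont.
    by apply: normpowR_cont; rewrite addr_gt0.
  apply: (@cvgM R R^o); first exact: cv.
  by apply: cvgV; [rewrite gt_eqF|exact: cvg_id].
- move=> r r0; have [rr|rr] := ltP rho r.
    by rewrite v_supp// powR0 ?mul0r ?normr0 ?mulr_ge0 ?powR_ge0// gt_eqF// addr_gt0.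
  have vr := vC r r0; rewrite ger0_norm// in vr.
  rewrite ger0_norm ?divr_ge0 ?powR_ge0 ?(ltW r0)// ler_pdivrMr//.
  have s1 : 0 < 1 + s by rewrite addr_gt0.
  rewrite powRD ?(gt_eqF s1)// (powRr1 (v0 r)) mulrAC; apply: ler_pM; rewrite ?powR_ge0//.
  rewrite ge0_ler_powR ?nnegrE ?(ltW s0)//; last first.
    by apply: le_trans vr _; rewrite ler_wpM2l.
  by rewrite mulr_ge0// (le_trans (ltW r0)).
- by move=> r r0 rr; rewrite v_supp// powR0 ?mul0r// gt_eqF// addr_gt0.
Qed.

Lemma nagy_tame r1 : 0 < r1 -> v r1 != 0 -> exists2 M, 0 < M &
  ((ar * k ^+ 2 * (M ^+ 2) `^ (- c))%:E * \int[leb]_(r in pos) (v r `^ (1 + c) / r)%:E +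
   (ar * k * M ^+ 2 * (2 * (theta c 1 - theta c 0)))%:E <= \int[leb]_(r in pos) (F r)%:E)%E.
Proof.
move=> r10 vr1; have v0 r : 0 <= v r by rewrite addr_ge0 ?sqr_ge0.
have [C vC] := v_bound; have [D WD] := W_bound.
have [|r0 r00 vmax] := max_attained vC v_supp v_cont r10.
  by rewrite lt_neqAle eq_sym vr1 v0.
have vr0 : 0 < v r0 by apply: lt_le_trans (vmax _ r10); rewrite lt_neqAle eq_sym vr1 v0.
pose M := Num.sqrt (v r0).
have M0 : 0 < M by rewrite sqrtr_gt0.
have M2 : M ^+ 2 = v r0 by rewrite sqr_sqrtr.
exists M => //.
have NE r : 0 < r -> ar * k ^+ 2 * M ^+ 2 * (v r / M ^+ 2) `^ (1 + c) / r =
   ar * k ^+ 2 * (M ^+ 2) `^ (- c) * (v r `^ (1 + c) / r).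
  move=> rp; rewrite M2 powRM// ?invr_ge0// -[(v r0)^-1]powR_inv1// -powRrM mulN1r opprD.
  rewrite [v r0 `^ _]powRD ?(gt_eqF vr0) ?implybT// powR_inv1//.
  by field; rewrite !gt_eqF.
have iN : leb.-integrable pos (EFin \o (fun r => ar * k ^+ 2 * M ^+ 2 * (v r / M ^+ 2) `^ (1 + c) / r)).
  have mP : measurable (pos : set (measurableTypeR R)) by exact: measurable_itv.
  have := integrableZl mP (ar * k ^+ 2 * (M ^+ 2) `^ (- c)) (profile_integrable c0).
  apply: eq_integrable; first exact: measurable_itv.
  by move=> r; rewrite inE /= in_itv /= andbT => rp; rewrite /= NE// EFinM.
have vM r : 0 < r -> v r <= M ^+ 2 by move=> rp; rewrite M2 vmax.
have := nagy_inequality ar0 k0 M0 c0 r00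
  (fun r r0 => is_derive_prof r0 tu) (fun r r0 => is_derive_prof r0 tw) DW
  (fun r r0 => dprof_cont r0 tu) (fun r r0 => dprof_cont r0 tw) cdW vM (esym M2)
  energy_integrable iN leF (vanish_at0 vC) (vanish_aty vC v_supp) (vanish_at0 WD) (vanish_aty WD W_supp).
apply: le_trans; rewrite leeD2r//.
rewrite -ge0_integralZl_EFin//.
- by rewrite le_eqVlt; apply/orP; left; apply/eqP; apply: eq_integral => r;
    rewrite inE /= in_itv /= andbT => rp; rewrite NE// EFinM.
- by move=> r; rewrite /= in_itv /= andbT => rp; rewrite lee_fin divr_ge0 ?powR_ge0// ltW.
- exact: (measurable_int leb (profile_integrable c0)).
- by rewrite !mulr_ge0 ?powR_ge0// ltW.
Qed.

End RadialReduction.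

(** * The sharp constant *)

Section SobolevConstant.
Context {R : realType}.
Variables (a kap s : R).
Hypotheses (a0 : 0 < a) (kap0 : 0 < kap) (s0 : 0 < s).
Let Q := 2 * (a + 1).
(** With a = (Q-2)/2 these exponents are [al] = 2/p and [bt] = 2/Q; they add up to 1 and are the
    weights of the AM-GM step. *)
Let al := a / (a + 1).
Let bt := (a + 1)^-1.

(** The integral of sech(t)^(2a+2) over the line, equal to 2^(2a+1) B(a+1, a+1). *)
Definition beta_const : R := 2 `^ (2 * a + 1) * (Gamma (a + 1) ^+ 2 / Gamma (2 * (a + 1))).

Let a1 : 1 <= a + 1. Proof. by rewrite lerDr ltW. Qed.
Let a2 : 0 < a + 1. Proof. exact: lt_le_trans a1. Qed.
Let Q1 : 1 <= Q. Proof. by rewrite /Q mulrDr mulr1 ler_wpDl ?mulr_ge0 ?(ltW a0)// ler1n. Qed.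
Let g1 : 0 < Gamma (a + 1). Proof. exact: Gamma_gt0. Qed.
Let g2 : 0 < Gamma Q. Proof. exact: Gamma_gt0. Qed.

Lemma beta_const_gt0 : 0 < beta_const.
Proof. by apply: mulr_gt0; [exact: powR_gt0|apply: divr_gt0; [exact: exprn_gt0|]]. Qed.

(** The infimum over M of the lower bound in [sobolev_interpolation] with [J] = [beta_const],
    divided by (s Y)^al; [sobCE] identifies it with the constant of the theorem. *)
Definition sobC : R := s `^ bt * kap `^ (2 - bt) * (a + 1) * a `^ (- al) * beta_const `^ bt.

Lemma sobC_gt0 : 0 < sobC.
Proof.
by apply: mulr_gt0; [rewrite !mulr_gt0 ?powR_gt0|rewrite powR_gt0// beta_const_gt0].
Qed.

(** Identities between products of real powers are proved by logarithms: the lemmas below assemble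
    the logarithm of an expression along its structure, which leaves a linear identity in the
    logarithms of the atoms. *)
Let has_ln (x l : R) := 0 < x /\ ln x = l.
Let hM x y l m : has_ln x l -> has_ln y m -> has_ln (x * y) (l + m).
Proof. by move=> [x0 <-] [y0 <-]; split; [exact: mulr_gt0|rewrite lnM]. Qed.
Let hV x l : has_ln x l -> has_ln x^-1 (- l).
Proof. by move=> [x0 <-]; split; [rewrite invr_gt0|rewrite lnV]. Qed.
Let hP x l e : has_ln x l -> has_ln (x `^ e) (e * l).
Proof. by move=> [x0 <-]; split; [rewrite powR_gt0|rewrite ln_powR]. Qed.
Let hX x l : has_ln x l -> has_ln (x ^+ 2) (2 * l).
Proof. by move=> [x0 <-]; split; [rewrite exprn_gt0|rewrite lnXn// mulr_natl]. Qed.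
Let hl x : 0 < x -> has_ln x (ln x).
Proof. by []. Qed.
Let hinj x y l : has_ln x l -> has_ln y l -> x = y.
Proof. by move=> [x0 <-] [y0 h]; apply: ln_inj; rewrite ?posrE. Qed.

Lemma sobCE : (kap ^+ 2) `^ ((Q - 1) / Q) / ((Q - 2) ^+ 2 / 4) `^ ((Q - 1) / Q) * S_const Q s = sobC.
Proof.
have Q2 : Q / 2 = a + 1 by rewrite /Q; field.
rewrite /S_const Q2 Gamma_succ//.
have -> : (Q - 2) ^+ 2 / 4 = a ^+ 2 by rewrite /Q; field.
have -> : Q - 2 = 2 * a by rewrite /Q; ring.
have two : has_ln 2 (ln 2) by exact: hl.
have hQ : has_ln Q (ln 2 + ln (a + 1)) := hM two (hl a2).
have hg : has_ln (Gamma (a + 1)) (ln (Gamma (a + 1))) := hl g1.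
have hG : has_ln (Gamma Q) (ln (Gamma Q)) := hl g2.
have ha := hl a0; have ha1 := hl a2; have hk := hl kap0; have hs := hl s0.
have h1 := hM (hM (hP ((Q - 1) / Q) (hX hk)) (hV (hP ((Q - 1) / Q) (hX ha))))
   (hM (hM (hM (hP (2 / Q) hs) (hP (2 * a / Q) hQ)) (hM two ha)) (hP (2 / Q) (hM (hM hg (hM ha1 hg)) (hV hG)))).
have h2 : has_ln sobC _ := hM (hM (hM (hM (hP bt hs) (hP (2 - bt) hk)) ha1) (hP (- al) ha))
   (hP bt (hM (hP (2 * a + 1) two) (hM (hX hg) (hV hG)))).
apply: hinj h1 _; rewrite [X in has_ln _ X](_ : _ = ln sobC); first by rewrite /has_ln sobC_gt0.
case: h2 => _ ->; rewrite /al /bt /Q.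
move: (ln 2) (ln (a + 1)) (ln a) (ln kap) (ln s) (ln (Gamma (a + 1))) (ln (Gamma Q)) => l1 l2 l3 l4 l5 l6 l7.
by field; rewrite gt_eqF.
Qed.

Lemma sobolev_interpolation (M Y J : R) : 0 < M -> 0 <= Y -> beta_const <= J ->
  sobC * (s * Y) `^ al <= s * kap ^+ 2 * (M ^+ 2) `^ (- a^-1) * Y + s * kap * M ^+ 2 * J.
Proof.
move=> M0 Y0 JJ.
have al0 : 0 < al by rewrite divr_gt0.
have be0 : 0 < bt by rewrite invr_gt0.
apply: (@le_trans _ _ (s * (kap ^+ 2 * (M ^+ 2) `^ (- a^-1) * Y + kap * M ^+ 2 * beta_const))); last first.
  have -> : s * (kap ^+ 2 * (M ^+ 2) `^ (- a^-1) * Y + kap * M ^+ 2 * beta_const) =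
      s * kap ^+ 2 * (M ^+ 2) `^ (- a^-1) * Y + s * kap * M ^+ 2 * beta_const.
    by move: beta_const (M ^+ 2) => x y; ring.
  rewrite lerD2l; apply: ler_wpM2l => //.
  by rewrite mulr_ge0 ?sqr_ge0// mulr_ge0 ?(ltW s0) ?(ltW kap0).
have [->|Yn0] := eqVneq Y 0.
  rewrite mulr0 powR0 ?gt_eqF// mulr0 mulr0 add0r.
  apply: mulr_ge0; first exact: ltW.
  apply: mulr_ge0; last exact: ltW beta_const_gt0.
  by apply: mulr_ge0; [exact: ltW|exact: sqr_ge0].
have {}Y0 : 0 < Y by rewrite lt_neqAle eq_sym Yn0.
set X1 := kap ^+ 2 * _ * Y; set X2 := kap * _ * beta_const.
have M2 : 0 < M ^+ 2 by rewrite exprn_gt0.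
have X10 : 0 < X1 by apply: mulr_gt0 => //; apply: mulr_gt0; [exact: exprn_gt0|exact: powR_gt0].
have X20 : 0 < X2 by apply: mulr_gt0; [exact: mulr_gt0|exact: beta_const_gt0].
(* Weighted AM-GM, from Young's inequality with conjugate exponents (a+1)/a and a+1. With these
   weights the powers of M cancel, because [al]/a = [bt]. *)
have amgm : (X1 / al) `^ al * (X2 / bt) `^ bt <= X1 + X2.
  have [p1 p2] : 0 <= X1 / al /\ 0 <= X2 / bt by rewrite !divr_ge0 ?ltW.
  have e1 : al * ((a + 1) / a) = 1 by rewrite /al; field; rewrite !gt_eqF.
  have e2 : bt * (a + 1) = 1 by rewrite mulVf// gt_eqF.
  have e3 z : z / al / ((a + 1) / a) = z by rewrite -mulrA -invfM e1 invr1 mulr1.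
  have e4 z : z / bt / (a + 1) = z by rewrite -mulrA -invfM e2 invr1 mulr1.
  have := @conjugate_powR R ((X1 / al) `^ al) ((X2 / bt) `^ bt) ((a + 1) / a) (a + 1)
    (powR_ge0 _ _) (powR_ge0 _ _) (divr_gt0 a2 a0) a2.
  rewrite -!powRrM e1 e2 !powRr1// e3 e4; apply.
  by field; rewrite !gt_eqF.
apply: le_trans (ler_wpM2l (ltW s0) amgm).
rewrite le_eqVlt; apply/orP; left; apply/eqP.
have ha := hl a0; have ha1 := hl a2; have hk := hl kap0; have hs := hl s0.
have hM2 := hl M2; have hY := hl Y0; have hJ := hl beta_const_gt0.
have h1 : has_ln (sobC * (s * Y) `^ al) _ :=
   hM (hM (hM (hM (hM (hP bt hs) (hP (2 - bt) hk)) ha1) (hP (- al) ha)) (hP bt hJ)) (hP al (hM hs hY)).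
have h2 : has_ln (s * ((X1 / al) `^ al * (X2 / bt) `^ bt)) _ :=
  hM hs (hM (hP al (hM (hM (hM (hX hk) (hP (- a^-1) hM2)) hY) (hV (hM ha (hV ha1)))))
            (hP bt (hM (hM (hM hk hM2) hJ) (hV (hV ha1))))).
apply: hinj h1 _; rewrite [X in has_ln _ X](_ : _ = ln (s * ((X1 / al) `^ al * (X2 / bt) `^ bt))).
  by case: h2 => h2 _.
case: h2 => _ ->; rewrite /al /bt.
move: (ln (M ^+ 2)) (ln (a + 1)) (ln a) (ln kap) (ln s) (ln Y) (ln beta_const) => l1 l2 l3 l4 l5 l6 l7.
by field; rewrite !gt_eqF.
Qed.

(* [X] plays the role of the integral of the extremal profile to the power [p]. *)
Lemma sobolev_extremal (C' : R) : let b := kap / a in let X := beta_const / b in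
  C' * (s * X) `^ al <= s * (a * (a + 1) * b ^+ 2 * X) -> C' <= sobC.
Proof.
move=> b X; have b0 : 0 < b by rewrite divr_gt0.
have X0 : 0 < X by apply: divr_gt0; [exact: beta_const_gt0|].
have sX : 0 < (s * X) `^ al by apply: powR_gt0; exact: mulr_gt0.
rewrite -(ler_pdivlMr _ _ sX) => /le_trans; apply.
rewrite le_eqVlt; apply/orP; left; apply/eqP.
have ha := hl a0; have ha1 := hl a2; have hk := hl kap0; have hs := hl s0; have hJ := hl beta_const_gt0.
have hb := hM hk (hV ha).
have hX' : has_ln X _ := hM hJ (hV hb).
have h1 : has_ln sobC _ := hM (hM (hM (hM (hP bt hs) (hP (2 - bt) hk)) ha1) (hP (- al) ha)) (hP bt hJ).
have h2 : has_ln (s * (a * (a + 1) * b ^+ 2 * X) / (s * X) `^ al) _ :=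
  hM (hM hs (hM (hM (hM ha ha1) (hX hb)) hX')) (hV (hP al (hM hs hX'))).
apply: hinj h2 _; rewrite [X in has_ln _ X](_ : _ = ln sobC); first by rewrite /has_ln sobC_gt0.
case: h1 => _ ->; rewrite /al /bt.
move: (ln (a + 1)) (ln a) (ln kap) (ln s) (ln beta_const) => l2 l3 l4 l5 l7.
by field; rewrite !gt_eqF.
Qed.

Lemma sech_kernel_int : (\int[lebesgue_measure]_(u in `]0%R, +oo[) (sech_kernel a u)%:E)%E = beta_const%:E.
Proof.
have -> : (\int[lebesgue_measure]_(u in `]0%R, +oo[) (sech_kernel a u)%:E =
   \int[lebesgue_measure]_(u in `]0%R, +oo[) ((2 `^ (2 * a + 1))%:E * (beta_fun (a + 1) u)%:E))%E.
  by apply: eq_integral => u; rewrite inE /= in_itv /= andbT => u0; rewrite sech_kernel_beta_fun.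
rewrite ge0_integralZl_EFin ?powR_ge0//.
- by rewrite -/(beta_int (a + 1)) beta_intE// -EFinM.
- by move=> u _; rewrite lee_fin beta_fun_ge0.
apply/measurable_EFinP; apply: pos_measurable => u u0; apply: (@cvgM R R^o).
  exact: powR_cont.
apply: (@continuous_comp _ _ _ (fun u : R^o => 1 + u : R^o) (fun x : R^o => x `^ (- (2 * (a + 1))) : R^o)).
  by apply: (@cvgD _ R^o); [exact: cvg_cst|exact: cvg_id].
by apply: powR_cont; rewrite addr_gt0.
Qed.

End SobolevConstant.

(** * Smooth approximation of radial functions *)

Section UniformApproximation.
Context {R : realType} {n : nat} {M : ptopologicalType}.
Context {A : set (chart 'rV[R]_n M)}.
Hypothesis HA : smooth_atlas A.
Hypothesis hM : hausdorff_space M.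
Variables (F : M -> R) (K O : set M) (e : R).
Hypothesis (cF : continuous (F : M -> R^o)) (FK : forall x, F x != 0 -> K x).
Hypothesis (cK : compact K) (oO : open O) (KO : K `<=` O) (e0 : 0 < e).

(* [1 - P] is the part of the partition of unity already used up by [f]. *)
Let partial_approx (f P : M -> R) : Prop :=
  [/\ smooth_fun A f, smooth_fun A P, (forall x, 0 <= P x <= 1),
      (forall x, `|f x - (1 - P x) * F x| <= e * (1 - P x)) &
      (forall x, f x != 0 -> O x)].

Let approx_comp f1 P1 f2 P2 : partial_approx f1 P1 -> partial_approx f2 P2 ->
  partial_approx (fun x => f2 x + P2 x * f1 x) (fun x => P1 x * P2 x).
Proof.
move=> [s1 t1 b1 a1 o1] [s2 t2 b2 a2 o2]; split.
- by apply: smoothD => //; exact: smoothM.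
- exact: smoothM.
- move=> x; have /andP[p1 q1] := b1 x; have /andP[p2 q2] := b2 x.
  by rewrite mulr_ge0//= mulr_ile1.
- move=> x; have /andP[p1 q1] := b1 x; have /andP[p2 q2] := b2 x.
  have -> : f2 x + P2 x * f1 x - (1 - P1 x * P2 x) * F x =
    (f2 x - (1 - P2 x) * F x) + P2 x * (f1 x - (1 - P1 x) * F x) by ring.
  apply: le_trans (ler_normD _ _) _; rewrite normrM (ger0_norm p2).
  have -> : e * (1 - P1 x * P2 x) = e * (1 - P2 x) + P2 x * (e * (1 - P1 x)) by ring.
  by rewrite lerD// ler_wpM2l.
- move=> x; have [f20|/o2//] := eqVneq (f2 x) 0; rewrite f20 add0r mulf_eq0 negb_or.
  by move=> /andP[_ /o1].
Qed.

Let approx_id : partial_approx (fun=> 0) (fun=> 1).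
Proof.
split; [exact: smooth_cst|exact: smooth_cst| | |].
- by move=> x; rewrite ler01 lexx.
- by move=> x; rewrite subrr !(mulr0, mul0r) subrr normr0.
- by move=> x; rewrite eqxx.
Qed.

Let approx_at x : K x -> exists f P, partial_approx f P /\ P x < 1.
Proof.
move=> Kx; pose N := O `&` [set y | `|F x - F y| < e].
have oN : open N.
  apply: openI => //.
  have cG : continuous (fun y => `|F x - F y| : R^o).
    move=> y; apply: (@continuous_comp _ _ _ (fun y => F x - F y : R^o) (Num.Def.normr : R^o -> R^o)).
      by apply: (@cvgB _ R^o); [exact: cvg_cst|exact: cF].
    exact: norm_continuous.
  by apply: (@open_comp _ _ (fun y => `|F x - F y| : R^o) [set z : R^o | z < e]) => //; exact: open_lt.
have Nx : N x by split; [exact: KO|rewrite /= subrr normr0].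
have [b [L [sb b01 bx _ [LN bL]]]] := smooth_bump HA hM oN Nx.
exists (fun y => F x * b y), (fun y => 1 + -1 * b y); split; last by rewrite mulN1r ltrBlDr ltrDl.
split.
- exact: smoothZ.
- by apply: (smoothD HA); [exact: smooth_cst|exact: smoothZ].
- move=> y; have /andP[] := b01 y; lra.
- move=> y; have -> : F x * b y - (1 - (1 + -1 * b y)) * F y = b y * (F x - F y) by ring.
  have -> : e * (1 - (1 + -1 * b y)) = b y * e by ring.
  have /andP[b0 _] := b01 y; rewrite normrM (ger0_norm b0).
  have [->|/bL/LN[_ /ltW]] := eqVneq (b y) 0; first by rewrite !mul0r.
  exact: ler_wpM2l.
- by move=> y; rewrite mulf_eq0 negb_or => /andP[_ /bL/LN[]].
Qed.

Let approx_cover : exists f P, partial_approx f P /\ forall x, K x -> P x < 1.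
Proof.
have : forall x : M, exists fP : (M -> R) * (M -> R), partial_approx fP.1 fP.2 /\ (K x -> fP.2 x < 1).
  move=> x; have [Kx|nKx] := pselect (K x); last by exists (fun=> 0, fun=> 1).
  by have [f [P [h1 h2]]] := approx_at Kx; exists (f, P).
move=> /choice[g gP].
have : cover_compact K by rewrite -compact_cover.
move=> /(_ M K (fun x => [set y | (g x).2 y < 1])).
case.
- move=> x Kx; have [[_ sP _ _ _] _] := gP x.
  apply: (@open_comp _ _ ((g x).2 : M -> R^o) [set z : R^o | z < 1]); last exact: open_lt.
  by move=> y _; exact: smooth_fun_continuous sP y.
- by move=> x Kx; exists x => //=; exact: (gP x).2.
move=> D _ KD.
suff [f [P [h1 h2]]] : exists f P, partial_approx f P /\
    forall y x, x \in (finmap.enum_fset D) -> (g x).2 y < 1 -> P y < 1.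
  by exists f, P; split=> // x /KD[y /= yD]; exact: h2.
elim: (finmap.enum_fset D) => [|x s [f [P [h1 h2]]]]; first by exists (fun=> 0), (fun=> 1).
exists (fun y => f y + P y * (g x).1 y), (fun y => (g x).2 y * P y).
have [a2 _] := gP x; split; first exact: approx_comp a2 h1.
move=> y z; have [_ _ /(_ y)/andP[p0 p1] _ _] := a2; have [_ _ /(_ y)/andP[q0 q1] _ _] := h1.
rewrite inE => /orP[/eqP->|zs] lt1.
  by apply: le_lt_trans lt1; rewrite ler_piMr.
by apply: le_lt_trans (h2 _ _ zs lt1); rewrite ler_piMl.
Qed.

Lemma unif_approx : exists f, [/\ smooth_fun A f, (forall x, `|f x - F x| <= 2 * e) &
  (forall x, f x != 0 -> O x)].
Proof.
have [f [P [aP P1]]] := approx_cover.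
have [C C0 FC] := compact_bounded_fun cF cK FK.
have [rho [rho0 rho1 Prho]] : exists rho, [/\ 0 <= rho, rho < 1 & forall x, K x -> P x <= rho].
  have [K0|/set0P/negP/negPn/eqP K0] := pselect (K !=set0); last first.
    by exists 0; split=> // x; rewrite K0.
  have [_ sP b01 _ _] := aP.
  have [|z Kz Hz] := @compact_EVT_max M R P K K0 cK.
    by apply: continuous_subspaceT => x; exact: smooth_fun_continuous sP x.
  exists (P z); split; [by have /andP[] := b01 z|apply: P1; exact/set_mem|].
  by move=> x Kx; apply: Hz; exact/mem_set.
have powP m : exists f, partial_approx f (fun x => P x ^+ m).
  elim: m => [|m [g gP]]; first by exists (fun=> 0); exact: approx_id.
  exists (fun x => f x + P x * g x).
  have -> : (fun x => P x ^+ m.+1) = (fun x => P x ^+ m * P x).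
    by apply/funext => x; rewrite exprSr.
  exact: approx_comp.
have : (fun m => rho ^+ m * C : R^o) @ \oo --> (0 * C : R^o).
  by apply: (@cvgMr_tmp R nat); apply: cvg_expr; rewrite ger0_norm.
rewrite mul0r => /cvgrPdist_le/(_ _ e0)[m _ /(_ m (leqnn m))].
rewrite sub0r normrN => hm.
have [g [sg sPm b01 ag og]] := powP m; exists g; split=> // x.
have /andP[p0 p1] := b01 x.
have -> : g x - F x = g x - (1 - P x ^+ m) * F x - P x ^+ m * F x by ring.
apply: le_trans (ler_normB _ _) _; rewrite mulr_natl mulr2n lerD//.
  by apply: le_trans (ag x) _; rewrite ler_piMr ?(ltW e0)// gerBl.
have [->|/FK Kx] := eqVneq (F x) 0; first by rewrite mulr0 normr0 ltW.
apply: le_trans (le_trans (ler_norm _) hm).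
rewrite normrM (ger0_norm p0); apply: ler_pM => //.
have [_ _ /(_ x)/andP[q0 _] _ _] := aP.
by apply: lerXn2r; rewrite ?nnegrE// Prho.
Qed.

End UniformApproximation.

(** * Riemann sums and interpolation by hat functions *)

Section HatFunctions.
Context {R : realType}.

Lemma mvt (g dg : R -> R) (a b : R) : a <= b ->
  (forall t, is_derive (t : R^o) (1 : R^o) (g : R^o -> R^o) (dg t)) ->
  exists2 c, a <= c <= b & g b - g a = dg c * (b - a).
Proof.
move=> ab dgP.
have [|c] := @MVT_segment R g dg a b ab (fun t _ => dgP t).
  by apply: continuous_subspaceT => t; exact: derive_continuous (dgP t).
by rewrite in_itv /= => cab cE; exists c.
Qed.

Lemma lipschitz_of_derive (g dg : R -> R) (B s t : R) :
  (forall t, is_derive (t : R^o) (1 : R^o) (g : R^o -> R^o) (dg t)) ->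
  (forall t, `|dg t| <= B) -> `|g s - g t| <= B * `|s - t|.
Proof.
move=> dgP dB; wlog ts : s t / t <= s.
  by move=> H; have [/H//|/ltW/H] := leP t s; rewrite distrC (distrC s).
have [c _ ->] := mvt ts dgP.
by rewrite normrM ler_wpM2r.
Qed.

(** On each step the mean value theorem gives the increment of [g] as [d] times a value of [dg]
    within distance [d] of the node. For [g] of compact support it says that the sums of [dg] are
    nearly zero. *)
Lemma riemann_sum_derive (g dg : R -> R) (s0 d w : R) (N : nat) : 0 <= d ->
  (forall t, is_derive (t : R^o) (1 : R^o) (g : R^o -> R^o) (dg t)) ->
  (forall s t, `|s - t| <= d -> `|dg s - dg t| <= w) ->
  `|\sum_(j < N) d * dg (s0 + j%:R * d) - (g (s0 + N%:R * d) - g s0)| <= N%:R * d * w.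
Proof.
move=> d0 dgP dw; elim: N => [|N IH].
  by rewrite big_ord0 !mul0r addr0 subrr subr0 normr0.
rewrite big_ord_recr /=.
have le : s0 + N%:R * d <= s0 + N.+1%:R * d by rewrite lerD2l ler_wpM2r// ler_nat.
have [c /andP[c1 c2] cE] := mvt le dgP.
have dE : s0 + N.+1%:R * d - (s0 + N%:R * d) = d by rewrite -natr1; ring.
rewrite dE in cE.
set S := \sum_(j < N) _ in IH *.
have -> : S + d * dg (s0 + N%:R * d) - (g (s0 + N.+1%:R * d) - g s0) =
  (S - (g (s0 + N%:R * d) - g s0)) + d * (dg (s0 + N%:R * d) - dg c).
  have -> : g (s0 + N.+1%:R * d) = g (s0 + N%:R * d) + dg c * d by rewrite -cE; ring.
  by ring.
have -> : N.+1%:R * d * w = N%:R * d * w + d * w by rewrite -natr1; ring.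
apply: le_trans (ler_normD _ _) _; apply: lerD => //.
rewrite normrM ger0_norm// ler_wpM2l// dw// distrC ger0_norm ?subr_ge0//.
by rewrite -[leRHS]dE lerD2r.
Qed.

Variable tau : R.
Hypothesis tau0 : 0 < tau.

Definition ramp (t : R) : R := Num.max 0 (Num.min 1 (t / tau)).
(** The piecewise linear hat on [-tau, tau] with integral 1. As a difference of ramps shifted by
    [tau], which is [m] steps of size [d], its translates have sums that telescope. *)
Definition hat (t : R) : R := (ramp (t + tau) - ramp t) / tau.

Lemma ramp_ge0 t : 0 <= ramp t. Proof. by rewrite le_max lexx. Qed.
Lemma ramp_le1 t : ramp t <= 1. Proof. by rewrite ge_max ler01 ge_min lexx. Qed.

Lemma ramp0 t : t <= 0 -> ramp t = 0.
Proof.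
move=> t0; apply/max_idPl; rewrite ge_min; apply/orP; right.
by rewrite pmulr_lle0// invr_gt0.
Qed.

Lemma ramp1 t : tau <= t -> ramp t = 1.
Proof.
move=> t0; rewrite /ramp (_ : Num.min 1 _ = 1); first by apply/max_idPr.
by apply/min_idPl; rewrite ler_pdivlMr// mul1r.
Qed.

Lemma ramp_nondecreasing s t : s <= t -> ramp s <= ramp t.
Proof.
move=> st; rewrite /ramp ge_max !le_max lexx /=; apply/orP; right.
by rewrite le_min !ge_min lexx /= ler_wpM2r ?orbT// invr_ge0 ltW.
Qed.

Lemma ramp_continuous : continuous (ramp : R^o -> R^o).
Proof.
move=> t.
have c0 a : {for t, continuous (fun=> a : R^o)} by exact: cvg_cst.
have c1 : {for t, continuous (fun t : R^o => t / tau : R^o)}.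
  by apply: (@cvgMr_tmp R R^o); exact: cvg_id.
exact: (continuous_max (c0 0) (continuous_min (c0 1) c1)).
Qed.

Lemma hat_ge0 t : 0 <= hat t.
Proof. by rewrite divr_ge0 ?(ltW tau0)// subr_ge0 ramp_nondecreasing// lerDl ltW. Qed.

Lemma hat_supp t : hat t != 0 -> `|t| < tau.
Proof.
apply: contraNT; rewrite -leNgt ler_normr => /orP[h|h].
  by rewrite /hat !ramp1 ?subrr ?mul0r// (le_trans h)// lerDl ltW.
have h2 : t + tau <= 0 by rewrite addrC -lerBrDr sub0r.
have h1 : t <= 0 by rewrite (le_trans _ h2)// lerDl ltW.
by rewrite /hat !ramp0// subrr mul0r.
Qed.

Lemma hat_continuous : continuous (hat : R^o -> R^o).
Proof.
move=> t; apply: (@cvgMr_tmp R R^o); apply: (@cvgB _ R^o); last exact: ramp_continuous.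
apply: (@continuous_comp _ _ _ (fun t : R^o => t + tau : R^o) (ramp : R^o -> R^o)).
  by apply: (@cvgD _ R^o); [exact: cvg_id|exact: cvg_cst].
exact: ramp_continuous.
Qed.

Lemma telescope_shift (u : nat -> R) (N m : nat) :
  \sum_(j < N) (u j - u (j + m)%N) = \sum_(j < m) u j - \sum_(j < m) u (N + j)%N.
Proof.
elim: N => [|N IH]; first by rewrite big_ord0 subrr.
rewrite big_ord_recr /= IH; case: m {IH} => [|m].
  by rewrite !big_ord0 addn0 !subrr addr0.
rewrite [\sum_(j < m.+1) u (N + j)%N]big_ord_recl [\sum_(j < m.+1) u (N.+1 + j)%N]big_ord_recr /=.
rewrite addn0.
have -> : \sum_(i < m) u (N + fintype.bump 0 i)%N = \sum_(i < m) u (N.+1 + i)%N.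
  by apply: eq_bigr => i _; rewrite /fintype.bump /= add1n addnS.
rewrite addnS; ring.
Qed.

Variables (m : nat) (d s0 : R) (N : nat).
Hypotheses (d0 : 0 < d) (md : tau = m%:R * d).

Lemma hat_sum t : \sum_(j < N) d * hat (t - (s0 + j%:R * d)) =
  m%:R^-1 * (\sum_(j < m) ramp (t - s0 + tau - j%:R * d) -
             \sum_(j < m) ramp (t - s0 + tau - (N + j)%:R * d)).
Proof.
have m0 : m%:R != 0 :> R.
  by apply: contraTneq tau0 => m0; rewrite md m0 mul0r ltxx.
rewrite -(telescope_shift (fun j => ramp (t - s0 + tau - j%:R * d))) mulr_sumr.
apply: eq_bigr => j _; rewrite /hat.
have -> : t - (s0 + j%:R * d) + tau = t - s0 + tau - j%:R * d by ring.
have -> : t - s0 + tau - (j + m)%:R * d = t - (s0 + j%:R * d) by rewrite natrD mulrDl md; ring.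
by rewrite md invfM; field; rewrite m0 gt_eqF.
Qed.

Let m_gt0 : 0 < m%:R :> R.
Proof. by move: tau0; rewrite md pmulr_lgt0. Qed.

Lemma hat_sum_le1 t : \sum_(j < N) d * hat (t - (s0 + j%:R * d)) <= 1.
Proof.
rewrite hat_sum mulrC ler_pdivrMr// mul1r lerBlDr -[X in X <= _]addr0; apply: lerD.
  have -> : m%:R = \sum_(j < m) 1 :> R by rewrite sumr_const card_ord.
  by apply: ler_sum => j _; exact: ramp_le1.
by apply: sumr_ge0 => j _; exact: ramp_ge0.
Qed.

Lemma hat_sum_eq1 t : s0 + tau <= t -> t <= s0 + N%:R * d - tau ->
  \sum_(j < N) d * hat (t - (s0 + j%:R * d)) = 1.
Proof.
move=> h1 h2; rewrite hat_sum [X in _ * (X - _)](_ : _ = m%:R); last first.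
  have -> : m%:R = \sum_(j < m) 1 :> R by rewrite sumr_const card_ord.
  apply: eq_bigr => j _; apply: ramp1.
  have : j%:R * d <= tau by rewrite md ler_wpM2r ?(ltW d0)// ler_nat ltnW.
  lra.
rewrite [X in _ * (_ - X)](_ : _ = 0); first by rewrite subr0 mulVf ?gt_eqF.
apply: big1 => j _; apply: ramp0.
rewrite natrD mulrDl; have : 0 <= j%:R * d by rewrite mulr_ge0 ?(ltW d0).
lra.
Qed.

(** Where [h] lives the hats weighted by [d] sum to exactly 1, so the sum averages values of [h] at
    distance less than [tau]; elsewhere they sum to at most 1. *)
Lemma hat_interpolation (h : R -> R) (w t : R) : 0 <= w ->
  (forall t, h t != 0 -> s0 + tau <= t <= s0 + N%:R * d - tau) ->
  (forall s t, `|s - t| <= tau -> `|h s - h t| <= w) ->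
  `|\sum_(j < N) d * h (s0 + j%:R * d) * hat (t - (s0 + j%:R * d)) - h t| <= w.
Proof.
move=> w0 hs hw.
have -> : h t = h t * \sum_(j < N) d * hat (t - (s0 + j%:R * d)).
  have [->|/hs/andP[h1 h2]] := eqVneq (h t) 0; first by rewrite mul0r.
  by rewrite hat_sum_eq1// mulr1.
rewrite mulr_sumr -sumrB; apply: le_trans (ler_norm_sum _ _ _) _.
apply: (@le_trans _ _ (w * \sum_(j < N) d * hat (t - (s0 + j%:R * d)))); last first.
  by rewrite ler_piMr// hat_sum_le1.
rewrite mulr_sumr; apply: ler_sum => j _; set s := s0 + _.
have -> : d * h s * hat (t - s) - h t * (d * hat (t - s)) = (h s - h t) * (d * hat (t - s)) by ring.
have p0 : 0 <= d * hat (t - s) by rewrite mulr_ge0 ?hat_ge0// ltW.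
rewrite normrM (ger0_norm p0).
have [->|/hat_supp/ltW lt] := eqVneq (hat (t - s)) 0; first by rewrite !mulr0.
by rewrite ler_wpM2r// hw// distrC.
Qed.

End HatFunctions.

(** * Smooth functions on the group close to a function of the logarithm of the quasi-norm *)

Section RadialApproximation.
Context {R : realType} {n : nat} {G : groupSpaceType}.
Context {A : set (chart 'rV[R]_n G)} {E : 'rV[R]_n -> (G -> R) -> G -> R}.
Context {A0 : 'M[R]_n} {dil : R -> G -> G} {q : G -> R}.
Hypothesis HG : homogeneous_group A E A0.
Hypothesis HD : induced_dilations A E A0 dil.
Hypothesis HQ : homogeneous_quasi_norm dil q.
Let HL := hg_lie HG.
Let HA := lie_atlas HL.
Let cq : forall rho : R, compact [set x | q x <= rho].
Proof. by move=> rho; exact: (@compact_qball R n G A E A0 dil HG HD q HQ rho). Qed.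
Arguments cq : clear implicits.
Local Notation eu := (eulerR (dil := dil)).

Lemma is_derive_flow (w : G -> R) x (s : R) : smooth_fun A w ->
  is_derive (s : R^o) (1 : R^o) (fun s : R^o => w (dil (expR (- s)) x) : R^o)
    (- eu w (dil (expR (- s)) x)).
Proof.
move=> sw; have d1 := is_derive_eulerR HL HD x (- s) sw.
have d2 : is_derive (s : R^o) (1 : R^o) (fun s : R^o => - s : R^o) (-1).
  exact: is_deriveN (is_derive_id _ _).
have := @is_derive1_comp R (fun t : R^o => w (dil (expR t) x) : R^o) (fun s : R^o => - s : R^o) s _ _ d1 d2.
by move=> d; apply: is_derive_eq d _; rewrite mulrN1.
Qed.

(** Dilations commute with one another, hence with the Euler operator. *)
Lemma eulerR_sum (w : G -> R) (c s : nat -> R) (N : nat) x : smooth_fun A w ->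
  eu (fun x => \sum_(j < N) c j * w (dil (expR (- s j)) x)) x =
  \sum_(j < N) c j * eu w (dil (expR (- s j)) x).
Proof.
move=> sw.
have st (t : R) j : w (dil (expR (- s j)) (dil (expR t) x)) = w (dil (expR t) (dil (expR (- s j)) x)).
  by rewrite -!(dilM HD) ?expR_gt0// mulrC.
suff [_ <-] : is_derive (0 : R^o) (1 : R^o)
   (fun t : R^o => \sum_(j < N) c j * w (dil (expR (- s j)) (dil (expR t) x)) : R^o)
   (\sum_(j < N) c j * eu w (dil (expR (- s j)) x)) by rewrite /eulerR derive1E.
elim: N => [|N IH].
  rewrite big_ord0 (_ : (fun t => _) = cst 0); first exact: is_derive_cst.
  by apply/funext => t; rewrite big_ord0.
rewrite big_ord_recr (_ : (fun t => _) =
  (fun t : R^o => \sum_(j < N) c j * w (dil (expR (- s j)) (dil (expR t) x)) : R^o) +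
  (fun t : R^o => c N * w (dil (expR t) (dil (expR (- s N)) x)) : R^o)); last first.
  by apply/funext => t; rewrite big_ord_recr /= st.
apply: is_deriveD => /=.
have := is_derive_eulerR HL HD (dil (expR (- s N)) x) 0 sw.
by rewrite expR0 (dil1 HD) => /(is_deriveZ (c N)).
Qed.

Lemma hat_smooth_approx (tau e : R) : 0 < tau -> tau < 1 -> 0 < e ->
  exists Phi, [/\ smooth_fun A Phi,
    (forall x, 0 < q x -> `|Phi x - hat tau (ln (q x))| <= e) &
    (forall x, Phi x != 0 -> expR (-2) < q x < expR 2)].
Proof.
move=> tau0 tau1 e0.
(* Truncating [q] below keeps the logarithm continuous at the identity; the hat function vanishes
   there anyway, since [tau] < 1. *)
pose mq x := Num.max (q x) (expR (-1)).
have mq0 x : 0 < mq x by rewrite lt_max expR_gt0 orbT.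
pose F x := hat tau (ln (mq x)).
have cF : continuous (F : G -> R^o).
  move=> x; apply: (@continuous_comp _ _ _ (fun x => ln (mq x) : R^o) (hat tau : R^o -> R^o)); last first.
    exact: hat_continuous.
  apply: (@continuous_comp _ _ _ (mq : G -> R^o) (@ln R : R^o -> R^o)); last exact: continuous_ln.
  have cc : {for x, continuous (fun=> expR (-1) : R^o)} by exact: cvg_cst.
  exact: (continuous_max (@q_continuous R G dil q HQ x) cc).
pose K := [set x | expR (-1) <= q x] `&` [set x | q x <= expR 1].
pose O := [set x | expR (-2) < q x] `&` [set x | q x < expR 2].
have cK : compact K.
  apply: subclosed_compact (cq (expR 1)) _; last by move=> x [].
  apply: closedI.
    apply: (@closed_comp _ _ (q : G -> R^o) [set z : R^o | expR (-1) <= z]); last exact: closed_ge.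
    by move=> x _; exact: (@q_continuous R G dil q HQ x).
  apply: (@closed_comp _ _ (q : G -> R^o) [set z : R^o | z <= expR 1]); last exact: closed_le.
  by move=> x _; exact: (@q_continuous R G dil q HQ x).
have oO : open O.
  apply: openI.
    apply: (@open_comp _ _ (q : G -> R^o) [set z : R^o | expR (-2) < z]); last exact: open_gt.
    by move=> x _; exact: (@q_continuous R G dil q HQ x).
  apply: (@open_comp _ _ (q : G -> R^o) [set z : R^o | z < expR 2]); last exact: open_lt.
  by move=> x _; exact: (@q_continuous R G dil q HQ x).
have FK x : F x != 0 -> K x.
  move=> /(hat_supp tau0); rewrite ltr_norml => /andP[h1 h2].
  have l1 : -1 < ln (mq x) by apply: lt_trans h1; rewrite ltrN2.
  have l2 : ln (mq x) < 1 by exact: lt_trans tau1.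
  have m1 : expR (-1) < mq x by rewrite -[mq x]lnK ?posrE// ltr_expR.
  have m2 : mq x < expR 1 by rewrite -[mq x]lnK ?posrE// ltr_expR.
  have mE : mq x = q x.
    by move: m1; rewrite /mq; case: (leP (q x) (expR (-1))) => // _; rewrite ltxx.
  by rewrite mE in m1 m2; split; rewrite /= ltW.
have KO : K `<=` O.
  move=> x [/= h1 h2]; split => /=.
    by apply: lt_le_trans h1; rewrite ltr_expR ltrN2 ltr1n.
  by apply: le_lt_trans h2 _; rewrite ltr_expR ltr1n.
have e20 : 0 < e / 2 by rewrite divr_gt0.
have [Phi [sP PF PO]] := unif_approx HA (lie_hausdorff HL) cF FK cK oO KO e20.
exists Phi; split=> //; last by move=> x /PO[/= -> ->].
move=> x qx; have -> : e = 2 * (e / 2) by field.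
suff -> : hat tau (ln (q x)) = F x by [].
rewrite /F /mq; case: (leP (q x) (expR (-1))) => // qe.
have tle y : y <= -1 -> hat tau y = 0.
  move=> y1; apply/eqP; apply: contraTT y1 => /(hat_supp tau0); rewrite ltr_norml -ltNge => /andP[+ _].
  by apply: lt_trans; rewrite ltrN2.
by rewrite !tle ?expRK// -[leRHS](expRK (-1)) ler_ln ?posrE ?expR_gt0.
Qed.

(* [f] is a Riemann sum of the convolution along the dilation flow of [k] with a smooth
   approximation [Phi] of the hat function of [ln q]; the sum [eu f + \sum_j d dk(s_j) Phi_j] is a
   Riemann sum of the derivative of a compactly supported function of the flow parameter. *)
Lemma radial_approx (k dk : R -> R) (L M0 M1 e : R) : 0 < e -> 0 <= L ->
  (forall t, is_derive (t : R^o) (1 : R^o) (k : R^o -> R^o) (dk t)) ->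
  (forall t, k t != 0 -> `|t| <= L) -> (forall t, dk t != 0 -> `|t| <= L) ->
  (forall t, `|k t| <= M0) -> (forall t, `|dk t| <= M1) ->
  (forall e, 0 < e -> exists2 d, 0 < d & forall s t, `|s - t| <= d -> `|dk s - dk t| <= e) ->
  exists f, [/\ smooth_fun A f,
    (forall x, f x != 0 -> expR (- (L + 2)) < q x < expR (L + 2)) &
    (forall x, 0 < q x -> `|f x - k (ln (q x))| <= e /\ `|eu f x - dk (ln (q x))| <= e)].
Proof.
move=> e0 L0 kD kL dkL kM0 dkM1 uc.
have M00 : 0 <= M0 by apply: le_trans (kM0 0).
have M10 : 0 <= M1 by apply: le_trans (dkM1 0).
pose La := 2 * L + 3.
have La0 : 0 < La by rewrite /La; lra.
have e4 : 0 < e / 4 by rewrite divr_gt0.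
have [d1 d10 uc1] := uc _ e4.
(* The bound 1/2 leaves a margin around the support, [d1] limits the variation of [dk] over a
   distance [tau] to e/4, and the last term does the same for [k], which is [M1]-Lipschitz. *)
pose tau := Num.min (2^-1) (Num.min d1 (e / 4 / (M1 + 1))).
have M11 : 0 < M1 + 1 by rewrite ltr_wpDl.
have tau0 : 0 < tau by rewrite !lt_min d10 invr_gt0 ltr0n divr_gt0.
have tauh : tau <= 2^-1 by rewrite ge_min lexx.
have taud : tau <= d1 by rewrite !ge_min lexx orbT.
have tauM : tau * (M1 + 1) <= e / 4 by rewrite -ler_pdivlMr// !ge_min lexx !orbT.
have tau1 : tau < 1 by apply: le_lt_trans tauh _; rewrite invf_lt1// ltr1n.
have MM : 0 < M0 + M1 + 1 by rewrite ltr_wpDl// addr_ge0.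
(* The error allowed between [Phi] and the hat: weighted by [k] or [dk] and summed over a length of
   at most [La], it costs at most e/4. *)
pose e1 := e / 4 / (La * (M0 + M1 + 1)).
have e10 : 0 < e1 by rewrite !divr_gt0// mulr_gt0.
have [Phi [sP PF PO]] := hat_smooth_approx tau0 tau1 e10.
have tP : tame (A := A) (q := q) (expR 2) Phi by split=> // x /PO/andP[_ /ltW].
have tP1 := tame_euler HG HD HQ tP; have tP2 := tame_euler HG HD HQ tP1.
have [B0 B00 PB0] := tame_bounded HG HD HQ tP.
have [B1 B10 PB1] := tame_bounded HG HD HQ tP1.
have [B2 B20 PB2] := tame_bounded HG HD HQ tP2.
(* The variation allowed to [dk] over one step: multiplied by the bound [B0] of [Phi] and by the
   length [La] it costs at most e/8. *)
pose e2 := e / 8 / (La * (B0 + 1)).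
have B01 : 0 < B0 + 1 by rewrite ltr_wpDl.
have e20 : 0 < e2 by rewrite !divr_gt0// mulr_gt0.
have [d2 d20 uc2] := uc _ e20.
(* A Lipschitz rate for the remaining terms of the derivative of [k] times [Phi] along the flow,
   with 1 added to make it positive; the step [d] will be small enough for them to cost at most
   e/8. *)
pose BB := 2 * M1 * B1 + M0 * B2 + 1.
have BB0 : 0 < BB by rewrite ltr_wpDl// addr_ge0// mulr_ge0// mulr_ge0.
pose dm := Num.min (2^-1) (Num.min d2 (e / 8 / (La * BB))).
have dm0 : 0 < dm by rewrite !lt_min d20 invr_gt0 ltr0n /= !divr_gt0// mulr_gt0.
have [m m0 dle] : exists2 m : nat, 0 < m%:R :> R & tau / m%:R <= dm.
  exists (Num.bound (tau / dm)).
    by apply: le_lt_trans (archi_boundP _); rewrite divr_ge0 ?ltW.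
  have h : tau / dm < (Num.bound (tau / dm))%:R by rewrite archi_boundP// divr_ge0 ?ltW.
  have h0 : 0 < (Num.bound (tau / dm))%:R :> R by apply: le_lt_trans h; rewrite divr_ge0 ?ltW.
  by rewrite ler_pdivrMr// mulrC -ler_pdivrMr// ltW.
pose d := tau / m%:R.
have d0 : 0 < d by rewrite divr_gt0.
have md : tau = m%:R * d by rewrite /d mulrC divfK// gt_eqF.
have dh : d <= 2^-1 by apply: le_trans dle _; rewrite ge_min lexx.
have dd2 : d <= d2 by apply: le_trans dle _; rewrite !ge_min lexx orbT.
have dB : d * (La * BB) <= e / 8.
  by rewrite -ler_pdivlMr ?mulr_gt0//; apply: le_trans dle _; rewrite !ge_min lexx !orbT.
(* The nodes start at -L-1 and must reach L+1. Rounding the count up adds at most one step, so the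
   covered length lies between 2L+2 and [La] = 2L+3. *)
pose y := (2 * L + 2) / d.
have y0 : 0 <= y by rewrite divr_ge0 ?(ltW d0)// addr_ge0// mulr_ge0.
have /andP[N1 N2] := truncn_itv y0; set N0 := Num.truncn y in N1 N2.
pose N := N0.+1.
have Nd1 : 2 * L + 2 <= N%:R * d by rewrite -ler_pdivrMr// ltW.
have Nd2 : N%:R * d <= La.
  have h : N0%:R * d <= 2 * L + 2 by rewrite -ler_pdivlMr.
  have -> : N%:R * d = N0%:R * d + d by rewrite /N -[N0.+1%:R]natr1 mulrDl mul1r.
  by apply: le_trans (lerD h dh) _; rewrite /La; clear - HA HD HQ cq; lra.
pose s0 : R := - L - 1.
pose s (j : nat) : R := s0 + j%:R * d.
have supp (h : R -> R) : (forall t, h t != 0 -> `|t| <= L) ->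
    forall t, h t != 0 -> s0 + tau <= t <= s0 + N%:R * d - tau.
  move=> hL t /hL; rewrite ler_norml /s0 => /andP[h1 h2].
  by apply/andP; split; move: h1 h2 tauh Nd1; clear - HA HD HQ cq; lra.
pose f x := \sum_(j < N) (d * k (s j)) * Phi (dil (expR (- s j)) x).
have efE x : eu f x = \sum_(j < N) (d * k (s j)) * eu Phi (dil (expR (- s j)) x).
  exact: (eulerR_sum (fun j => d * k (s j)) s N x sP).
have approx (h : R -> R) Mh w x : 0 < q x -> 0 <= w -> 0 <= Mh -> (forall t, h t != 0 -> `|t| <= L) ->
   (forall t, `|h t| <= Mh) -> (forall s t, `|s - t| <= tau -> `|h s - h t| <= w) ->
   `|\sum_(j < N) (d * h (s j)) * Phi (dil (expR (- s j)) x) - h (ln (q x))| <= La * (Mh * e1) + w.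
  move=> qx w0 Mh0 hL hM hw.
  have hi := hat_interpolation tau0 d0 md (ln (q x)) w0 (supp h hL) hw.
  set X := (X in `|X - _| <= _) in hi; set Y := (X in `|X - _| <= _).
  have -> : Y - h (ln (q x)) = (Y - X) + (X - h (ln (q x))) by rewrite addrA subrK.
  apply: le_trans (ler_normD _ _) _; apply: lerD => //.
  rewrite /X /Y -sumrB; apply: le_trans (ler_norm_sum _ _ _) _.
  apply: (@le_trans _ _ (\sum_(j < N) d * (Mh * e1))).
    apply: ler_sum => j _; rewrite -mulrBr normrM [`|d * _|]normrM (gtr0_norm d0) -[leLHS]mulrA.
    apply: ler_wpM2l; first exact: ltW.
    apply: ler_pM => //; have qd : 0 < q (dil (expR (- s j)) x).
      by rewrite (qnorm_dil HQ) ?mulr_gt0 ?expR_gt0.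
    have := PF _ qd; rewrite (qnorm_dil HQ) ?expR_gt0//.
    by rewrite lnM ?posrE ?expR_gt0// expRK [- s j + _]addrC.
  rewrite sumr_const card_ord -mulr_natl mulrA ler_wpM2r//.
  by rewrite mulr_ge0// ltW.
have kl a b : `|k a - k b| <= M1 * `|a - b| by exact: lipschitz_of_derive kD dkM1.
exists f; split.
- have := @smooth_sum _ _ _ _ HA N (fun j x => (d * k (s j)) * Phi (dil (expR (- s j)) x)).
  apply => j; apply: (smoothZ HA).
  by apply: (smooth_dil HL HD) => //; exact: expR_gt0.
- move=> x fx.
  have [j [kj Pj]] : exists j : 'I_N, k (s j) != 0 /\ Phi (dil (expR (- s j)) x) != 0.
    apply: contrapT => H; move/eqP: fx; apply; apply: big1 => j _.
    apply/eqP; apply: contrapT => /negP; rewrite !mulf_eq0 !negb_or => /andP[/andP[_ h1] h2].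
    by apply: H; exists j.
  move: (kL _ kj) (PO _ Pj); rewrite ler_norml => /andP[h1 h2].
  rewrite (qnorm_dil HQ) ?expR_gt0// => /andP[h3 h4].
  apply/andP; split.
    move: h3; rewrite expRN mulrC ltr_pdivlMr ?expR_gt0// -expRD.
    by apply: le_lt_trans; rewrite ler_expR; move: h1 h2; clear - HA HD HQ cq; lra.
  move: h4; rewrite expRN mulrC ltr_pdivrMr ?expR_gt0// -expRD => h4.
  by apply: lt_le_trans h4 _; rewrite ler_expR; move: h1 h2; clear - HA HD HQ cq; lra.
have LM Mh : 0 <= Mh -> Mh <= M0 + M1 -> La * (Mh * e1) <= e / 4.
  move=> Mh0 Mh1; have -> : e / 4 = La * ((M0 + M1 + 1) * e1).
    by rewrite /e1; field; rewrite !gt_eqF.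
  rewrite ler_wpM2l ?(ltW La0)// ler_wpM2r ?(ltW e10)//; move: Mh1; clear - HA HD HQ cq; lra.
move=> x qx; split.
  have tM : 0 <= tau * (M1 + 1) by rewrite mulr_ge0 ?ltW.
  have := approx k M0 (tau * (M1 + 1)) x qx tM M00 kL kM0 _.
  move=> /(_ _)/le_trans; apply.
    move=> a b ab; apply: le_trans (kl a b) _; rewrite mulrC; apply: ler_pM => //.
    by rewrite lerDl.
  have := LM M0 M00; rewrite lerDl => /(_ M10); move: tauM e4; clear - HA HD HQ cq; lra.
pose phi (t : R) := Phi (dil (expR (- t)) x).
pose dphi (t : R) := - eu Phi (dil (expR (- t)) x).
pose g t := k t * phi t; pose dg t := dk t * phi t + k t * dphi t.
have phiD t : is_derive (t : R^o) (1 : R^o) (phi : R^o -> R^o) (dphi t).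
  exact: is_derive_flow.
have gD t : is_derive (t : R^o) (1 : R^o) (g : R^o -> R^o) (dg t).
  apply: is_derive_eq (is_deriveM (kD t) (phiD t)) _.
  by rewrite -![_ *: _]/(_ * _) /dg addrC mulrC [k t * _]mulrC; congr (_ + _); rewrite mulrC.
have dphiD t : is_derive (t : R^o) (1 : R^o) (dphi : R^o -> R^o) (eu (eu Phi) (dil (expR (- t)) x)).
  by have := is_deriveN (is_derive_flow x t tP1.1); rewrite opprK.
have phil a b : `|phi a - phi b| <= B1 * `|a - b|.
  by apply: lipschitz_of_derive phiD _ => t; rewrite normrN.
have dphil a b : `|dphi a - dphi b| <= B2 * `|a - b|.
  by apply: lipschitz_of_derive dphiD _ => t.
have osc a b : `|a - b| <= d -> `|dg a - dg b| <= e2 * B0 + d * (2 * M1 * B1 + M0 * B2).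
  move=> ab.
  have -> : dg a - dg b = (dk a - dk b) * phi a + (dk b * (phi a - phi b) + ((k a - k b) * dphi a +
     k b * (dphi a - dphi b))) by rewrite /dg; ring.
  have -> : e2 * B0 + d * (2 * M1 * B1 + M0 * B2) =
     e2 * B0 + (M1 * (B1 * d) + (M1 * d * B1 + M0 * (B2 * d))) by ring.
  have le1 u v Bu Bv : `|u| <= Bu -> `|v| <= Bv -> `|u * v| <= Bu * Bv.
    by move=> h1 h2; rewrite normrM; apply: ler_pM.
  have ld B u : 0 <= B -> u <= B * `|a - b| -> u <= B * d.
    by move=> Bp h; apply: le_trans h _; rewrite ler_wpM2l.
  apply: le_trans (ler_normD _ _) _; apply: lerD.
    by apply: le1; [apply: uc2; exact: le_trans ab dd2|exact: PB0].
  apply: le_trans (ler_normD _ _) _; apply: lerD.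
    by apply: le1 => //; apply: ld.
  apply: le_trans (ler_normD _ _) _; apply: lerD.
    by apply: le1; [exact: ld|rewrite normrN; exact: PB1].
  by apply: le1 => //; apply: ld.
have knull t : L < `|t| -> k t = 0.
  by move=> h; apply/eqP; apply: contraTT h => /kL; rewrite -leNgt.
have g0 : g s0 = 0.
  by rewrite /g knull ?mul0r// ltr_normr /s0; apply/orP; right; move: L0; clear - HA HD HQ cq; lra.
have gN : g (s0 + N%:R * d) = 0.
  rewrite /g knull ?mul0r// ltr_normr; apply/orP; left; move: Nd1 L0; rewrite /s0; clear - HA HD HQ cq; lra.
have := riemann_sum_derive s0 N (ltW d0) gD osc.
rewrite gN g0 subrr subr0.
have -> : \sum_(j < N) d * dg (s0 + j%:R * d) =
  \sum_(j < N) (d * dk (s j)) * Phi (dil (expR (- s j)) x) - eu f x.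
  rewrite efE -sumrB; apply: eq_bigr => j _; rewrite /dg /phi /dphi -/(s j); ring.
set Z := \sum_(j < N) _ => h.
have w0 : 0 <= e / 4 by exact: ltW.
have := approx dk M1 (e / 4) x qx w0 M10 dkL dkM1 (fun a b ab => uc1 a b (le_trans ab taud)).
rewrite -/Z => h'.
have h2 : N%:R * d * (e2 * B0 + d * (2 * M1 * B1 + M0 * B2)) <= e / 4.
  have b1 : 0 <= 2 * M1 * B1 + M0 * B2 by rewrite addr_ge0// mulr_ge0// mulr_ge0.
  have b2 : 0 <= e2 * B0 + d * (2 * M1 * B1 + M0 * B2).
    by rewrite addr_ge0// mulr_ge0// ltW.
  apply: le_trans (ler_wpM2r b2 Nd2) _.
  have c1 : La * (e2 * (B0 + 1)) = e / 8 by rewrite /e2; field; rewrite !gt_eqF.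
  have c2 : La * (e2 * B0) <= La * (e2 * (B0 + 1)).
    by rewrite ler_wpM2l ?(ltW La0)// ler_wpM2l ?(ltW e20)// lerDl.
  have c3 : La * (d * (2 * M1 * B1 + M0 * B2)) <= d * (La * BB).
    by rewrite mulrCA ler_wpM2l ?(ltW d0)// ler_wpM2l ?(ltW La0)// lerDl.
  rewrite mulrDr; move: c1 c2 c3 dB; clear - HA HD HQ cq; lra.
have -> : eu f x - dk (ln (q x)) = - (Z - eu f x) + (Z - dk (ln (q x))) by ring.
apply: le_trans (ler_normD _ _) _; rewrite normrN.
have := LM M1 M10; rewrite lerDr => /(_ M00); move: h h' h2 e4; clear - HA HD HQ cq; lra.
Qed.

End RadialApproximation.

(** * Uniform continuity and a C^1 truncation *)

Section Truncation.
Context {R : realType}.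

Lemma continuous_supp_uniform (f : R -> R) (L e : R) : continuous (f : R^o -> R^o) ->
  (forall t, f t != 0 -> `|t| <= L) -> 0 < e ->
  exists2 d, 0 < d & forall s t, `|s - t| <= d -> `|f s - f t| <= e.
Proof.
move=> cf fL e0; have e20 : 0 < e / 2 by rewrite divr_gt0.
have : forall x : R, exists r, 0 < r /\ forall y, `|y - x| < 2 * r -> `|f y - f x| < e / 2.
  move=> x; have /cvgrPdist_lt/(_ _ e20)/nbhs_ballP[r /= r0 rf] := cf x.
  exists (r / 2); split; first by rewrite divr_gt0.
  move=> y; have -> : 2 * (r / 2) = r by field.
  by move=> yx; rewrite distrC; apply: rf; rewrite /ball /= distrC.
move=> /choice[r rP].
pose K : set R := `[- L, L]%classic.
have : cover_compact (K : set R^o) by rewrite -compact_cover; exact: segment_compact.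
move=> /(_ R^o K (fun x => [set y : R^o | `|y - x| < r x])); case.
- move=> x _.
  have cx : continuous (fun y : R^o => `|y - x| : R^o).
    move=> y; apply: (@continuous_comp _ _ _ (fun y : R^o => y - x : R^o) (Num.Def.normr : R^o -> R^o)).
      by apply: (@cvgB _ R^o); [exact: cvg_id|exact: cvg_cst].
    exact: norm_continuous.
  apply: (@open_comp _ _ (fun y : R^o => `|y - x| : R^o) [set z : R^o | z < r x]); last exact: open_lt.
  by move=> y _; exact: cx.
- by move=> x Kx; exists x => //=; rewrite subrr normr0; exact: (rP x).1.
move=> D _ KD.
have [d d0 dr] : exists2 d, 0 < d & forall x, x \in finmap.enum_fset D -> d <= r x.
  elim: (finmap.enum_fset D) => [|x s [d d0 dr]]; first by exists 1.
  exists (Num.min d (r x)); first by rewrite lt_min d0 (rP x).1.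
  move=> y; rewrite inE => /orP[/eqP->|/dr h]; first by rewrite ge_min lexx orbT.
  by rewrite ge_min h.
exists d => // s t; wlog Ks : s t / f s != 0.
  move=> H st; have [s0|/H] := eqVneq (f s) 0; last exact.
  have [t0|/H ht] := eqVneq (f t) 0; first by rewrite s0 t0 subrr normr0 ltW.
  by rewrite distrC; apply: ht; rewrite distrC.
move=> st; have Ks' : K s by move/fL : Ks; rewrite ler_norml /K /= in_itv.
have [x /= xD sx] := KD _ Ks'.
have [r0 rf] := rP x.
have h1 : `|f s - f x| < e / 2 by apply: rf; apply: lt_trans sx _; rewrite ltr_pMl// ltr1n.
have h2 : `|f t - f x| < e / 2.
  apply: rf; have -> : t - x = (t - s) + (s - x) by ring.
  apply: le_lt_trans (ler_normD _ _) _; rewrite mulr_natl mulr2n ler_ltD// distrC.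
  exact: le_trans (dr _ xD).
have -> : f s - f t = (f s - f x) - (f t - f x) by ring.
apply: le_trans (ler_normB _ _) _; rewrite ltW//.
by have -> : e = e / 2 + e / 2 by [field]; exact: ltrD.
Qed.

Definition posp (x : R) : R := Num.max 0 x.

Lemma posp_ge0 x : 0 <= posp x. Proof. by rewrite le_max lexx. Qed.
Lemma posp_le x y : x <= y -> posp x <= posp y.
Proof. by move=> xy; rewrite /posp ge_max !le_max lexx xy orbT. Qed.
Lemma posp0 x : x <= 0 -> posp x = 0. Proof. by move/max_idPl. Qed.
Lemma pospE x : 0 <= x -> posp x = x. Proof. by move/max_idPr. Qed.

Lemma posp_continuous : continuous (posp : R^o -> R^o).
Proof.
move=> t; have c0 : {for t, continuous (fun=> 0 : R^o)} by exact: cvg_cst.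
by apply: (continuous_max c0); exact: cvg_id.
Qed.

Lemma is_derive_posp2 (x : R) :
  is_derive (x : R^o) (1 : R^o) (fun x : R^o => posp x ^+ 2 : R^o) (2 * posp x).
Proof.
have [x0|x0|x0] := ltgtP x 0.
- rewrite posp0 ?mulr0 1?ltW//; apply: (@near_eq_is_derive _ _ _ (cst (0 : R^o))).
  by near=> y; rewrite /= posp0 ?expr0n//; apply: ltW; near: y; exact: lt_nbhsl.
- rewrite pospE 1?ltW//; apply: (@near_eq_is_derive _ _ _ (fun x : R^o => x ^+ 2 : R^o)).
    by near=> y; rewrite /= pospE//; apply: ltW; near: y; exact: lt_nbhsr.
  apply: is_derive_eq (is_deriveX 2 (is_derive_id (x : R^o) (1 : R^o))) _.
  by rewrite -[_ *: _]/(_ * _) mulr1 expr1 mulr_natl.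
have H : (fun h : R => h^-1 *: (((fun x : R^o => posp x ^+ 2 : R^o) \o shift (0 : R^o)) (h *: (1 : R^o)) - posp 0 ^+ 2) : R^o)
    @ 0^' --> (0 : R^o).
  apply/cvgrPdist_le => e e0; near=> h.
  have h0 : h != 0 by near: h; exact: nbhs_dnbhs_neq.
  have he : `|h| <= e by near: h; exact: dnbhs0_le.
  rewrite sub0r normrN /= addr0 [posp 0]posp0// expr0n subr0 -![_ *: _]/(_ * _) mulr1.
  apply: le_trans he; have [hn|hp] := leP h 0; first by rewrite posp0// expr0n mulr0 normr0.
  by rewrite pospE ?(ltW hp)// expr2 mulKf.
rewrite x0 posp0// mulr0; split; last exact: cvg_lim H.
by apply/cvg_ex; exists 0.
Unshelve. all: by end_near. Qed.

Variable e : R.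
Hypothesis e0 : 0 < e.

(* A continuously differentiable substitute for [posp (s - e)]. *)
Definition trunc_fun (s : R) : R := posp (s - e) ^+ 2 / s.
Definition dtrunc_fun (s : R) : R := 2 * posp (s - e) / s - (posp (s - e) / s) ^+ 2.

Lemma is_derive_trunc (s : R) : 0 < s ->
  is_derive (s : R^o) (1 : R^o) (trunc_fun : R^o -> R^o) (dtrunc_fun s).
Proof.
move=> s0.
have d1 : is_derive (s : R^o) (1 : R^o) (fun s : R^o => s - e : R^o) (1 : R).
  by apply: is_derive_eq (is_deriveB (is_derive_id _ _) (is_derive_cst _ _ _)) _; rewrite subr0.
have d2 := @is_derive1_comp R (fun x : R^o => posp x ^+ 2 : R^o) (fun s : R^o => s - e : R^o) s _ _ (is_derive_posp2 (s - e)) d1.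
have sn : (id : R^o -> R^o) s != 0 by rewrite gt_eqF.
have d3 := is_deriveV sn (is_derive_id (s : R^o) (1 : R^o)).
apply: is_derive_eq (is_deriveM d2 d3) _.
by rewrite /dtrunc_fun /= -![_ *: _]/(_ * _); field; rewrite gt_eqF.
Qed.

Lemma dtrunc_continuous (s : R) : 0 < s -> {for s, continuous (dtrunc_fun : R^o -> R^o)}.
Proof.
move=> s0.
have c1 : {for s, continuous (fun s : R^o => posp (s - e) : R^o)}.
  apply: (@continuous_comp _ _ _ (fun s : R^o => s - e : R^o) (posp : R^o -> R^o)).
    by apply: (@cvgB _ R^o); [exact: cvg_id|exact: cvg_cst].
  exact: posp_continuous.
have c2 : {for s, continuous (fun s : R^o => s^-1 : R^o)}.
  by apply: cvgV; [rewrite gt_eqF|exact: cvg_id].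
apply: (@cvgB _ R^o).
  by apply: (@cvgM R R^o); [apply: (@cvgMl_tmp R R^o); exact: c1|exact: c2].
by apply: (@cvgM R R^o); apply: (@cvgM R R^o); by [exact: c1|exact: c2].
Qed.

Lemma trunc_ge0 s : 0 < s -> 0 <= trunc_fun s.
Proof. by move=> s0; rewrite divr_ge0 ?sqr_ge0 ?(ltW s0). Qed.

Lemma posp_sub_le s : 0 < s -> posp (s - e) <= s.
Proof. by move=> s0; rewrite ge_max (ltW s0) /= gerBl ltW. Qed.

Lemma trunc_le s : 0 < s -> trunc_fun s <= s.
Proof.
move=> s0; rewrite ler_pdivrMr// -expr2 lerXn2r ?nnegrE ?posp_ge0 ?(ltW s0)//.
exact: posp_sub_le.
Qed.

(** With z = posp(s-e)/s in [0,1] the derivative is 1 - (1-z)^2. Together with [trunc_le] this makes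
    truncation lower both terms of the energy density, so that no limit of energies has to be
    computed. *)
Lemma dtrunc_bound s : 0 < s -> `|dtrunc_fun s| <= 1.
Proof.
move=> s0; rewrite /dtrunc_fun; set z := posp (s - e) / s.
have -> : 2 * posp (s - e) / s = 2 * z by rewrite /z mulrA.
have z0 : 0 <= z by rewrite divr_ge0 ?posp_ge0 ?(ltW s0).
have z1 : z <= 1 by rewrite ler_pdivrMr// mul1r posp_sub_le.
have -> : 2 * z - z ^+ 2 = 1 - (1 - z) ^+ 2 by ring.
have s1 : (1 - z) ^+ 2 <= 1.
  rewrite -[leRHS](expr1n _ 2).
  by rewrite lerXn2r ?nnegrE ?subr_ge0// gerBl.
have s2 : 0 <= (1 - z) ^+ 2 by exact: sqr_ge0.
by rewrite ler_norml; apply/andP; split; move: s1 s2; lra.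
Qed.

Lemma trunc_eq0 s : s <= e -> trunc_fun s = 0.
Proof. by move=> se; rewrite /trunc_fun posp0 ?subr_le0// expr0n mul0r. Qed.

Lemma dtrunc_eq0 s : s <= e -> dtrunc_fun s = 0.
Proof. by move=> se; rewrite /dtrunc_fun posp0 ?subr_le0// mulr0 !mul0r expr0n subrr. Qed.

End Truncation.

(** * The extremal profile *)

Section ExtremalProfile.
Context {R : realType}.
Local Notation leb := (@lebesgue_measure R).
Local Notation pos := (`]0%R, +oo[%classic : set R).
Variables (a kap : R).
Hypotheses (a0 : 0 < a) (kap0 : 0 < kap).
Let Q := 2 * (a + 1).
Let delta := Q ^+ 2 / 4 - kap ^+ 2.
Let b := kap / a.
Let b0 : 0 < b. Proof. by rewrite divr_gt0. Qed.
Let u r := r `^ (2 * b).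
Let u0 r : 0 < r -> 0 < u r. Proof. exact: powR_gt0. Qed.
Let Z r := sech2_ln (u r).
Let T r := tanh_ln (u r).

(* [extremal (e^t)] is [sech(b t)^a]. *)
Definition extremal (r : R) : R := sech2_ln (r `^ (2 * (kap / a))) `^ (a / 2).
Let h := extremal.

Let Z0 r : 0 < r -> 0 < Z r. Proof. by move=> /u0/sech2_ln_gt0. Qed.
Lemma extremal_gt0 r : 0 < r -> 0 < h r. Proof. by move=> /Z0; exact: powR_gt0. Qed.

Let ZT r : 0 < r -> 1 - Z r = T r ^+ 2. Proof. by move=> /u0; exact: sech2_ln_tanh_ln. Qed.

Let Du r : 0 < r -> is_derive (r : R^o) (1 : R^o) (u : R^o -> R^o) (2 * b * u r / r).
Proof.
move=> r0; apply: is_derive_eq (is_derive_powR (2 * b) r0) _.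
by rewrite /u (powR_pred (2 * b) r0); field; rewrite gt_eqF.
Qed.

Let DZ r : 0 < r -> is_derive (r : R^o) (1 : R^o) (Z : R^o -> R^o) (- 2 * b * T r * Z r / r).
Proof.
move=> r0; have ur := u0 r0.
apply: is_derive_eq (@is_derive1_comp R (sech2_ln : R^o -> R^o) (u : R^o -> R^o) r _ _ (is_derive_sech2_ln ur) (Du r0)) _.
by rewrite -/(Z r) -/(T r); field; rewrite !gt_eqF.
Qed.

Let DT r : 0 < r -> is_derive (r : R^o) (1 : R^o) (T : R^o -> R^o) (b * Z r / r).
Proof.
move=> r0; have ur := u0 r0.
apply: is_derive_eq (@is_derive1_comp R (tanh_ln : R^o -> R^o) (u : R^o -> R^o) r _ _ (is_derive_tanh_ln ur) (Du r0)) _.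
by rewrite -/(Z r); field; rewrite !gt_eqF.
Qed.

Let dh r := - (a * b) * T r * h r / r.

Let Dh r : 0 < r -> is_derive (r : R^o) (1 : R^o) (h : R^o -> R^o) (dh r).
Proof.
move=> r0; have zr := Z0 r0.
apply: is_derive_eq (@is_derive1_comp R (fun x : R^o => x `^ (a / 2) : R^o) (Z : R^o -> R^o) r _ _ (is_derive_powR (a / 2) zr) (DZ r0)) _.
rewrite /dh /h /extremal -/b -/(u r) -/(Z r) (powR_pred (a / 2) zr).
by field; rewrite gt_eqF.
Qed.

Let T_cont r : 0 < r -> {for r, continuous (T : R^o -> R^o)}.
Proof. by move=> /DT/derive_continuous. Qed.
Let h_cont r : 0 < r -> {for r, continuous (h : R^o -> R^o)}.
Proof. by move=> /Dh/derive_continuous. Qed.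
Let Z_cont r : 0 < r -> {for r, continuous (Z : R^o -> R^o)}.
Proof. by move=> /DZ/derive_continuous. Qed.
Let inv_cont r : 0 < r -> {for r, continuous (fun r : R^o => r^-1 : R^o)}.
Proof. by move=> r0; apply: cvgV; [rewrite gt_eqF|exact: cvg_id]. Qed.

Let h2 r : 0 < r -> h r ^+ 2 = Z r `^ a.
Proof.
move=> r0; rewrite /h /extremal -/b -/(u r) -/(Z r) -powR_mulrn ?powR_ge0// -powRrM.
by congr (_ `^ _); field.
Qed.

Let P r := Z r `^ (a + 1) / r.

Let PE r : 0 < r -> P r = h r ^+ 2 * Z r / r.
Proof.
move=> r0; rewrite /P h2// powRD ?(gt_eqF (Z0 r0)) ?implybT//.
by rewrite powRr1// ltW// Z0.
Qed.

Lemma extremal_powR r : 0 < r -> h r `^ (2 * (1 + a^-1)) / r = P r.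
Proof.
move=> r0; rewrite /h /extremal -/b -/(u r) -/(Z r) -powRrM; congr (_ `^ _ / _).
by field; rewrite gt_eqF.
Qed.

(** The substitution u = r^(2b) turns the integral of [sech_kernel] into [b] times this one. *)
Lemma extremal_integral : (\int[leb]_(r in pos) (P r)%:E = (beta_const a / b)%:E)%E.
Proof.
have bn : b != 0 by rewrite gt_eqF.
have cj v : 0 < v -> {for v, continuous (sech_kernel a : R^o -> R^o)}.
  move=> v0; apply: (@cvgM R R^o).
    apply: (@continuous_comp _ _ _ (sech2_ln : R^o -> R^o) (fun x : R^o => x `^ (a + 1) : R^o)).
      exact: sech2_ln_continuous.
    by apply: powR_cont; exact: sech2_ln_gt0.
  by apply: cvgV; [rewrite gt_eqF// mulr_gt0|apply: (@cvgMl_tmp R R^o); exact: cvg_id].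
have j0 v : 0 < v -> 0 <= sech_kernel a v.
  by move=> v0; rewrite divr_ge0 ?powR_ge0// mulr_ge0// ltW.
have b20 : 0 < 2 * b by rewrite mulr_gt0.
have cP r : 0 < r -> {for r, continuous (P : R^o -> R^o)}.
  move=> r0; apply: (@cvgM R R^o); last exact: inv_cont.
  apply: (@continuous_comp _ _ _ (Z : R^o -> R^o) (fun x : R^o => x `^ (a + 1) : R^o)).
    exact: Z_cont.
  by apply: powR_cont; exact: Z0.
have := subst_powR ltr01 b20 cj j0; rewrite sech_kernel_int//.
have -> : (\int[leb]_(r in pos) (sech_kernel a (1 * r `^ (2 * b)) * (1 * (2 * b * r `^ (2 * b - 1))))%:E =
   \int[leb]_(r in pos) (b%:E * (P r)%:E))%E.
  apply: eq_integral => r; rewrite inE /= in_itv /= andbT => r0; rewrite -EFinM; congr EFin.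
  rewrite !mul1r /sech_kernel /P /Z /u {2}(powR_pred (2 * b) r0).
  by field; rewrite !gt_eqF ?powR_gt0.
rewrite ge0_integralZl_EFin; last first.
- exact: ltW.
- by apply/measurable_EFinP; apply: pos_measurable; exact: cP.
- by move=> r; rewrite /= in_itv /= andbT => r0; rewrite lee_fin divr_ge0 ?powR_ge0// ltW.
- exact: measurable_itv.
case: (\int[leb]_(r in pos) (P r)%:E)%E => [x|/esym|/esym].
- by move=> [->]; rewrite mulrAC mulfV ?mul1r.
- by rewrite gt0_muley ?lte_fin.
- by rewrite gt0_muleNy ?lte_fin.
Qed.

Let P_cont r : 0 < r -> {for r, continuous (P : R^o -> R^o)}.
Proof.
move=> r0; apply: (@cvgM R R^o); last exact: inv_cont.
apply: (@continuous_comp _ _ _ (Z : R^o -> R^o) (fun x : R^o => x `^ (a + 1) : R^o)).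
  exact: Z_cont.
by apply: powR_cont; exact: Z0.
Qed.

Lemma extremal_integrable : leb.-integrable pos (EFin \o P).
Proof.
apply/integrableP; split.
  by apply/measurable_EFinP; apply: pos_measurable; exact: P_cont.
have -> : (\int[leb]_(r in pos) `|(EFin \o P) r| = \int[leb]_(r in pos) (P r)%:E)%E.
  apply: eq_integral => r; rewrite inE /= in_itv /= andbT => r0.
  by rewrite ger0_norm// divr_ge0 ?powR_ge0// ltW.
by rewrite extremal_integral ltry.
Qed.

Let cvgZ (x : nat -> R) : (forall n, 0 < x n) -> (fun n => Z (x n) : R^o) @ \oo --> (0 : R^o) ->
  (fun n => h (x n) ^+ 2 : R^o) @ \oo --> (0 : R^o).
Proof.
move=> x0 zc.
have := @normpowR_cont R a 0 a0; rewrite /prop_for /continuous_at normr0 powR0 ?gt_eqF// => ch.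
have := cvg_comp _ _ zc ch; apply: cvg_trans; apply: near_eq_cvg; apply: nearW => n /=.
by rewrite h2// ger0_norm// ltW// Z0.
Qed.

Let cvgy (y : R^o) : (fun n => (n.+1%:R^-1 : R) `^ (2 * b) : R^o) @ \oo --> (0 : R^o).
Proof.
have b20 : 0 < 2 * b by rewrite mulr_gt0.
have := @normpowR_cont R (2 * b) 0 b20; rewrite /prop_for /continuous_at normr0 powR0 ?gt_eqF// => ch.
have := cvg_comp _ _ (@cvg_harmonic R) ch; apply: cvg_trans; apply: near_eq_cvg; apply: nearW => n /=.
by rewrite ger0_norm.
Qed.

Let Z_squeeze (x : nat -> R) : (forall n, 0 < x n) ->
  (forall n, Z (x n) <= 4 * (n.+1%:R^-1 : R) `^ (2 * b)) -> (fun n => Z (x n) : R^o) @ \oo --> (0 : R^o).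
Proof.
move=> x0 le.
have c4 : (fun n => 4 * (n.+1%:R^-1 : R) `^ (2 * b) : R^o) @ \oo --> (0 : R^o).
  by rewrite -[X in _ --> X](mulr0 4); apply: (@cvgMl_tmp R nat); exact: (cvgy 0).
apply/cvgrPdist_le => e e0; move/cvgrPdist_le : c4 => /(_ _ e0); apply: filterS => n.
rewrite !sub0r !normrN ger0_norm; last by rewrite mulr_ge0 ?powR_ge0.
by rewrite ger0_norm ?(ltW (Z0 (x0 n)))//; exact: le_trans.
Qed.

Let h2_at0 : (fun n => h n.+1%:R^-1 ^+ 2 : R^o) @ \oo --> (0 : R^o).
Proof.
have x0 n : 0 < n.+1%:R^-1 :> R by rewrite invr_gt0.
by apply: (cvgZ x0); apply: (Z_squeeze x0) => n; exact: (sech2_ln_le (u0 (x0 n))).1.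
Qed.

Let h2_aty : (fun n => h n.+1%:R ^+ 2 : R^o) @ \oo --> (0 : R^o).
Proof.
have x0 n : 0 < n.+1%:R :> R by [].
apply: (cvgZ x0); apply: (Z_squeeze x0) => n.
have := (sech2_ln_le (u0 (x0 n))).2; rewrite -/(Z _) /u => /le_trans; apply.
by rewrite -[X in _ <= _ * X `^ _]powR_inv1// -powRrM mulN1r powRN.
Qed.

Section Truncated.
Variable e : R.
Hypothesis e0 : 0 < e.

Let H r := trunc_fun e (h r).
Let dH r := dtrunc_fun e (h r) * dh r.

Let DH r : 0 < r -> is_derive (r : R^o) (1 : R^o) (H : R^o -> R^o) (dH r).
Proof.
move=> r0; exact: (@is_derive1_comp R (trunc_fun e : R^o -> R^o) (h : R^o -> R^o) r _ _
  (is_derive_trunc e (extremal_gt0 r0)) (Dh r0)).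
Qed.

Let cdh r : 0 < r -> {for r, continuous (dh : R^o -> R^o)}.
Proof.
move=> r0; apply: (@cvgM R R^o); last exact: inv_cont.
apply: (@cvgM R R^o); last exact: h_cont.
by apply: (@cvgMl_tmp R R^o); exact: T_cont.
Qed.

Let cH r : 0 < r -> {for r, continuous (H : R^o -> R^o)}.
Proof. by move=> /DH/derive_continuous. Qed.

Let cdH r : 0 < r -> {for r, continuous (dH : R^o -> R^o)}.
Proof.
move=> r0; apply: (@cvgM R R^o); last exact: cdh.
apply: (@continuous_comp _ _ _ (h : R^o -> R^o) (dtrunc_fun e : R^o -> R^o)).
  exact: h_cont.
by apply: dtrunc_continuous; exact: extremal_gt0.
Qed.

(** With t = ln r this is r^(-Q/2) times the truncated extremal function, since a+1 = Q/2: the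
    radial function on the group whose rescaled profile is the truncation. *)
Definition profile (t : R) : R := expR (- (a + 1) * t) * trunc_fun e (extremal (expR t)).
Definition dprofile (t : R) : R :=
  expR (- (a + 1) * t) * (expR t * dH (expR t) - (a + 1) * trunc_fun e (extremal (expR t))).

Lemma is_derive_profile t :
  is_derive (t : R^o) (1 : R^o) (profile : R^o -> R^o) (dprofile t).
Proof.
have d1 : is_derive (t : R^o) (1 : R^o) (fun t : R^o => - (a + 1) * t : R^o) (- (a + 1)).
  by apply: is_derive_eq (is_deriveZ (- (a + 1)) (is_derive_id _ _)) _; rewrite [LHS]mulr1.
have d2 := @is_derive1_comp R expR (fun t : R^o => - (a + 1) * t : R^o) t _ _ (is_derive_expR _) d1.
have d3 := @is_derive1_comp R (H : R^o -> R^o) expR t _ _ (DH (expR_gt0 t)) (is_derive_expR t).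
apply: is_derive_eq (is_deriveM d2 d3) _.
by rewrite -![_ *: _]/(_ * _) /dprofile /= /H; ring.
Qed.

Lemma dprofile_continuous : continuous (dprofile : R^o -> R^o).
Proof.
move=> t; have ce : {for t, continuous (expR : R^o -> R^o)} by exact: continuous_expR.
apply: (@cvgM R R^o).
  apply: (@continuous_comp _ _ _ (fun t : R^o => - (a + 1) * t : R^o) (expR : R^o -> R^o)).
    by apply: (@cvgMl_tmp R R^o); exact: cvg_id.
  exact: continuous_expR.
apply: (@cvgB _ R^o).
  apply: (@cvgM R R^o); first exact: ce.
  apply: (@continuous_comp _ _ _ (expR : R^o -> R^o) (dH : R^o -> R^o)); first exact: ce.
  by apply: cdH; exact: expR_gt0.
apply: (@cvgMl_tmp R R^o).
apply: (@continuous_comp _ _ _ (expR : R^o -> R^o) (H : R^o -> R^o)); first exact: ce.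
by apply: cH; exact: expR_gt0.
Qed.

(** Where the truncation is active, sech^2 exceeds a positive constant, while it is at most 4u and
    at most 4/u; this bounds u = e^(2bt) from both sides. *)
Lemma profile_supp : exists2 L, 0 <= L &
  forall t, profile t != 0 \/ dprofile t != 0 -> `|t| <= L.
Proof.
pose c := ln (e `^ (2 / a) / 4) / (2 * b).
have b20 : 0 < 2 * b by rewrite mulr_gt0.
exists `|c| => // t nz.
have he : e < h (expR t).
  rewrite ltNge; apply/negP => le; case: nz => /eqP; apply.
    by rewrite /profile trunc_eq0 ?mulr0.
  by rewrite /dprofile /dH trunc_eq0// dtrunc_eq0// mul0r !mulr0 subrr mulr0.
have uE : u (expR t) = expR (2 * b * t) by rewrite /u -expRM mulrC.
have [z1 z2] := sech2_ln_le (u0 (expR_gt0 t)).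
have ez : e `^ (2 / a) < Z (expR t).
  have -> : Z (expR t) = h (expR t) `^ (2 / a).
    rewrite /h /extremal -/b -/(u _) -/(Z _) -powRrM.
    have -> : a / 2 * (2 / a) = 1 by field; rewrite gt_eqF.
    by rewrite powRr1// ltW// Z0// expR_gt0.
  by rewrite gt0_ltr_powR ?divr_gt0// nnegrE ltW// extremal_gt0// expR_gt0.
have e40 : 0 < e `^ (2 / a) / 4 by rewrite divr_gt0// powR_gt0.
have c1 : c <= t.
  rewrite ler_pdivrMr// [t * _]mulrC -(expRK (2 * b * t)) ler_ln ?posrE ?expR_gt0//.
  by rewrite ler_pdivrMr// [_ * 4]mulrC -uE (le_trans (ltW ez)).
have c2 : c <= - t.
  rewrite ler_pdivrMr// mulNr [t * _]mulrC -(expRK (- (2 * b * t))) ler_ln ?posrE ?expR_gt0//.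
  by rewrite ler_pdivrMr// [_ * 4]mulrC expRN -uE (le_trans (ltW ez)).
have c3 : - c <= `|c| by rewrite -normrN ler_norm.
by apply: le_trans c3; rewrite ler_norml opprK c1 /= lerNr.
Qed.

Let Q2 : Q / 2 = a + 1. Proof. by rewrite /Q; field. Qed.

Let expQ r : 0 < r -> expR (- (a + 1) * ln r) ^+ 2 * r `^ (Q - 1) = r^-1.
Proof.
move=> r0; have -> : expR (- (a + 1) * ln r) = r `^ (- (a + 1)).
  by rewrite /powR gt_eqF.
rewrite -powR_mulrn ?powR_ge0// -powRrM -powRD ?(gt_eqF r0) ?implybT//.
rewrite -powR_inv1 ?ltW//; congr (_ `^ _); rewrite /Q; ring.
Qed.

(** The last term is the derivative of (Q/2) H^2; it disappears on integration. *)
Let energyE r : 0 < r -> (dprofile (ln r) ^+ 2 - delta * profile (ln r) ^+ 2) * r `^ (Q - 1) =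
  (r * dH r ^+ 2 + kap ^+ 2 * H r ^+ 2 / r) - (a + 1) * (2 * H r * dH r).
Proof.
move=> r0; rewrite /dprofile /profile lnK ?posrE// -/(H r).
have := expQ r0; set x := expR _; set y := r `^ _ => xy.
have -> : ((x * (r * dH r - (a + 1) * H r)) ^+ 2 - delta * (x * H r) ^+ 2) * y =
   (x ^+ 2 * y) * ((r * dH r - (a + 1) * H r) ^+ 2 - delta * H r ^+ 2) by ring.
by rewrite xy /delta /Q; field; rewrite gt_eqF.
Qed.

Lemma profile_energy_integrable :
  leb.-integrable pos (EFin \o (fun r => (dprofile (ln r) ^+ 2 - delta * profile (ln r) ^+ 2) * r `^ (Q - 1))).
Proof.
have [L L0 Ls] := profile_supp.
have cp : continuous (profile : R^o -> R^o) by move=> t; exact: derive_continuous (is_derive_profile t).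
have cd := dprofile_continuous.
pose g t := dprofile t ^+ 2 - delta * profile t ^+ 2.
have cg : continuous (g : R^o -> R^o).
  move=> t; apply: (@cvgB _ R^o); first by apply: (@cvgM R R^o); exact: cd.
  by apply: (@cvgMl_tmp R R^o); apply: (@cvgM R R^o); exact: cp.
have gs t : g t != 0 -> `|t| <= L.
  move=> gt; apply: Ls; apply: contrapT => H0; move/eqP : gt; apply; rewrite /g.
  have [p0|p0] := eqVneq (profile t) 0; last by case: H0; left.
  have [q0|q0] := eqVneq (dprofile t) 0; last by case: H0; right.
  by rewrite p0 q0 expr0n mulr0 subrr.
have gK t : g t != 0 -> (`[- L, L]%classic : set R^o) t by move=> /gs; rewrite ler_norml /= in_itv.
have [C C0 gC] := compact_bounded_fun cg (@segment_compact R (- L) L) gK.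
have Q10 : 0 <= Q - 1 by rewrite /Q; move: a0; lra.
apply: (@pos_integrable_bounded _ _ (expR L) (C * expR L `^ (Q - 1))).
- apply: pos_measurable => r r0; apply: (@cvgM R R^o); last exact: powR_cont.
  apply: (@continuous_comp _ _ _ (@ln R : R^o -> R^o) (g : R^o -> R^o)); last exact: cg.
  exact: continuous_ln.
- move=> r r0; rewrite -/(g _); have [->|/gs] := eqVneq (g (ln r)) 0.
    by rewrite mul0r normr0 mulr_ge0 ?powR_ge0.
  rewrite ler_norml => /andP[_ rL]; rewrite normrM; apply: ler_pM => //.
  rewrite ger0_norm ?powR_ge0// ge0_ler_powR ?nnegrE ?expR_ge0// ?(ltW r0)//.
  by rewrite -[r]lnK ?posrE// ler_expR.
- move=> r r0 rL; rewrite -/(g _); have [->|/gs] := eqVneq (g (ln r)) 0; first by rewrite mul0r.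
  rewrite ler_norml => /andP[_]; rewrite leNgt => /negP[].
  by rewrite -[L]expRK ltr_ln ?posrE ?expR_gt0.
Qed.

(** For the untruncated [h] the density r h'^2 + kap^2 h^2/r equals [c * P] minus the derivative of
    a b h^2 T, and truncation only lowers the density. [W] collects both exact terms, and it
    vanishes at the two ends because it is bounded by a multiple of h^2. *)
Lemma profile_energy_le :
  (\int[leb]_(r in pos) ((dprofile (ln r) ^+ 2 - delta * profile (ln r) ^+ 2) * r `^ (Q - 1))%:E <=
   (a * (a + 1) * b ^+ 2 * (beta_const a / b))%:E)%E.
Proof.
pose g r := (dprofile (ln r) ^+ 2 - delta * profile (ln r) ^+ 2) * r `^ (Q - 1).
pose c := a * (a + 1) * b ^+ 2.
have mP : measurable (pos : set (measurableTypeR R)) by exact: measurable_itv.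
have icP := integrableZl mP c extremal_integrable.
have iD : leb.-integrable pos (EFin \o (fun r => c * P r - g r)).
  have := integrableB mP icP profile_energy_integrable.
  by apply: eq_integrable.
pose W r := (a + 1) * H r ^+ 2 + a * b * (h r ^+ 2 * T r).
pose dW r := (a + 1) * (2 * H r * dH r) + a * b * (h r ^+ 2 * (b * Z r / r) + T r * (2 * h r * dh r)).
have DW r : 0 < r -> is_derive (r : R^o) (1 : R^o) (W : R^o -> R^o) (dW r).
  move=> r0.
  have d1 := is_deriveZ (a + 1) (is_deriveX 2 (DH r0)).
  have d2 := is_deriveZ (a * b) (is_deriveM (is_deriveX 2 (Dh r0)) (DT r0)).
  apply: is_derive_eq (is_deriveD d1 d2) _.
  by rewrite -![_ *: _]/(_ * _) /dW !expr1 !mulr_natl.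
have cW r : 0 < r -> {for r, continuous (dW : R^o -> R^o)}.
  move=> r0; have c1 := cH r0; have c2 := cdH r0; have c3 := h_cont r0.
  have c4 := Z_cont r0; have c5 := T_cont r0; have c6 := cdh r0; have c7 := inv_cont r0.
  apply: (@cvgD _ R^o); apply: (@cvgMl_tmp R R^o).
    by apply: (@cvgM R R^o) => //; apply: (@cvgMl_tmp R R^o).
  apply: (@cvgD _ R^o).
    apply: (@cvgM R R^o); first by apply: (@cvgM R R^o).
    by apply: (@cvgM R R^o) => //; apply: (@cvgMl_tmp R R^o).
  apply: (@cvgM R R^o) => //; apply: (@cvgM R R^o) => //.
  by apply: (@cvgMl_tmp R R^o).
have le r : 0 < r -> dW r <= c * P r - g r.
  move=> r0; rewrite /g energyE// PE//.
  have hr := extremal_gt0 r0; have zr := Z0 r0.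
  have H1 : r * dH r ^+ 2 <= r * dh r ^+ 2.
    rewrite ler_wpM2l ?(ltW r0)// /dH exprMn ler_piMl ?sqr_ge0//.
    rewrite -[dtrunc_fun _ _ ^+ 2]real_normK ?num_real// -[leRHS](expr1n _ 2).
    by rewrite lerXn2r ?nnegrE// dtrunc_bound.
  have H2 : kap ^+ 2 * H r ^+ 2 / r <= kap ^+ 2 * h r ^+ 2 / r.
    rewrite ler_wpM2r ?invr_ge0 ?(ltW r0)// ler_wpM2l ?sqr_ge0//.
    by rewrite lerXn2r ?nnegrE ?trunc_ge0 ?trunc_le// ltW.
  have E : r * dh r ^+ 2 + kap ^+ 2 * h r ^+ 2 / r =
      c * (h r ^+ 2 * Z r / r) - a * b * (h r ^+ 2 * (b * Z r / r) + T r * (2 * h r * dh r)).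
    have kE : kap = a * b by rewrite /b mulrC divfK// gt_eqF.
    have zE : Z r = 1 - T r ^+ 2 by rewrite -ZT// opprB addrC subrK.
    rewrite /dh kE /c zE; move: (T r) (h r) b => x y z.
    by field; rewrite gt_eqF.
  move: H1 H2 E; rewrite /dW; move: (r * dH r ^+ 2) (r * dh r ^+ 2) (kap ^+ 2 * H r ^+ 2 / r)
    (kap ^+ 2 * h r ^+ 2 / r) (c * _) (a * b * _) ((a + 1) * _) => *; lra.
have HW r : 0 < r -> `|W r| <= (a + 1 + a * b) * h r ^+ 2.
  move=> r0; have hr := extremal_gt0 r0; rewrite mulrDl.
  apply: le_trans (ler_normD _ _) _; apply: lerD.
    rewrite normrM (gtr0_norm (_ : 0 < a + 1)) ?addr_gt0// ler_wpM2l ?addr_ge0 ?(ltW a0)//.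
    rewrite ger0_norm ?sqr_ge0//.
    by rewrite lerXn2r ?nnegrE ?trunc_ge0 ?trunc_le// ltW.
  have ab0 : 0 < a * b by exact: mulr_gt0.
  rewrite normrM (gtr0_norm ab0); apply: ler_wpM2l; first exact: ltW.
  rewrite normrM ger0_norm ?sqr_ge0// ler_piMr ?sqr_ge0//.
  by apply: tanh_ln_le1; exact: u0.
have cvgW (x : nat -> R) : (forall n, 0 < x n) -> (fun n => h (x n) ^+ 2 : R^o) @ \oo --> (0 : R^o) ->
   (fun n => W (x n) : R^o) @ \oo --> (0 : R^o).
  move=> x0 hc.
  have : (fun n => (a + 1 + a * b) * h (x n) ^+ 2 : R^o) @ \oo --> (0 : R^o).
    by rewrite -[X in _ --> X](mulr0 (a + 1 + a * b)); apply: (@cvgMl_tmp R nat).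
  move=> hc'; apply/cvgrPdist_le => ep ep0; move/cvgrPdist_le : hc' => /(_ _ ep0); apply: filterS => n.
  rewrite !sub0r !normrN => h'; apply: le_trans (HW _ (x0 n)) _.
  exact: le_trans (ler_norm _) h'.
have x0 n : 0 < n.+1%:R^-1 :> R by rewrite invr_gt0.
have y0 n : 0 < n.+1%:R :> R by [].
have := FTC_ge iD ltr01 DW DW cW cW (fun r rp => le r (proj1 (andP rp)))
  (fun r rp => le r (lt_le_trans ltr01 rp)) (cvgW _ x0 h2_at0) (cvgW _ y0 h2_aty).
rewrite subr0 sub0r subrr.
have -> : (\int[leb]_(r in pos) (c * P r - g r)%:E =
   \int[leb]_(r in pos) (c%:E * (P r)%:E) - \int[leb]_(r in pos) (g r)%:E)%E.
  by rewrite -(integralB mP icP profile_energy_integrable); apply: eq_integral => r _; rewrite EFinB EFinM.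
have -> : (\int[leb]_(r in pos) (c%:E * (P r)%:E) = (c * (beta_const a / b))%:E)%E.
  by rewrite (integralZl mP extremal_integrable) /= extremal_integral -EFinM.
have : (\int[leb]_(r in pos) (g r)%:E)%E \is a fin_num.
  by apply: integrable_fin_num => //; exact: profile_energy_integrable.
rewrite -/g; case: (\int[leb]_(r in pos) (g r)%:E)%E => // x _.
by rewrite -EFinB !lee_fin subr_ge0.
Qed.

End Truncated.
End ExtremalProfile.

(** * The inequality and its sharpness *)

Section SobolevInequality.
Context {R : realType} {n : nat} {G : groupSpaceType}.
Context {A : set (chart 'rV[R]_n G)} {E : 'rV[R]_n -> (G -> R) -> G -> R}.
Context {A0 : 'M[R]_n} {dil : R -> G -> G} {q : G -> R}.
Context {mu sigma : {measure set (borel G) -> \bar R}}.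
Local Notation Q := (\tr A0).
Hypothesis HG : homogeneous_group A E A0.
Hypothesis HD : induced_dilations A E A0 dil.
Hypothesis HQ : homogeneous_quasi_norm dil q.
Hypothesis HM : haar_measure mu.
Hypothesis HS : sphere_measure dil q Q mu sigma.
Hypothesis Q3 : 3 <= Q.
Let HL := hg_lie HG.
Let HA := lie_atlas HL.
Local Notation leb := (@lebesgue_measure R).
Local Notation pos := (`]0%R, +oo[%classic : set R).
Let Q1 : 1 <= Q. Proof. by apply: le_trans Q3; rewrite ler1n. Qed.
Let cq : forall rho : R, compact [set x | q x <= rho].
Proof. by move=> rho; exact: (@compact_qball R n G A E A0 dil HG HD q HQ rho). Qed.
Arguments cq : clear implicits.
Let ar : R := sphere_area q sigma.
Let ar0 : 0 < ar := area_gt0 HQ HM HS cq Q1.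
Local Notation eu := (eulerR (dil := dil)).
Local Notation tame := (tame (A := A) (q := q)).
Local Notation sint := (sint (dil := dil) (q := q) (sigma := sigma)).
Local Notation mean := (mean (dil := dil) (q := q) (sigma := sigma)).
Local Notation prof := (prof (A0 := A0) (dil := dil) (q := q) (sigma := sigma)).
Let Q0 : 0 < Q. Proof. exact: lt_le_trans Q3. Qed.
Let Qm2 : 0 < Q - 2. Proof. by rewrite subr_gt0 (lt_le_trans _ Q3)// ltr_nat. Qed.
Let a := (Q - 2) / 2.
Let c := a^-1.
Let p := 2 * Q / (Q - 2).
Let a0 : 0 < a. Proof. by rewrite divr_gt0. Qed.
Let c0 : 0 < c. Proof. by rewrite invr_gt0. Qed.
Let p0 : 0 < p. Proof. by rewrite divr_gt0// mulr_gt0. Qed.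
Let pE : p = 2 * (1 + c). Proof. by rewrite /p /c /a; field; rewrite gt_eqF. Qed.
Let Qa : Q = 2 * (a + 1). Proof. by rewrite /a; field. Qed.

Lemma normc2 (z : R[i]) : normc z ^+ 2 = complex.Re z * complex.Re z + complex.Im z * complex.Im z.
Proof. by case: z => x y /=; rewrite sqr_sqrtr ?addr_ge0 ?sqr_ge0// !expr2. Qed.

Lemma normc_ge0 (z : R[i]) : 0 <= normc z.
Proof. by case: z => x y; exact: sqrtr_ge0. Qed.

Lemma Cc_infty_tame (f : G -> R[i]) : Cc_infty A f -> exists rho,
  tame rho (fun x => complex.Re (f x)) /\ tame rho (fun x => complex.Im (f x)).
Proof.
move=> [sr si cK]; set K := closure _ in cK.
have [rho qr] : exists rho, forall x, K x -> q x <= rho.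
  have [K0|/set0P/negP/negPn/eqP K0] := pselect (K !=set0); last first.
    by exists 0 => x; rewrite K0.
  have [|z _ Hz] := @compact_EVT_max G R q K K0 cK.
    by apply: continuous_subspaceT => x; exact: (@q_continuous R G dil q HQ x).
  by exists (q z) => x Kx; apply: Hz; exact/mem_set.
have fK x : f x != 0 -> q x <= rho by move=> fx; apply: qr; exact: subset_closure.
exists rho; split; split=> // x nz; apply: fK; apply: contraNN nz => /eqP->; exact: eqxx.
Qed.

Section OneFunction.
Variables (f : G -> R[i]) (rho : R).
Let u x := complex.Re (f x).
Let w x := complex.Im (f x).
Hypothesis (tu : tame rho u) (tw : tame rho w).
Let ff x := u x * u x + w x * w x.
Let ee x := eu u x * eu u x + eu w x * eu w x.
Let v r := prof u r ^+ 2 + prof w r ^+ 2.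
Let teu : tame rho (eu u) := tame_euler HG HD HQ tu.
Let tew : tame rho (eu w) := tame_euler HG HD HQ tw.
Let tff : tame rho ff := tameD HG (tameM HG tu tu) (tameM HG tw tw).
Let tee : tame rho ee := tameD HG (tameM HG teu teu) (tameM HG tew tew).

Lemma energy_polar (delta : R) :
  (\int[mu]_x (normc (euler dil f x) ^+ 2)%:E - delta%:E * \int[mu]_x (normc (f x) ^+ 2)%:E =
   \int[leb]_(r in pos) ((sint ee r - delta * sint ff r) * r `^ (Q - 1))%:E)%E.
Proof.
have mP : measurable (pos : set (measurableTypeR R)) by exact: measurable_itv.
have -> : (\int[mu]_x (normc (euler dil f x) ^+ 2)%:E = \int[mu]_x (ee x)%:E)%E.
  by apply: eq_integral => x _; rewrite normc2.
have -> : (\int[mu]_x (normc (f x) ^+ 2)%:E = \int[mu]_x (ff x)%:E)%E.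
  by apply: eq_integral => x _; rewrite normc2.
rewrite (polar_tame HG HD HQ HM HS Q1 tff) (polar_tame HG HD HQ HM HS Q1 tee).
have i1 := sint_integrable HG HD HQ HM HS Q1 tee.
have i2 := sint_integrable HG HD HQ HM HS Q1 tff.
rewrite -(integralZl mP i2) -(integralB mP i1 (integrableZl mP delta i2)).
apply: eq_integral => r _.
transitivity ((sint ee r * r `^ (Q - 1) - delta * (sint ff r * r `^ (Q - 1)))%:E); first by [].
by congr EFin; ring.
Qed.

Lemma mean_polar :
  (\int[mu]_x (q x `^ p * normc (spherical_mean dil q sigma f (q x)) `^ p)%:E =
   ar%:E * \int[leb]_(r in pos) (v r `^ (1 + c) / r)%:E)%E.
Proof.
pose m r := normc (spherical_mean dil q sigma f r).
have m2 r : m r ^+ 2 = mean u r ^+ 2 + mean w r ^+ 2 by rewrite /m normc2 !expr2.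
have m0 r : 0 <= m r by exact: normc_ge0.
have mp r : m r `^ p = (mean u r ^+ 2 + mean w r ^+ 2) `^ (1 + c).
  by rewrite -m2 -powR_mulrn// -powRrM pE.
pose g r := r `^ p * m r `^ p.
(* Measurability of [g] is available on the open half-line only. Cutting it off changes nothing at q
   x = 0, where the factor r^p vanishes already. *)
pose H := g \_ pos.
have Hq x : H (q x) = g (q x).
  rewrite /H patchE; case: ifPn => //; rewrite notin_setE /= in_itv /= andbT => /negP.
  rewrite -leNgt => q0; have -> : q x = 0 by apply/eqP; rewrite eq_le q0 (qnorm_ge0 HQ).
  by rewrite /g powR0 ?mul0r// gt_eqF.
have H0 r : 0 <= H r by rewrite /H patchE; case: ifPn => // _; rewrite mulr_ge0 ?powR_ge0.
have mP : measurable (pos : set (measurableTypeR R)) by exact: measurable_itv.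
have c1 : 0 < 1 + c by rewrite addr_gt0.
have mH : measurable_fun setT H.
  apply: (@measurable_restrictT _ _ (measurableTypeR R) (measurableTypeR R) pos g mP).1.
  apply: pos_measurable => r r0; apply: (@cvgM R R^o); first exact: powR_cont.
  have cm : {for r, continuous (fun r : R^o => mean u r ^+ 2 + mean w r ^+ 2 : R^o)}.
    have h1 := mean_cont HG HD HQ HM HS Q3 r0 tu; have h2 := mean_cont HG HD HQ HM HS Q3 r0 tw.
    by apply: (@cvgD _ R^o); apply: (@cvgM R R^o).
  have -> : (fun x : R^o => m x `^ p : R^o) =
     (fun y : R => `|y| `^ (1 + c)) \o (fun r => mean u r ^+ 2 + mean w r ^+ 2).
    by apply/funext => x; rewrite /= mp ger0_norm// addr_ge0 ?sqr_ge0.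
  rewrite mp -[X in _ --> X `^ _]ger0_norm ?addr_ge0 ?sqr_ge0//.
  apply: (@continuous_comp _ _ _ (fun r : R^o => mean u r ^+ 2 + mean w r ^+ 2 : R^o)
    (fun y : R^o => `|y| `^ (1 + c) : R^o)); first exact: cm.
  exact: normpowR_cont.
have Hs r : H r != 0 -> r <= rho.
  rewrite /H patchE; case: ifPn => [|_]; last by rewrite eqxx.
  rewrite inE /= in_itv /= andbT => r0; apply: contraNT; rewrite -ltNge => rr.
  by rewrite /g mp (mean_supp HQ tu)// (mean_supp HQ tw)// expr0n addr0 powR0 ?mulr0// gt_eqF.
have [C1 C10 uC] := mean_bound HG HD HQ HM HS Q3 tu.
have [C2 C20 wC] := mean_bound HG HD HQ HM HS Q3 tw.
have sqle (x C : R) : `|x| <= C -> x ^+ 2 <= C ^+ 2.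
  by move=> h; rewrite -real_normK ?num_real// lerXn2r ?nnegrE// (le_trans _ h).
have Hb r : `|H r| <= rho `^ p * (C1 ^+ 2 + C2 ^+ 2) `^ (1 + c).
  have [->|nz] := eqVneq (H r) 0; first by rewrite normr0 mulr_ge0 ?powR_ge0.
  have rr := Hs r nz; rewrite ger0_norm//; move: nz.
  rewrite /H patchE; case: ifPn => [|_]; last by rewrite eqxx.
  rewrite inE /= in_itv /= andbT => r0 _; rewrite /g mp; apply: ler_pM; rewrite ?powR_ge0//.
    by rewrite ge0_ler_powR ?nnegrE ?(ltW p0) ?(ltW r0) ?(le_trans (ltW r0) rr).
  rewrite ge0_ler_powR ?nnegrE ?(ltW c1) ?addr_ge0 ?sqr_ge0//.
  by rewrite lerD// sqle ?uC ?wC.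
have mHq : measurable_fun setT ((H \o q) : borel G -> R).
  exact: measurableT_comp mH (q_measurable HQ).
have iH : mu.-integrable setT (EFin \o (fun x : borel G => H (q x))).
  apply: (integrable_supp HQ HM cq mHq (fun x => Hb (q x))).
  by move=> x; exact: Hs.
have -> : (\int[mu]_x (q x `^ p * normc (spherical_mean dil q sigma f (q x)) `^ p)%:E =
   \int[mu]_x (H (q x))%:E)%E by apply: eq_integral => x _; rewrite Hq.
rewrite (polar_radial HQ HS mH H0 iH) (sigma_sphereE HQ HM HS cq Q1) muleC; congr (_ * _)%E.
apply: eq_integral => r; rewrite inE /= in_itv /= andbT => r0; congr EFin.
rewrite /H patchE mem_set /= ?in_itv /= ?r0// /g mp /v /prof.
have -> : (r `^ (Q / 2) * mean u r) ^+ 2 + (r `^ (Q / 2) * mean w r) ^+ 2 =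
  (r `^ (Q / 2)) ^+ 2 * (mean u r ^+ 2 + mean w r ^+ 2).
  by move: (mean u r) (mean w r) (r `^ _) => x y z; ring.
rewrite powRM ?sqr_ge0 ?addr_ge0 ?sqr_ge0//.
rewrite -[(r `^ (Q / 2)) ^+ 2]powR_mulrn ?powR_ge0// -!powRrM.
have -> : r^-1 = r `^ (-1) by rewrite powR_inv1// ltW.
(* The exponents p + Q - 1 and Q(1+c) - 1 agree because p = Q c. *)
rewrite mulrAC [RHS]mulrAC -!powRD ?(gt_eqF r0) ?implybT//.
by congr (_ `^ _ * _); rewrite pE /c Qa; field; rewrite gt_eqF.
Qed.

Lemma sobolev_tame (delta : R) : delta < Q ^+ 2 / 4 ->
  euler_sobolev_ineq dil q mu sigma p delta (sobC a (Num.sqrt (Q ^+ 2 / 4 - delta)) ar) f.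
Proof.
move=> dQ; rewrite /euler_sobolev_ineq energy_polar mean_polar.
set kap := Num.sqrt _.
have kap0 : 0 < kap by rewrite sqrtr_gt0 subr_gt0.
have ip := profile_integrable HG HD HQ HM HS Q3 tu tw c0.
have v0 r : 0 <= v r by rewrite addr_ge0 ?sqr_ge0.
have : (0 <= \int[leb]_(r in pos) (v r `^ (1 + c) / r)%:E)%E.
  apply: integral_ge0 => r; rewrite /= in_itv /= andbT => r0.
  by rewrite lee_fin divr_ge0 ?powR_ge0 ?(ltW r0).
have : (\int[leb]_(r in pos) (v r `^ (1 + c) / r)%:E)%E \is a fin_num.
  by apply: integrable_fin_num => //; exact: ip.
set X := (\int[leb]_(r in pos) (v r `^ (1 + c) / r)%:E)%E => Xf X0.
have p2 : 2 / p = a / (a + 1).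
  rewrite pE /c; field; rewrite !gt_eqF// ?addr_gt0//.
(* If the profile vanishes identically, the right side is zero and only nonnegativity of the energy
   is left. *)
have [[r1 r10 vr1]|nz] := pselect (exists2 r, 0 < r & v r != 0); last first.
  have -> : X = 0%E.
    apply: integral0_eq => r; rewrite /= in_itv /= andbT => r0.
    have [->|h] := eqVneq (v r) 0; last by case: nz; exists r.
    by rewrite powR0 ?mul0r// gt_eqF// addr_gt0.
  rewrite mule0 poweR_EFin powR0 ?mule0; first exact: (energy_ge0 HG HD HQ HM HS Q3 tu tw dQ).
  by rewrite gt_eqF// divr_gt0.
have [M M0 le] := nagy_tame HG HD HQ HM HS Q3 tu tw dQ r10 vr1.
apply: le_trans le; rewrite -/a -/c -/kap -/ar -/X.
have ij : leb.-integrable pos (EFin \o sech_kernel a).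
  apply/integrableP; split.
    apply/measurable_EFinP; apply: pos_measurable => r r0; apply: (@cvgM R R^o).
      apply: (@continuous_comp _ _ _ (sech2_ln : R^o -> R^o) (fun x : R^o => x `^ (a + 1) : R^o)).
        exact: sech2_ln_continuous.
      by apply: powR_cont; exact: sech2_ln_gt0.
    by apply: cvgV; [rewrite gt_eqF// mulr_gt0|apply: (@cvgMl_tmp R R^o); exact: cvg_id].
  have -> : (\int[leb]_(r in pos) `|(EFin \o sech_kernel a) r| = \int[leb]_(r in pos) (sech_kernel a r)%:E)%E.
    apply: eq_integral => r; rewrite inE /= in_itv /= andbT => r0.
    by rewrite ger0_norm// divr_ge0 ?powR_ge0// mulr_ge0// ltW.
  by rewrite sech_kernel_int// ltry.
have := sech_kernel_theta a0 ij; rewrite sech_kernel_int// lee_fin => JJ.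
case: X Xf X0 => // Y _; rewrite lee_fin => Y0.
rewrite -!EFinM -EFinD lee_fin p2.
exact: sobolev_interpolation.
Qed.

End OneFunction.

Lemma sint_le rho w K r : 0 < r -> tame rho w -> (forall y, q y = r -> w y <= K) -> sint w r <= K * ar.
Proof.
move=> r0 tw wK; have mS : measurable (quasi_sphere q : set (borel G)) := sphere_measurable HQ.
have := @le_Rintegral _ _ _ sigma _ (fun y => w (dil r y)) (fun=> K) mS.
rewrite Rintegral_cst// (sigma_sphereE HQ HM HS cq Q1) /=; apply.
- exact: (sphere_integrable HG HD HQ HM HS Q1 r0 tw).
- exact: (sphere_cst_integrable HG HD HQ HM HS Q1).
- by move=> y Sy; apply: wK; rewrite (qnorm_dil HQ)// Sy mulr1.
Qed.

Lemma sint_ge rho w K r : 0 < r -> tame rho w -> (forall y, q y = r -> K <= w y) -> K * ar <= sint w r.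
Proof.
move=> r0 tw wK; have := @sint_le rho (fun x => -1 * w x) (- K) r r0 (tameZ HG (-1) tw).
rewrite (sintZ HG HD HQ HM HS Q1 _ r0 tw) mulN1r mulNr lerN2; apply => y /wK.
by rewrite mulN1r lerN2.
Qed.

Let kC (delta : R) := Num.sqrt (Q ^+ 2 / 4 - delta).

(* The profile is [r^(-Q/2)] times the truncation at height [e] of the extremal function; [t] bounds
   the error made when replacing it by a smooth function on the group. *)
Let zz kap e t r := (r `^ (Q / 2) * posp (profile a kap e (ln r) - t)) ^+ 2.

(** Two one-sided estimates pass from the smooth approximation to the profile: its energy exceeds
    that of the profile by a controlled amount, and the absolute value of its spherical mean is at
    least the positive part of the profile minus [t]. *)
Lemma sharp_step (delta C' e t : R) : 0 <= delta -> delta < Q ^+ 2 / 4 -> 0 < e -> 0 < t -> 0 < C' ->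
  (forall f, Cc_infty A f -> euler_sobolev_ineq dil q mu sigma p delta C' f) ->
  exists Z, [/\ leb.-integrable pos (EFin \o (fun r => zz (kC delta) e t r `^ (1 + c) / r)),
   (\int[leb]_(r in pos) (zz (kC delta) e t r `^ (1 + c) / r)%:E = Z%:E)%E &
   C' * (ar * Z) `^ (a / (a + 1)) <=
     ar * (a * (a + 1) * (kC delta / a) ^+ 2 * (beta_const a / (kC delta / a))) + t].
Proof.
move=> d0 dQ e0 t0 C0 H; rewrite /zz; set kap := kC delta.
have kap0 : 0 < kap by rewrite sqrtr_gt0 subr_gt0.
have kap2 : kap ^+ 2 = Q ^+ 2 / 4 - delta by rewrite sqr_sqrtr// ltW// subr_gt0.
have dE : (2 * (a + 1)) ^+ 2 / 4 - kap ^+ 2 = delta by rewrite kap2 -Qa; ring.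
pose k := profile a kap e; pose dk := dprofile a kap e.
have kD s : is_derive (s : R^o) (1 : R^o) (k : R^o -> R^o) (dk s) by exact: is_derive_profile.
have ck : continuous (k : R^o -> R^o) by move=> s; exact: derive_continuous (kD s).
have cdk : continuous (dk : R^o -> R^o) by exact: dprofile_continuous.
have [L L0 Ls] := profile_supp a0 kap0 e0.
have kL s : k s != 0 -> `|s| <= L by move=> h; apply: Ls; left.
have dkL s : dk s != 0 -> `|s| <= L by move=> h; apply: Ls; right.
have inI (g : R -> R) : (forall s, g s != 0 -> `|s| <= L) -> forall s, g s != 0 -> (`[- L, L]%classic : set R^o) s.
  by move=> gL s /gL; rewrite ler_norml /= in_itv.
have [M0 M00 kM] := compact_bounded_fun ck (@segment_compact R (- L) L) (inI k kL).
have [M1 M10 dkM] := compact_bounded_fun cdk (@segment_compact R (- L) L) (inI dk dkL).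
pose a2 := expR (L + 2).
(* The polar weight, cut at the radius beyond which both the approximation and the profile vanish;
   the pointwise energy error is multiplied by it and then integrates to a finite amount. *)
pose rho (r : R) : R := if r <= a2 then r `^ (Q - 1) else 0.
have Q10 : 0 <= Q - 1 by rewrite subr_ge0.
have rho0 r : 0 <= rho r by rewrite /rho; case: ifP => // _; exact: powR_ge0.
have irho : leb.-integrable pos (EFin \o rho).
  apply: (@pos_integrable_bounded _ rho a2 (a2 `^ (Q - 1))).
  - rewrite /rho; apply: measurable_fun_if => //.
    + by apply: measurable_fun_ler => //.
    + exact: measurable_funTS (measurable_powR _).
  - move=> r r0; rewrite ger0_norm// /rho; case: ifPn => [h|_]; last exact: powR_ge0.
    by rewrite ge0_ler_powR ?nnegrE ?expR_ge0// ltW.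
  - by move=> r r0 ra; rewrite /rho leNgt ra.
pose D := \int[leb]_(r in pos) rho r.
have D0 : 0 <= D by apply: Rintegral_ge0 => r _.
(* For an error [eta] <= 1, the square of the Euler derivative grows by at most (2 M1 + 1) eta and
   the square of the function drops by at most 2 M0 eta, the latter weighted by [delta]. *)
pose c1 := 2 * M1 + 1 + delta * (2 * M0).
have c10 : 0 < c1 by rewrite ltr_wpDr ?mulr_ge0// ltr_wpDl// mulr_ge0.
have B0 : 0 < ar * c1 * D + 1 by rewrite ltr_wpDl// mulr_ge0// mulr_ge0// ltW.
(* Bounded by [t] for the spherical means, by 1 for the quadratic error term, and by the last
   quotient to keep the total energy error below [t]. *)
pose eta := Num.min t (Num.min 1 (t / (ar * c1 * D + 1))).
have eta0 : 0 < eta by rewrite !lt_min t0 ltr01 divr_gt0.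
have etat : eta <= t by rewrite ge_min lexx.
have eta1 : eta <= 1 by rewrite !ge_min lexx orbT.
have etaD : ar * (c1 * eta) * D <= t.
  have : eta * (ar * c1 * D + 1) <= t by rewrite -ler_pdivlMr// !ge_min lexx !orbT.
  by apply: le_trans; rewrite mulrDr mulr1 ler_wpDr ?(ltW eta0)// le_eqVlt; apply/orP; left; apply/eqP; ring.
have [f0 [sf fs fa]] := radial_approx HG HD HQ eta0 L0 kD kL dkL kM dkM
  (fun ep ep0 => continuous_supp_uniform cdk dkL ep0).
have tf : tame a2 f0 by split=> // x /fs/andP[_ /ltW].
have tz : tame a2 (fun=> 0) by split; [exact: (smooth_cst HA)|move=> x; rewrite eqxx].
have tef := tame_euler HG HD HQ tf.
pose f x : R[i] := Complex (f0 x) 0.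
have Hf : Cc_infty A f.
  split; [exact: sf|exact: (smooth_cst HA)|].
  apply: subclosed_compact (cq a2) _; first exact: closed_closure.
  have cl : closed [set x | q x <= a2].
    apply: (@closed_comp _ _ (q : G -> R^o) [set z : R^o | z <= a2]); last exact: closed_le.
    by move=> x _; exact: (@q_continuous R G dil q HQ x).
  rewrite [X in _ `<=` X](closure_id _).1//; apply: closure_subset => x /= fx.
  by apply: tf.2; apply: contraNN fx => /eqP h; rewrite /f h.
have := H f Hf; rewrite /euler_sobolev_ineq.
rewrite (energy_polar (f := f) tf tz) (mean_polar (f := f) tf tz) /=.
have ez x : eu (fun=> 0) x = 0 by rewrite /eulerR derive1E; exact: derive_cst.
pose ee x := eu f0 x * eu f0 x; pose ff x := f0 x * f0 x.
have tee : tame a2 ee := tameM HG tef tef; have tff : tame a2 ff := tameM HG tf tf.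
have eeE : (fun x => eu f0 x * eu f0 x + eu (fun=> 0) x * eu (fun=> 0) x) = ee.
  by apply/funext => x; rewrite ez mulr0 addr0.
have ffE : (fun x => f0 x * f0 x + 0 * 0) = ff by apply/funext => x; rewrite mulr0 addr0.
rewrite eeE ffE.
have iF := energy_integrable HG HD HQ HM HS Q3 delta tf tz; rewrite eeE ffE in iF.
pose g r := (dk (ln r) ^+ 2 - delta * k (ln r) ^+ 2) * r `^ (Q - 1).
have ig := profile_energy_integrable a0 kap0 e0; rewrite dE -Qa -/k -/dk in ig.
have gle := profile_energy_le a0 kap0 e0; rewrite dE -Qa -/k -/dk in gle.
have ln_ge r : a2 < r -> L < `|ln r|.
  move=> ar2; apply: lt_le_trans (ler_norm _); rewrite -[L]expRK ltr_ln ?posrE ?expR_gt0//.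
    by apply: le_lt_trans ar2; rewrite ler_expR lerDl.
  by apply: lt_trans ar2; exact: expR_gt0.
have Fle r : 0 < r -> (sint ee r - delta * sint ff r) * r `^ (Q - 1) <=
    ar * g r + ar * (c1 * eta) * rho r.
  move=> r0; have [ra|ra] := leP r a2; last first.
    rewrite (sint_supp HQ tee ra r0) (sint_supp HQ tff ra r0) mulr0 subrr mul0r.
    have gt0 : g r = 0.
      have Lr := ln_ge r ra; rewrite /g.
      have -> : dk (ln r) = 0 by apply/eqP; apply: contraTT Lr => /dkL; rewrite -leNgt.
      have -> : k (ln r) = 0 by apply/eqP; apply: contraTT Lr => /kL; rewrite -leNgt.
      by rewrite expr0n mulr0 subrr mul0r.
    by rewrite gt0 /rho [r <= a2]leNgt ra !mulr0 addr0.
  pose W x := ee x + (- delta) * ff x.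
  have tW : tame a2 W := tameD HG tee (tameZ HG (- delta) tff).
  have WE : sint W r = sint ee r - delta * sint ff r.
    rewrite (sintD HG HD HQ HM HS Q1 r0 tee (tameZ HG (- delta) tff)).
    by rewrite (sintZ HG HD HQ HM HS Q1 _ r0 tff) mulNr.
  have Wle : sint W r <= (dk (ln r) ^+ 2 - delta * k (ln r) ^+ 2 + c1 * eta) * ar.
    apply: (sint_le r0 tW) => y qy; have qy0 : 0 < q y by rewrite qy.
    have [h1 h2] := fa y qy0; rewrite qy in h1 h2.
    have := kM (ln r); have := dkM (ln r); rewrite /W /ee /ff.
    move: h1 h2; move: (f0 y) (eu f0 y) (k (ln r)) (dk (ln r)) => F E' k' d' h1 h2 h3 h4.
    have e1 : E' * E' <= d' ^+ 2 + (2 * M1 + 1) * eta.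
      have -> : E' * E' = d' ^+ 2 + (2 * (d' * (E' - d')) + (E' - d') * (E' - d')) by ring.
      have -> : (2 * M1 + 1) * eta = 2 * (M1 * eta) + eta by ring.
      rewrite lerD2l; apply: lerD.
        rewrite ler_wpM2l//; apply: le_trans (ler_norm _) _.
        by rewrite normrM; exact: ler_pM.
      apply: le_trans (ler_norm _) _; rewrite normrM.
      by apply: le_trans (ler_pM _ _ h2 h2) _ => //; rewrite ler_piMl// ltW.
    have e2 : k' ^+ 2 - 2 * M0 * eta <= F * F.
      have -> : F * F = k' ^+ 2 + (2 * (k' * (F - k')) + (F - k') ^+ 2) by ring.
      rewrite lerD2l; apply: ler_wpDr; first exact: sqr_ge0.
      rewrite lerNl -mulrN -mulrA ler_wpM2l//; apply: le_trans (ler_norm _) _.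
      by rewrite normrN normrM; exact: ler_pM.
    have := ler_wpM2l d0 e2; rewrite /c1; move: e1.
    have -> : (2 * M1 + 1 + delta * (2 * M0)) * eta = (2 * M1 + 1) * eta + delta * (2 * M0 * eta) by ring.
    rewrite mulrBr mulNr; move: (E' * E') (F * F) (delta * (2 * M0 * eta)) ((2 * M1 + 1) * eta) => *; lra.
  rewrite -WE; apply: le_trans (ler_wpM2r (powR_ge0 r (Q - 1)) Wle) _.
  by rewrite /g /rho ra le_eqVlt; apply/orP; left; apply/eqP; ring.
have mP : measurable (pos : set (measurableTypeR R)) by exact: measurable_itv.
set RHS := ar * _ + t.
have FI : (\int[leb]_(r in pos) ((sint ee r - delta * sint ff r) * r `^ (Q - 1))%:E <= RHS%:E)%E.
  have i1 := integrableZl mP ar ig; have i2 := integrableZl mP (ar * (c1 * eta)) irho.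
  apply: (@le_trans _ _ (\int[leb]_(r in pos) (ar * g r + ar * (c1 * eta) * rho r)%:E)%E).
    apply: (le_integral mP iF (integrableD mP i1 i2)).
    by move=> r; rewrite inE /= in_itv /= andbT => r0; rewrite lee_fin Fle.
  have -> : (\int[leb]_(r in pos) (ar * g r + ar * (c1 * eta) * rho r)%:E =
     ar%:E * \int[leb]_(r in pos) (g r)%:E + (ar * (c1 * eta))%:E * \int[leb]_(r in pos) (rho r)%:E)%E.
    by rewrite -(integralZl mP ig) -(integralZl mP irho) -(integralD mP i1 i2).
  have -> : (\int[leb]_(r in pos) (rho r)%:E = D%:E)%E.
    by rewrite /D /Rintegral fineK//; apply: integrable_fin_num => //; exact: irho.
  rewrite /RHS EFinD; apply: leeD; last by rewrite -EFinM lee_fin.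
  by rewrite EFinM; apply: lee_wpmul2l => //; rewrite lee_fin ltW.
have iv := profile_integrable HG HD HQ HM HS Q3 tf tz c0.
pose v r := prof f0 r ^+ 2 + prof (fun=> 0) r ^+ 2.
pose z r := (r `^ (Q / 2) * posp (k (ln r) - t)) ^+ 2.
have z0 r : 0 <= z r by exact: sqr_ge0.
have zle r : 0 < r -> z r <= v r.
  move=> r0; rewrite /v; apply: ler_wpDr; first exact: sqr_ge0.
  rewrite -[leRHS]real_normK ?num_real//.
  rewrite lerXn2r ?nnegrE ?mulr_ge0 ?powR_ge0 ?posp_ge0//.
  rewrite /prof normrM ger0_norm ?powR_ge0// ler_wpM2l ?powR_ge0//.
  rewrite ge_max normr_ge0 /=; apply: le_trans (ler_norm _).
  rewrite /mean -/ar mulrC ler_pdivlMr//.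
  apply: le_trans (sint_ge r0 tf (K := k (ln r) - eta) _).
    by rewrite ler_wpM2r ?(ltW ar0)// lerD2l lerN2.
  move=> y qy; have qy0 : 0 < q y by rewrite qy.
  have [h1 _] := fa y qy0; rewrite qy ler_norml in h1.
  by move: h1 => /andP[h1 _]; rewrite -[leRHS](subrK (k (ln r))) [leLHS]addrC lerD2r.
have c1' : 0 < 1 + c by rewrite addr_gt0.
have pz r : 0 < r -> z r `^ (1 + c) / r <= v r `^ (1 + c) / r.
  move=> r0; rewrite ler_wpM2r ?invr_ge0 ?(ltW r0)//.
  by rewrite ge0_ler_powR ?nnegrE ?(ltW c1') ?zle// (le_trans (z0 r) (zle r r0)).
have z_cont r : 0 < r -> {for r, continuous (z : R^o -> R^o)}.
  move=> r0.
  have h1 : {for r, continuous (fun r : R^o => r `^ (Q / 2) * posp (k (ln r) - t) : R^o)}.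
    apply: (@cvgM R R^o); first exact: powR_cont.
    apply: (@continuous_comp _ _ _ (fun r : R^o => k (ln r) - t : R^o) (posp : R^o -> R^o)); last exact: posp_continuous.
    apply: (@cvgB _ R^o); last exact: cvg_cst.
    apply: (@continuous_comp _ _ _ (@ln R : R^o -> R^o) (k : R^o -> R^o)); last exact: ck.
    exact: continuous_ln.
  by apply: (@cvgM R R^o).
have zp_cont r : 0 < r -> {for r, continuous (fun r : R^o => z r `^ (1 + c) / r : R^o)}.
  move=> r0; have h1 : {for r, continuous (fun r : R^o => z r `^ (1 + c) : R^o)}.
    have -> : (fun r : R^o => z r `^ (1 + c) : R^o) = (fun y : R => `|y| `^ (1 + c)) \o z.
      by apply/funext => x; rewrite /= ger0_norm.
    apply: (@continuous_comp _ _ _ (z : R^o -> R^o) (fun y : R^o => `|y| `^ (1 + c) : R^o)).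
      exact: z_cont.
    exact: normpowR_cont.
  by apply: (@cvgM R R^o); [exact: h1|apply: cvgV; [rewrite gt_eqF|exact: cvg_id]].
have iz : leb.-integrable pos (EFin \o (fun r => z r `^ (1 + c) / r)).
  apply: (le_integrable mP _ _ iv).
    by apply/measurable_EFinP; exact: pos_measurable zp_cont.
  move=> r; rewrite /= in_itv /= andbT => r0; rewrite lee_fin.
  by rewrite !ger0_norm ?divr_ge0 ?powR_ge0 ?(ltW r0)// pz.
have ivf : (\int[leb]_(r in pos) (v r `^ (1 + c) / r)%:E)%E \is a fin_num.
  by apply: integrable_fin_num => //; exact: iv.
have izf : (\int[leb]_(r in pos) (z r `^ (1 + c) / r)%:E)%E \is a fin_num.
  by apply: integrable_fin_num => //; exact: iz.
have zv : (\int[leb]_(r in pos) (z r `^ (1 + c) / r)%:E <= \int[leb]_(r in pos) (v r `^ (1 + c) / r)%:E)%E.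
  apply: (le_integral mP iz iv).
  by move=> r; rewrite inE /= in_itv /= andbT => r0; rewrite lee_fin pz.
have z0' : (0 <= \int[leb]_(r in pos) (z r `^ (1 + c) / r)%:E)%E.
  by apply: integral_ge0 => r; rewrite /= in_itv /= andbT => r0; rewrite lee_fin divr_ge0 ?powR_ge0 ?(ltW r0).
have p2 : 2 / p = a / (a + 1) by rewrite pE /c; field; rewrite !gt_eqF// ?addr_gt0.
move: zv z0' ivf izf.
rewrite p2 -/(v _).
case: (\int[leb]_(r in pos) (v r `^ (1 + c) / r)%:E)%E => // Y.
case: (\int[leb]_(r in pos) (z r `^ (1 + c) / r)%:E)%E => // Z.
rewrite !lee_fin => ZY Z0 _ _ /le_trans/(_ FI); rewrite -!EFinM lee_fin => le.
exists Z; split=> //; apply: le_trans le; rewrite ler_wpM2l ?(ltW C0)//.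
have ale : 0 <= a / (a + 1) by apply: divr_ge0; apply: ltW => //; exact: addr_gt0.
apply: (ge0_ler_powR ale); rewrite ?nnegrE.
- by apply: mulr_ge0 => //; exact: ltW.
- by apply: mulr_ge0; [exact: ltW|exact: le_trans Z0 ZY].
- by apply: ler_wpM2l => //; exact: ltW.
Qed.

(** The energy bound is the same for all truncations up to the tolerance, so only the p-integrals
    need a limit; they increase to that of the extremal profile. In the limit the inequality for
    [C'] is the one compared with [sobC] in [sobolev_extremal]. *)
Lemma sobolev_sharp (delta C' : R) : 0 <= delta -> delta < Q ^+ 2 / 4 ->
  (forall f, Cc_infty A f -> euler_sobolev_ineq dil q mu sigma p delta C' f) ->
  C' <= sobC a (kC delta) ar.
Proof.
move=> d0 dQ H; set kap := kC delta.
have kap0 : 0 < kap by rewrite sqrtr_gt0 subr_gt0.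
have [C0|C0] := leP C' 0; first by apply: le_trans C0 (ltW (sobC_gt0 a0 kap0 ar0)).
apply: (sobolev_extremal a0 kap0 ar0).
set X := beta_const a / (kap / a); set B := (X in _ <= X).
pose e_ (m : nat) : R := m.+1%:R^-1.
have e_0 m : 0 < e_ m by rewrite invr_gt0.
(* Truncation height and tolerance are both 1/(m+1), so that a single monotone limit removes
   both. *)
have /choice[Z ZP] : forall m, exists Z, _ := fun m => sharp_step d0 dQ (e_0 m) (e_0 m) C0 H.
pose z m r := zz kap (e_ m) (e_ m) r.
pose P r := extremal a kap r `^ (2 * (1 + c)) / r.
have c1 : 0 < 1 + c by rewrite addr_gt0.
have z_cvg r : 0 < r -> (fun m => z m r `^ (1 + c) / r : R^o) @ \oo --> (P r : R^o).
  move=> r0; set h := extremal a kap r; have h0 : 0 < h by exact: extremal_gt0.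
  set x := expR (- (a + 1) * ln r).
  have xr : r `^ (Q / 2) * x = 1.
    rewrite /x; have -> : expR (- (a + 1) * ln r) = r `^ (- (a + 1)) by rewrite /powR gt_eqF.
    rewrite -powRD ?(gt_eqF r0) ?implybT//; have -> : Q / 2 + - (a + 1) = 0 by rewrite Qa; field.
    by rewrite powRr0.
  (* The integrand at a fixed [r] as a function of the common parameter, meaningful and continuous
     at 0, where its value is the extremal integrand. *)
  pose Psi (e : R) := `|(r `^ (Q / 2) * posp (x * (posp (h - e) ^+ 2 / h) - e)) ^+ 2| `^ (1 + c) / r.
  have ->  : (fun m => z m r `^ (1 + c) / r : R^o) = (fun m => Psi (e_ m)).
    apply/funext => m.
    have kE : profile a kap (e_ m) (ln r) = x * (posp (h - e_ m) ^+ 2 / h).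
      by rewrite /profile /trunc_fun lnK ?posrE.
    by rewrite /z /zz kE /Psi [`|_|]ger0_norm; last exact: sqr_ge0.
  have -> : P r = Psi 0.
    rewrite /Psi subr0 subr0 (pospE (ltW h0)) ger0_norm ?sqr_ge0//.
    have -> : h ^+ 2 / h = h by rewrite expr2 mulfK// gt_eqF.
    rewrite pospE ?mulr_ge0 ?expR_ge0 ?(ltW h0)// mulrA xr mul1r.
    have -> : h ^+ 2 = h `^ 2 by rewrite powR_mulrn// ltW.
    by rewrite -powRrM.
  have cPsi : {for (0 : R^o), continuous (Psi : R^o -> R^o)}.
    have c1' : {for (0 : R^o), continuous (fun e : R^o => h - e : R^o)}.
      by apply: (@cvgB _ R^o); [exact: cvg_cst|exact: cvg_id].
    have c2 : {for (0 : R^o), continuous (fun e : R^o => posp (h - e) : R^o)}.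
      apply: (@continuous_comp _ _ _ (fun e : R^o => h - e : R^o) (posp : R^o -> R^o)) => //.
      exact: posp_continuous.
    have c3 : {for (0 : R^o), continuous (fun e : R^o => x * (posp (h - e) ^+ 2 / h) - e : R^o)}.
      apply: (@cvgB _ R^o); last exact: cvg_id.
      apply: (@cvgMl_tmp R R^o); apply: (@cvgMr_tmp R R^o).
      by apply: (@cvgM R R^o); exact: c2.
    have c4 : {for (0 : R^o), continuous (fun e : R^o => posp (x * (posp (h - e) ^+ 2 / h) - e) : R^o)}.
      apply: (@continuous_comp _ _ _ (fun e : R^o => x * (posp (h - e) ^+ 2 / h) - e : R^o) (posp : R^o -> R^o)) => //.
      exact: posp_continuous.
    have c5 : {for (0 : R^o), continuous (fun e : R^o => (r `^ (Q / 2) * posp (x * (posp (h - e) ^+ 2 / h) - e)) ^+ 2 : R^o)}.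
      by apply: (@cvgM R R^o); apply: (@cvgMl_tmp R R^o); exact: c4.
    apply: (@cvgMr_tmp R R^o).
    apply: (@continuous_comp _ _ _ (fun e : R^o => (r `^ (Q / 2) * posp (x * (posp (h - e) ^+ 2 / h) - e)) ^+ 2 : R^o)
      (fun y : R^o => `|y| `^ (1 + c) : R^o)) => //.
    exact: normpowR_cont.
  exact: (cvg_comp _ _ (@cvg_harmonic R) cPsi).
have z_nd r : 0 < r -> {homo (fun m => z m r `^ (1 + c) / r) : m m' / (m <= m')%N >-> m <= m'}.
  move=> r0 m m' mm; have ee : e_ m' <= e_ m by rewrite lef_pV2 ?posrE// ler_nat.
  rewrite ler_wpM2r ?invr_ge0 ?(ltW r0)// ge0_ler_powR ?nnegrE ?sqr_ge0 ?(ltW c1)//.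
  rewrite /z /zz lerXn2r ?nnegrE ?mulr_ge0 ?powR_ge0 ?posp_ge0//.
  rewrite ler_wpM2l ?powR_ge0// posp_le// lerB// /profile ler_wpM2l ?expR_ge0//.
  have h0 : 0 < extremal a kap (expR (ln r)) by rewrite extremal_gt0// expR_gt0.
  rewrite /trunc_fun ler_wpM2r ?invr_ge0 ?(ltW h0)// lerXn2r ?nnegrE ?posp_ge0//.
  by rewrite posp_le// lerD2l lerN2.
have mP : measurable (pos : set (measurableTypeR R)) by exact: measurable_itv.
have PX : (\int[leb]_(r in pos) (P r)%:E = X%:E)%E.
  rewrite -(extremal_integral a0 kap0); apply: eq_integral => r.
  by rewrite inE /= in_itv /= andbT => r0; rewrite /P extremal_powR.
have Zcvg : (fun m => Z m : R^o) @ \oo --> (X : R^o).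
  apply: (@fine_cvg R nat \oo _ (fun m => (Z m)%:E)).
  rewrite -PX.
  have -> : (fun m => (Z m)%:E) = (fun m => \int[leb]_(r in pos) (z m r `^ (1 + c) / r)%:E)%E.
    by apply/funext => m; have [_ ->] := ZP m.
  have := @cvg_monotone_convergence _ _ R leb pos mP (fun m r => (z m r `^ (1 + c) / r)%:E).
  have -> : (\int[leb]_(r in pos) (P r)%:E = \int[leb]_(r in pos) limn (fun m => (z m r `^ (1 + c) / r)%:E))%E.
    apply: eq_integral => r; rewrite inE /= in_itv /= andbT => r0.
    by apply/esym/cvg_lim => //; apply: cvg_EFin; [exact: nearW|exact: z_cvg].
  apply.
  - by move=> m; have [iz _ _] := ZP m; exact: (measurable_int leb iz).
  - move=> m r; rewrite /= in_itv /= andbT => r0.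
    by rewrite lee_fin divr_ge0 ?powR_ge0 ?(ltW r0).
  - move=> r; rewrite /= in_itv /= andbT => r0 m m' mm.
    by rewrite lee_fin; exact: z_nd.
have X0 : 0 < X by apply: divr_gt0; [exact: beta_const_gt0|exact: divr_gt0].
have cL : (fun m => C' * (ar * Z m) `^ (a / (a + 1)) : R^o) @ \oo --> (C' * (ar * X) `^ (a / (a + 1)) : R^o).
  apply: (@cvgMl_tmp R nat).
  have c2 : (fun m => ar * Z m : R^o) @ \oo --> (ar * X : R^o) by apply: (@cvgMl_tmp R nat).
  exact: (cvg_comp _ _ c2 (@powR_cont R (a / (a + 1)) (ar * X) (mulr_gt0 ar0 X0))).
have cR : (fun m => B + e_ m : R^o) @ \oo --> (B : R^o).
  rewrite -[X in _ --> X]addr0; apply: (@cvgD _ R^o); first exact: cvg_cst.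
  exact: (@cvg_harmonic R).
apply: (ler_cvg_to cL cR); apply: nearW => m.
by have [_ _] := ZP m.
Qed.

End SobolevInequality.

Unset Implicit Arguments.

Theorem theorem4p12 (R : realType) (n : nat) (G : groupSpaceType)
    (A : set (chart 'rV[R]_n G)) (E : 'rV[R]_n -> (G -> R) -> G -> R)
    (A0 : 'M[R]_n) (dil : R -> G -> G) (q : G -> R)
    (mu sigma : {measure set (borel G) -> \bar R}) (delta : R)
    (Q := \tr A0) (p := 2 * Q / (Q - 2))
    (C := (Q ^+ 2 / 4 - delta) `^ ((Q - 1) / Q)
          / ((Q - 2) ^+ 2 / 4) `^ ((Q - 1) / Q)
          * S_const Q (sphere_area q sigma)) :
  homogeneous_group A E A0 ->
  induced_dilations A E A0 dil ->
  3 <= Q ->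
  homogeneous_quasi_norm dil q ->
  haar_measure mu ->
  sphere_measure dil q Q mu sigma ->
  0 <= delta -> delta < Q ^+ 2 / 4 ->
  (forall f : G -> R[i], Cc_infty A f ->
     euler_sobolev_ineq dil q mu sigma p delta C f) /\
  (forall C' : R,
     (forall f : G -> R[i], Cc_infty A f ->
        euler_sobolev_ineq dil q mu sigma p delta C' f) ->
     C' <= C).
Proof.
move=> HG HD Q3 HQ HM HS d0 dQ.
have Q1 : 1 <= Q by apply: le_trans Q3; rewrite ler1n.
have cq rho : compact [set x | q x <= rho].
  exact: (@compact_qball R n G A E A0 dil HG HD q HQ rho).
have s0 : 0 < sphere_area q sigma := area_gt0 HQ HM HS cq Q1.
have a0 : 0 < (Q - 2) / 2 by rewrite divr_gt0// subr_gt0 (lt_le_trans _ Q3)// ltr_nat.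
have k0 : 0 < Num.sqrt (Q ^+ 2 / 4 - delta) by rewrite sqrtr_gt0 subr_gt0.
(* The constant of the statement, rewritten with a = (Q-2)/2 and kap^2 = Q^2/4 - delta, is the one
   that the AM-GM step produces. *)
have CE : C = sobC ((Q - 2) / 2) (Num.sqrt (Q ^+ 2 / 4 - delta)) (sphere_area q sigma).
  have QE : 2 * ((Q - 2) / 2 + 1) = Q by field.
  by rewrite -(sobCE a0 k0 s0) QE sqr_sqrtr// subr_ge0 ltW.
rewrite CE; split=> [f Hf|C' H]; last exact: (sobolev_sharp HG HD HQ HM HS Q3 d0 dQ H).
have [rho [tu tw]] := Cc_infty_tame HQ Hf.
exact: (sobolev_tame HG HD HQ HM HS Q3 tu tw dQ).
Qed.
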